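(* Let $X=\{X_k:k\in\mathbb{Z}\}$ be a centered stationary Gaussian sequence with unit variance such that, for each $k$, $X_k=\int_{\mathbb{R}}K_k(s)\,dB_s$ for some $K_k\in L^2(\mathbb{R},\mathscr{B}(\mathbb{R}),dx)$, where $\{B_t\}_{t\in\mathbb{R}}$ is a two-sided Brownian motion. Set $\varrho(\nu)=E[X_0X_\nu]$ for $\nu\in\mathbb{Z}$ and assume $\sum_{\nu=-\infty}^{+\infty}|\varrho(\nu)|<\infty$. Let $$F_n=\frac{1}{\sqrt n}\sum_{k=1}^n\left(f(X_k)-E[f(X_k)]\right),$$ where $f:\mathbb{R}\to\mathbb{R}$ is of class $C^2$ with $E|f(N)|<\infty$ and $E|f''(N)|^4<\infty$ for $N\sim\mathcal{N}(0,1)$. Assume that $|K_k(x)|\leq g(k-x)$, where $g$ is such that $\int_{\mathbb{R}}g(y)\,dy<\infty$. Then, if $\lim_{n\to\infty}\operatorname{Var}F_n\in(0,\infty)$, $$d_{TV}\left(\frac{F_n}{\sqrt{\operatorname{Var}F_n}},N\right)\leq\frac{C}{\sqrt n},$$ where $N\sim\mathcal{N}(0,1)$ and $C$ is a constant that does not depend on $n$.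
   Context: A two-sided Brownian motion is $B_t=B_1(t)$ for $t\ge0$ and $B_t=B_2(-t)$ for $t<0$, with $B_1,B_2$ independent standard Brownian motions; $\int_{\mathbb{R}}h(s)\,dB_s$ is the Wiener integral of $h\in L^2(\mathbb{R},dx)$, so that these integrals form an isonormal Gaussian process over $L^2(\mathbb{R},dx)$. The bound is understood for those $n\geq1$ for which $\operatorname{Var}F_n>0$. For real random variables $U,V$, $d_{TV}(U,V)=\sup_{B\in\mathscr{B}(\mathbb{R})}|P(U\in B)-P(V\in B)|$. *)

(* Defs.v *)
From HB Require Import structures.
From mathcomp Require Import all_boot all_order all_algebra.
From mathcomp Require Import all_classical all_reals all_analysis.

Set Implicit Arguments.
Unset Strict Implicit.
Unset Printing Implicit Defensive.

Import Order.TTheory GRing.Theory Num.Theory.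
Import numFieldNormedType.Exports.

Local Open Scope classical_set_scope.
Local Open Scope ring_scope.

(* A law is only ever tested on Borel sets, because a [probability] is a
   function on all sets, whose values on nonmeasurable sets are irrelevant.
   Degenerate Gaussian laws are Dirac masses; they are treated separately
   because the library's [normal_prob m 0] is the uniform law on [0, 1]. *)
Definition gaussian_law (R : realType) (m v : R) (A : set R) : \bar R :=
  if v == 0 then \d_m A else normal_prob m (Num.sqrt v) A.

Definition has_gaussian_law d (T : measurableType d) (R : realType)
    (P : probability T R) (X : T -> R) (m v : R) : Prop :=
  forall A : set R, measurable A -> P (X @^-1` A) = gaussian_law m v A.

Definition process_sigma_algebra d (T : measurableType d) (R : realType)
    (I : Type) (D : set I) (W : I -> T -> R) : set_system T :=
  <<s [set E | exists2 t, D t &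
         exists2 A : set R, measurable A & E = W t @^-1` A] >>.

Definition independent_processes d (T : measurableType d) (R : realType)
    (P : probability T R) (I : Type) (D : set I) (W1 W2 : I -> T -> R) : Prop :=
  forall E F : set T, process_sigma_algebra D W1 E ->
    process_sigma_algebra D W2 F -> P (E `&` F) = (P E * P F)%E.

Definition increment (T : Type) (R : realType) (W : R -> T -> R) (s t : R)
    (w : T) : R := W t w - W s w.

(* Time is [0, +oo[; the values of W at negative times are ignored. *)
Definition standard_brownian_motion d (T : measurableType d) (R : realType)
    (P : probability T R) (W : R -> {RV P >-> R}) : Prop :=
  [/\ {ae P, forall w, W 0 w = 0},
      (forall (n : nat) (t : nat -> R) (A : nat -> set R),
         0 <= t 0%N -> {homo t : i j / (i <= j)%N >-> i <= j} ->
         (forall i, measurable (A i)) ->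
         P (\bigcap_(i < n) increment W (t i) (t i.+1) @^-1` A i) =
         (\prod_(i < n) P (increment W (t i) (t i.+1) @^-1` A i))%E),
      (forall s t : R, 0 <= s -> s <= t ->
         has_gaussian_law P (increment W s t) 0 (t - s)) &
      {ae P, forall w, {within `[0, +oo[, continuous (fun t => W t w)}}].

Definition two_sided_brownian_motion d (T : measurableType d) (R : realType)
    (P : probability T R) (B : R -> {RV P >-> R}) : Prop :=
  exists B1 B2 : R -> {RV P >-> R},
    [/\ standard_brownian_motion B1, standard_brownian_motion B2,
        independent_processes P [set t : R | 0 <= t]
          (fun t => B1 t : T -> R) (fun t => B2 t : T -> R) &
        forall t w, B t w = if 0 <= t then B1 t w else B2 (- t) w].

(* The list of the (a, (s, t)) stands for the step function
   \sum a * \1_]s, t], where s <= t. *)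
Definition step_list (R : realType) (c : seq (R * (R * R))) : Prop :=
  forall p, p \in c -> p.2.1 <= p.2.2.

Definition step_fun (R : realType) (c : seq (R * (R * R))) (x : R) : R :=
  \sum_(p <- c) p.1 * \1_(`]p.2.1, p.2.2]) x.

Definition step_wiener d (T : measurableType d) (R : realType)
    (B : R -> T -> R) (c : seq (R * (R * R))) (w : T) : R :=
  \sum_(p <- c) p.1 * increment B p.2.1 p.2.2 w.

(* Y is a version of the Wiener integral of h with respect to B: the limit in
   L^2(P) of the integrals of step functions which tend to h in L^2(dx). *)
Definition is_wiener_integral d (T : measurableType d) (R : realType)
    (P : probability T R) (B : R -> T -> R) (h : R -> R) (Y : T -> R) : Prop :=
  exists c : nat -> seq (R * (R * R)),
    [/\ forall n, step_list (c n),
        ('N[lebesgue_measure]_2%:E[(fun x => (h x - step_fun (c n) x)%:E)])%E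
          @[n --> \oo] --> 0%E &
        ('N[P]_2%:E[(fun w => (Y w - step_wiener B (c n) w)%:E)])%E
          @[n --> \oo] --> 0%E].

Definition gaussian_family d (T : measurableType d) (R : realType)
    (P : probability T R) (I : Type) (X : I -> T -> R) : Prop :=
  forall (n : nat) (k : 'I_n -> I) (a : 'I_n -> R),
    exists m v : R, 0 <= v /\
      has_gaussian_law P (fun w => \sum_(i < n) a i * X (k i) w) m v.

Definition stationary d (T : measurableType d) (R : realType)
    (P : probability T R) (X : int -> T -> R) : Prop :=
  forall (n : nat) (k : 'I_n -> int) (h : int) (A : 'I_n -> set R),
    (forall i, measurable (A i)) ->
    P (\bigcap_(i in setT) X (k i + h) @^-1` A i) =
    P (\bigcap_(i in setT) X (k i) @^-1` A i).

Definition correlation d (T : measurableType d) (R : realType)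
    (P : probability T R) (X : int -> T -> R) (nu : int) : \bar R :=
  ('E_P[(fun w => X 0 w * X nu w)%R])%E.

Definition class_C2 (R : realType) (f : R -> R) : Prop :=
  [/\ forall x : R, derivable f x 1, forall x : R, derivable f^`()%classic x 1 &
      continuous (f^`()^`())%classic].

Definition normalized_sum d (T : measurableType d) (R : realType)
    (P : probability T R) (f : R -> R) (X : int -> T -> R) (n : nat) (w : T)
    : R :=
  (Num.sqrt n%:R)^-1 *
  \sum_(1 <= k < n.+1) (f (X k%:Z w) - fine ('E_P[f \o X k%:Z])%E).

(* U and V may live on different probability spaces. *)
Definition dTV d (T : measurableType d) d' (T' : measurableType d')
    (R : realType) (P : probability T R) (U : T -> R)
    (Q : probability T' R) (V : T' -> R) : \bar R :=
  ereal_sup [set (`|P (U @^-1` A) - Q (V @^-1` A)|)%E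
            | A in [set A : set R | measurable A]].

(* Main.v *)
Require Import Defs.
From HB Require Import structures.
From mathcomp Require Import all_boot all_order all_algebra.
From mathcomp Require Import all_classical all_reals all_analysis.
From mathcomp Require Import measurable_realfun gauss_integral.
From mathcomp Require Import ring lra.

(* Let gamma be the standard normal law, phi = f - E f(N), and let u solve Stein's
   equation x u(x) - u'(x) = phi(x); the assumption on f'' makes phi, phi', phi'',
   u and u' fourth power integrable under gamma. Replacing X_l by an independent
   normal variable in the Gaussian vector (X_1, ..., X_n) and integrating by parts
   in it alone gives, for S = sum_l phi(X_l),
     E[S g(S)] = E[W g'(S)],  W = sum_{l,k} rho(l - k) u(X_l) phi'(X_k),
   for all bounded C^1 functions g with bounded derivative. Hence E W = Var S, and
   inserting the bounded solution of Stein's equation for a continuous function h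
   with values in [0, 1] gives |E h(S / sqrt v) - E h(N)| <= 2 E|1 - W / v|, where
   v = Var S. The Poincare inequality for the Gaussian vector bounds Var W by a
   constant times n, because rho is summable; since v / n has a positive limit, the
   bound is O(1 / sqrt n). Continuous functions with values in [0, 1] suffice to
   compute the total variation distance. *)

Set Implicit Arguments.
Unset Strict Implicit.
Unset Printing Implicit Defensive.

Import Order.TTheory GRing.Theory Num.Theory.
Import numFieldNormedType.Exports.

Local Open Scope classical_set_scope.
Local Open Scope ring_scope.

(** * Expectations of real functions *)

(** The covariance matrix of (X_1, ..., X_n) may be singular, so no joint density is used. A
    Gaussian vector is known through the expectations of cos (a . X + b), which determine its law;
    it may then be exchanged for any vector with the same covariance: one with a resampled
    coordinate for the integration by parts, a linear image of independent normal variables for the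
    Poincare inequality. Densities occur on the line only. Resampling a single coordinate is enough
    because Stein's equation makes phi(X_l) the divergence of a field that points along coordinate
    l. The price is a control of u and u'. A partial derivative of W is a sum of products of two
    factors among u, u', phi', phi'', and the Poincare inequality multiplies two partial
    derivatives; hence the fourth powers. The Poincare constant must not depend on n, but its value
    32 is immaterial and comes from an elementary weight argument on the half-line. The passage from
    Var W to E|1 - W / v| uses 2|V| <= t + V^2 / t with t = 1 / sqrt n. *)

Definition intg d (T : measurableType d) (R : realType)
    (m : {measure set T -> \bar R}) (f : T -> R) : Prop :=
  m.-integrable setT (EFin \o f).

Definition Exp d (T : measurableType d) (R : realType)
    (m : {measure set T -> \bar R}) (f : T -> R) : R := \int[m]_x f x.

Section RealIntegral.
Context d (T : measurableType d) (R : realType) (m : {measure set T -> \bar R}).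
Implicit Types f g h : T -> R.

Lemma intg_measurable f : intg m f -> measurable_fun setT f.
Proof. by move=> /measurable_int /measurable_EFinP. Qed.

Lemma ExpE f : intg m f -> (\int[m]_x (f x)%:E)%E = (Exp m f)%:E.
Proof. by move=> mf; rewrite /Exp /Rintegral fineK// integrable_fin_num. Qed.

Lemma intg_le f g : measurable_fun setT f -> (forall x, `|f x| <= g x) ->
  intg m g -> intg m f.
Proof.
move=> mf fg ig; apply: (le_integrable measurableT _ _ ig).
  exact/measurable_EFinP.
by move=> x _ /=; rewrite lee_fin (le_trans (fg x))// ler_norm.
Qed.

Lemma intgD f g : intg m f -> intg m g -> intg m (fun x => f x + g x).
Proof. by move=> mf mg; have := integrableD measurableT mf mg. Qed.

Lemma intgB f g : intg m f -> intg m g -> intg m (fun x => f x - g x).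
Proof. by move=> mf mg; have := integrableB measurableT mf mg. Qed.

Lemma intgZ k f : intg m f -> intg m (fun x => k * f x).
Proof. by move=> mf; have := integrableZl measurableT k mf. Qed.

Lemma intgZr k f : intg m f -> intg m (fun x => f x * k).
Proof. by move=> /(intgZ k); congr intg; apply/funext => x; rewrite mulrC. Qed.

Lemma intgN f : intg m f -> intg m (fun x => - f x).
Proof. by move=> mf; have := integrableN mf. Qed.

Lemma intg_norm f : intg m f -> intg m (fun x => `|f x|).
Proof. exact: integrable_norm. Qed.

Lemma intg0 : intg m (fun=> 0).
Proof. exact: integrable0. Qed.

Lemma intg_sum (I : Type) (s : seq I) (F : I -> T -> R) :
  (forall i, intg m (F i)) -> intg m (fun x => \sum_(i <- s) F i x).
Proof.
move=> iF; elim: s => [|i s IH].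
  by under eq_fun do rewrite big_nil; exact: intg0.
by under eq_fun do rewrite big_cons; exact: intgD.
Qed.

Lemma ExpD f g : intg m f -> intg m g ->
  Exp m (fun x => f x + g x) = Exp m f + Exp m g.
Proof. exact: RintegralD. Qed.

Lemma ExpB f g : intg m f -> intg m g ->
  Exp m (fun x => f x - g x) = Exp m f - Exp m g.
Proof. exact: RintegralB. Qed.

Lemma ExpZ k f : intg m f -> Exp m (fun x => k * f x) = k * Exp m f.
Proof. exact: RintegralZl. Qed.

Lemma ExpZr k f : intg m f -> Exp m (fun x => f x * k) = Exp m f * k.
Proof. exact: RintegralZr. Qed.

Lemma Exp0 : Exp m (fun=> 0) = 0.
Proof. by rewrite /Exp /Rintegral integral0. Qed.

Lemma Exp_sum (I : Type) (s : seq I) (F : I -> T -> R) :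
  (forall i, intg m (F i)) ->
  Exp m (fun x => \sum_(i <- s) F i x) = \sum_(i <- s) Exp m (F i).
Proof.
move=> iF; elim: s => [|i s IH].
  by under eq_fun do rewrite big_nil; rewrite big_nil Exp0.
under eq_fun do rewrite big_cons.
by rewrite big_cons ExpD ?IH//; exact: intg_sum.
Qed.

Lemma le_Exp f g : intg m f -> intg m g -> (forall x, f x <= g x) ->
  Exp m f <= Exp m g.
Proof. by move=> mf mg fg; apply: le_Rintegral. Qed.

Lemma Exp_ge0 f : (forall x, 0 <= f x) -> 0 <= Exp m f.
Proof. by move=> f0; apply: Rintegral_ge0 => x _. Qed.

Lemma le_norm_Exp f : intg m f -> `|Exp m f| <= Exp m (fun x => `|f x|).
Proof. exact: le_normr_Rintegral. Qed.

Lemma Exp_norm_le f g : measurable_fun setT f -> (forall x, `|f x| <= g x) ->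
  intg m g -> `|Exp m f| <= Exp m g.
Proof.
move=> mf fg ig; have i_f := intg_le mf fg ig.
by rewrite (le_trans (le_norm_Exp i_f))// le_Exp//; exact: intg_norm.
Qed.

Lemma Exp_dct (F : nat -> T -> R) f g :
  (forall n, measurable_fun setT (F n)) ->
  (forall x, F n x @[n --> \oo] --> f x) ->
  (forall n x, `|F n x| <= g x) -> intg m g ->
  intg m f /\ Exp m (F n) @[n --> \oo] --> Exp m f.
Proof.
move=> mF Ff Fg ig.
have mf : measurable_fun setT f by exact: measurable_fun_cvg mF _.
have [|||||i_f _ cv] := @dominated_convergence _ _ _ m setT measurableT
    (fun n x => (F n x)%:E) (EFin \o f) (EFin \o g).
- by move=> n; exact/measurable_EFinP.
- exact/measurable_EFinP.
- by apply: aeW => x _; apply/fine_cvgP; split; [exact: nearW|exact: Ff].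
- exact: ig.
- by apply: aeW => x n _; rewrite lee_fin.
split=> //; apply/fine_cvg; rewrite /=.
rewrite -(ExpE i_f) in cv *.
exact: cv.
Qed.

End RealIntegral.

Lemma intg_cst d (T : measurableType d) (R : realType) (P : probability T R)
  (k : R) : intg P (fun=> k).
Proof. exact: finite_measure_integrable_cst. Qed.

Lemma Exp_cst d (T : measurableType d) (R : realType) (P : probability T R)
  (k : R) : Exp P (fun=> k) = k.
Proof.
by rewrite /Exp /Rintegral integral_cst//= -[X in (_ * X)%E]/(P setT) probability_setT mule1.
Qed.

(** * Integrals of functions of two random elements with the same law *)

Section Transfer.
Context d (T : measurableType d) d' (T' : measurableType d')
  e (S : measurableType e) (R : realType)
  (m : {measure set T -> \bar R}) (m' : {measure set T' -> \bar R}).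
Variables (X : T -> S) (X' : T' -> S).
Hypotheses (mX : measurable_fun setT X) (mX' : measurable_fun setT X').
Hypothesis law_eq : forall A, measurable A -> m (X @^-1` A) = m' (X' @^-1` A).

Lemma transfer_ge0 (h : S -> \bar R) : measurable_fun setT h ->
  (forall x, 0 <= h x)%E ->
  (\int[m]_x h (X x) = \int[m']_x h (X' x))%E.
Proof.
move=> mh h0.
rewrite -[LHS]/(\int[m]_(x in X @^-1` setT) (h \o X) x)%E.
rewrite -[RHS]/(\int[m']_(x in X' @^-1` setT) (h \o X') x)%E.
rewrite -!ge0_integral_pushforward//.
by apply: eq_measure_integral => A mA _; exact: law_eq.
Qed.

Lemma transfer_intg (h : S -> R) : measurable_fun setT h ->
  intg m (fun x => h (X x)) -> intg m' (fun x => h (X' x)).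
Proof.
move=> mh /integrableP[_ i1]; apply/integrableP; split.
  by apply/measurable_EFinP; exact: measurableT_comp.
move: i1; rewrite (transfer_ge0 (h := fun x => (`|h x|)%:E))//.
by apply/measurable_EFinP; exact: measurableT_comp.
Qed.

(** No integrability is required: on both sides the positive and negative parts have equal integrals
    in the extended reals, and [fine] is applied to the same difference. *)
Lemma transfer_Exp (h : S -> R) : measurable_fun setT h ->
  Exp m (fun x => h (X x)) = Exp m' (fun x => h (X' x)).
Proof.
move=> mh; rewrite /Exp /Rintegral; congr fine.
have me : measurable_fun setT (EFin \o h) by exact/measurable_EFinP.
rewrite integralE [RHS]integralE.
have E1 (U : Type) (Y : U -> S) :
    (fun x => (h (Y x))%:E)^\+%E = ((EFin \o h)^\+ \o Y)%E.
  by rewrite -funepos_comp.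
have E2 (U : Type) (Y : U -> S) :
    (fun x => (h (Y x))%:E)^\-%E = ((EFin \o h)^\- \o Y)%E.
  by rewrite -funeneg_comp.
rewrite (E1 _ X) (E1 _ X') (E2 _ X) (E2 _ X'); congr (_ - _)%E.
  apply: (transfer_ge0 (h := ((EFin \o h)^\+)%E)) => [|x].
    exact: measurable_funepos.
  exact: funepos_ge0.
apply: (transfer_ge0 (h := ((EFin \o h)^\-)%E)) => [|x].
  exact: measurable_funeneg.
exact: funeneg_ge0.
Qed.

End Transfer.

(** * Integrals against a normal law as Lebesgue integrals *)

Section NormalDensity.
Context (R : realType).
Local Notation leb := (@lebesgue_measure R).
Variables (a s : R).
Local Notation nu := (normal_prob a s).
Local Notation p := (normal_pdf a s).

(** Change of variables holds with the Radon-Nikodym derivative; the latter agrees almost everywhere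
    with [p], as both have the same integral over every measurable set. *)
Lemma normal_prob_ge0_integral (f : R -> \bar R) : measurable_fun setT f ->
  (forall x, 0 <= f x)%E ->
  (\int[nu]_x f x = \int[leb]_x (f x * (p x)%:E))%E.
Proof.
move=> mf f0.
have dom : nu `<< leb := @normal_prob_dominates R a s.
rewrite -(Radon_Nikodym_SigmaFinite.change_of_variables dom)//.
have iRN := Radon_Nikodym_SigmaFinite.f_integrable dom.
have mp : measurable_fun setT (EFin \o p).
  by apply/measurable_EFinP; exact: measurable_normal_pdf.
apply: ae_eq_integral => //.
- by apply: emeasurable_funM => //; exact: measurable_int iRN.
- by apply: emeasurable_funM.
- apply: ae_eqe_mul2l; apply: integral_ae_eq => //.
  by move=> E ET mE; rewrite -Radon_Nikodym_SigmaFinite.f_integral.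
Qed.

Lemma normal_prob_intg (f : R -> R) : measurable_fun setT f ->
  intg nu f <-> intg leb (fun x => f x * p x).
Proof.
move=> mf.
have H : (\int[nu]_x (`|f x|)%:E = \int[leb]_x (`|f x * p x|)%:E)%E.
  rewrite normal_prob_ge0_integral//.
    by apply: eq_integral => x _; rewrite normrM (ger0_norm (normal_pdf_ge0 _ _ _)).
  by apply/measurable_EFinP; exact: measurableT_comp.
split=> /integrableP[_ i1]; apply/integrableP; split.
- apply/measurable_EFinP; apply: measurable_funM => //.
  exact: measurable_normal_pdf.
- by move: i1; rewrite /= H.
- exact/measurable_EFinP.
- by move: i1; rewrite /= -H.
Qed.

Lemma normal_prob_Exp (f : R -> R) : measurable_fun setT f ->
  Exp nu f = Exp leb (fun x => f x * p x).
Proof.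
move=> mf; rewrite /Exp /Rintegral; congr fine.
have me : measurable_fun setT (EFin \o f) by exact/measurable_EFinP.
rewrite integralE [RHS]integralE; congr (_ + - _)%E.
  rewrite normal_prob_ge0_integral; last 2 first.
    exact: measurable_funepos.
    exact: funepos_ge0.
  apply: eq_integral => x _; rewrite !funeposE EFinM maxe_pMl ?mul0e//.
  by rewrite lee_fin normal_pdf_ge0.
rewrite normal_prob_ge0_integral; last 2 first.
- exact: measurable_funeneg.
- exact: funeneg_ge0.
apply: eq_integral => x _; rewrite !funenegE EFinM maxe_pMl ?mul0e ?mulNe//.
by rewrite lee_fin normal_pdf_ge0.
Qed.

End NormalDensity.

(** * Calculus on the line *)

Section Calculus.
Context (R : realType).
Local Notation leb := (@lebesgue_measure R).

Definition der (f df : R -> R) : Prop := forall x, is_derive x (1 : R) f (df x).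

Lemma is_derive_add (x : R) (f g : R -> R) a b : is_derive x 1 f a ->
  is_derive x 1 g b -> is_derive x 1 (fun y => f y + g y) (a + b).
Proof. by move=> fa gb; exact: is_deriveD. Qed.

Lemma is_derive_sub (x : R) (f g : R -> R) a b : is_derive x 1 f a ->
  is_derive x 1 g b -> is_derive x 1 (fun y => f y - g y) (a - b).
Proof. by move=> fa gb; exact: is_deriveB. Qed.

Lemma is_derive_mul (x : R) (f g : R -> R) a b : is_derive x 1 f a ->
  is_derive x 1 g b -> is_derive x 1 (fun y => f y * g y) (f x * b + g x * a).
Proof. by move=> fa gb; exact: is_deriveM. Qed.

Lemma is_derive_opp (x : R) (f : R -> R) a : is_derive x 1 f a ->
  is_derive x 1 (fun y => - f y) (- a).
Proof. by move=> fa; exact: is_deriveN. Qed.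

Lemma is_derive_scale (x : R) k (f : R -> R) a : is_derive x 1 f a ->
  is_derive x 1 (fun y => k * f y) (k * a).
Proof. by move=> fa; exact: is_deriveZ. Qed.

Lemma is_derive_exp (x : R) n (f : R -> R) a : is_derive x 1 f a ->
  is_derive x 1 (fun y => f y ^+ n) (n%:R * f x ^+ n.-1 * a).
Proof.
move=> fa; have -> : (fun y => f y ^+ n) = f ^+ n.
  by apply/funext => y; rewrite exprfctE.
exact: is_deriveX.
Qed.

Lemma is_derive_const (x : R) (k : R) : is_derive x 1 (fun _ : R => k) 0.
Proof. exact: is_derive_cst. Qed.

Lemma is_derive_idfun (x : R) : is_derive x 1 (fun y : R => y) 1.
Proof. exact: is_derive_id. Qed.

Lemma is_derive_o (x : R) (f g : R -> R) a b : is_derive (g x) 1 f a ->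
  is_derive x 1 g b -> is_derive x 1 (fun y => f (g y)) (a * b).
Proof. by move=> fa gb; exact: (@is_derive1_comp _ f g). Qed.

Lemma is_derive_bigsum (x : R) (I : Type) (s : seq I) (F : I -> R -> R)
  (dF : I -> R) : (forall i, is_derive x 1 (F i) (dF i)) ->
  is_derive x 1 (fun y => \sum_(i <- s) F i y) (\sum_(i <- s) dF i).
Proof.
move=> Fd; elim: s => [|i s IH].
  by under eq_fun do rewrite big_nil; rewrite big_nil; exact: is_derive_const.
under eq_fun do rewrite big_cons.
by rewrite big_cons; exact: is_derive_add.
Qed.

Lemma der_continuous f df : der f df -> continuous f.
Proof.
move=> fd x; apply: differentiable_continuous; apply/derivable1_diffP.
by case: (fd x).
Qed.

Lemma continuous_meas (f : R -> R) : continuous f -> measurable_fun setT f.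
Proof. exact: continuous_measurable_fun. Qed.

Lemma continuous_add (f g : R -> R) : continuous f -> continuous g ->
  continuous (fun x => f x + g x).
Proof. by move=> fc gc x; apply: cvgD; [exact: fc|exact: gc]. Qed.

Lemma continuous_sub (f g : R -> R) : continuous f -> continuous g ->
  continuous (fun x => f x - g x).
Proof. by move=> fc gc x; apply: cvgB; [exact: fc|exact: gc]. Qed.

Lemma continuous_mul (f g : R -> R) : continuous f -> continuous g ->
  continuous (fun x => f x * g x).
Proof. by move=> fc gc x; apply: cvgM; [exact: fc|exact: gc]. Qed.

Lemma continuous_exp n (f : R -> R) : continuous f ->
  continuous (fun x => f x ^+ n).
Proof.
move=> fc; elim: n => [x|n IH]; first exact: cvg_cst.
by under eq_fun do rewrite exprS; exact: continuous_mul.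
Qed.

Lemma continuous_normr (f : R -> R) : continuous f ->
  continuous (fun x => `|f x|).
Proof. by move=> fc x; apply: cvg_norm; exact: fc. Qed.

Lemma continuous_o (f g : R -> R) : continuous f -> continuous g ->
  continuous (fun x => f (g x)).
Proof. by move=> fc gc x; apply: continuous_comp; [exact: gc|exact: fc]. Qed.

Lemma continuous_const (k : R) : continuous (fun _ : R => k).
Proof. by move=> x; exact: cvg_cst. Qed.

Lemma continuous_idfun : continuous (fun x : R => x).
Proof. by move=> x; exact: cvg_id. Qed.

Lemma lebesgue_opp (A : set R) : measurable A ->
  leb (idfun @^-1` A) = leb (-%R @^-1` A).
Proof.
move=> mA; rewrite preimage_id.
rewrite -[RHS]/(pushforward leb (-%R : measurableTypeR R -> measurableTypeR R) A).
apply: lebesgue_measure_unique => // X [[a b]/= ab] <-.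
rewrite /pushforward.
have -> : -%R @^-1` `]a, b]%classic = `[(- b), (- a)[%classic.
  apply/seteqP; split=> x /=; rewrite !in_itv/= => /andP[h1 h2]; apply/andP; split; lra.
by rewrite !lebesgue_measure_itv/= !lte_fin ltrN2 -!EFinB opprK addrC.
Qed.

Lemma Exp_leb_opp (h : R -> R) : measurable_fun setT h ->
  Exp leb (fun x => h (- x)) = Exp leb h.
Proof.
move=> mh; apply/esym.
exact: (@transfer_Exp _ _ _ _ _ _ _ leb leb (@idfun (measurableTypeR R)) -%R
  (@measurable_id _ _ _) (@oppr_measurable _ _) lebesgue_opp h mh).
Qed.

Lemma intg_leb_opp (h : R -> R) : measurable_fun setT h ->
  intg leb h -> intg leb (fun x => h (- x)).
Proof.
move=> mh.
exact: (@transfer_intg _ _ _ _ _ _ _ leb leb (@idfun (measurableTypeR R)) -%R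
  (@measurable_id _ _ _) (@oppr_measurable _ _) lebesgue_opp h mh).
Qed.

End Calculus.

(** * Integrals over rays and segments *)

Section LineIntegrals.
Context (R : realType).
Local Notation leb := (@lebesgue_measure R).
Implicit Types (f U dU A B : R -> R) (a b C : R).

(** Rays and segments enter as a numeric factor 0 or 1 in the integrand, so that a single notion of
    integrability over the whole line serves everywhere; this identity links it to restricted
    domains. *)
Lemma restrict_mul (D : set R) f :
  (fun x => f x * (x \in D)%:R) = f \_ D.
Proof.
apply/funext => x; rewrite patchE.
by case: ifPn => _; rewrite ?mulr1 ?mulr0.
Qed.

Lemma ray_in a x : (a <= x) = (x \in `[a, +oo[%classic).
Proof. by rewrite mem_setE in_itv/= andbT. Qed.

Lemma segment_in a b x : (a <= x <= b) = (x \in `[a, b]%classic).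
Proof. by rewrite mem_setE in_itv/=. Qed.

Lemma measurable_ray a : measurable_fun setT (fun x : R => (a <= x)%R%:R : R).
Proof.
under eq_fun do rewrite ray_in.
by under eq_fun do rewrite -indicE; exact: measurable_indic.
Qed.

Lemma intg_restrict (D : set R) f : measurable D ->
  intg leb (fun x => f x * (x \in D)%:R) <-> leb.-integrable D (EFin \o f).
Proof.
move=> mD; rewrite restrict_mul /intg -restrict_EFin.
exact: (iff_sym (@integrable_mkcond _ (measurableTypeR R) R leb D (EFin \o f) mD)).
Qed.

Lemma Exp_restrict (D : set R) f :
  Exp leb (fun x => f x * (x \in D)%:R) = \int[leb]_(x in D) f x.
Proof. by rewrite restrict_mul [RHS]Rintegral_mkcond. Qed.

Lemma intg_segment f a b : continuous f ->
  intg leb (fun x => f x * (a <= x <= b)%R%:R).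
Proof.
move=> fc; under eq_fun do rewrite segment_in.
apply/intg_restrict => //; apply: continuous_compact_integrable.
  exact: segment_compact.
by apply: continuous_subspaceT.
Qed.

Lemma Exp_FTC U dU a b : der U dU -> continuous dU -> a <= b ->
  Exp leb (fun x => dU x * (a <= x <= b)%R%:R) = U b - U a.
Proof.
move=> Ud dUc; rewrite le_eqVlt => /predU1P[<-|ab].
  rewrite subrr; under eq_fun do rewrite segment_in.
  rewrite Exp_restrict (_ : `[a, a]%classic = [set a]) ?Rintegral_set1//.
  by rewrite set_itv1.
under eq_fun do rewrite segment_in.
have Uc := der_continuous Ud.
rewrite Exp_restrict /Rintegral (@continuous_FTC2 _ dU U)//.
- by apply: continuous_subspaceT.
- split.
  + by move=> x _; case: (Ud x).
  + by apply: cvg_at_right_filter; exact: Uc.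
  + by apply: cvg_at_left_filter; exact: Uc.
- by move=> x _; rewrite derive1E; case: (Ud x).
Qed.

Lemma cvg_segment_ray f a x :
  f x * (a <= x <= a + n%:R)%R%:R @[n --> \oo] --> f x * (a <= x)%R%:R.
Proof.
apply: cvg_near_cst; near=> n; congr (_ * _%:R); congr nat_of_bool.
case: leP => //= ax; rewrite -lerBlDl.
near: n; exact: nbhs_infty_ger.
Unshelve. all: by end_near. Qed.

(** Integrating [dU <= A - B] over [[a, a + n]] bounds the integral of [B] there by that of [A] plus
    [U a + C], uniformly in [n]; monotone convergence concludes. The moment bounds on the half-line
    below come from a suitable choice of [U]. *)
Lemma energy U dU A B a C : der U dU -> continuous dU -> continuous A ->
  continuous B -> (forall x, a <= x -> 0 <= A x) ->
  (forall x, a <= x -> 0 <= B x) ->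
  (forall x, a <= x -> dU x <= A x - B x) -> (forall x, a <= x -> - C <= U x) ->
  intg leb (fun x => A x * (a <= x)%R%:R) ->
  intg leb (fun x => B x * (a <= x)%R%:R) /\
  Exp leb (fun x => B x * (a <= x)%R%:R) <=
    Exp leb (fun x => A x * (a <= x)%R%:R) + U a + C.
Proof.
move=> Ud dUc Ac Bc A0 B0 dUAB UC iA.
set K := Exp leb _ + U a + C.
pose Bn n x := B x * (a <= x <= a + n%:R)%R%:R.
have an n : a <= a + n%:R by rewrite lerDl.
have iBn n : intg leb (Bn n) by exact: intg_segment.
have Bn0 n x : 0 <= Bn n x.
  rewrite /Bn; case: andP => [[ax _]|_]; rewrite ?mulr1 ?mulr0//; exact: B0.
have BnK n : Exp leb (Bn n) <= K.
  (* [A] is kept on the whole ray to make the bound independent of [n]; beyond the segment it is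
     only an excess, being nonnegative. *)
  have H : Exp leb (fun x => dU x * (a <= x <= a + n%:R)%R%:R) <=
      Exp leb (fun x => A x * (a <= x)%R%:R - Bn n x).
    apply: le_Exp => [|| x]; [exact: intg_segment|exact: intgB|].
    rewrite /Bn; case: (leP a x) => [ax|_] /=; last by rewrite !mulr0 subrr.
    case: (x <= _); rewrite ?mulr1; first exact: dUAB.
    by rewrite !mulr0 subr0; exact: A0.
  move: H; rewrite (Exp_FTC Ud)// ExpB//.
  have := UC _ (an n); rewrite /K; lra.
have mB : measurable_fun setT (fun x => B x * (a <= x)%R%:R).
  by apply: measurable_funM; [exact: continuous_meas|exact: measurable_ray].
have Bcvg x : Bn n x @[n --> \oo] --> B x * (a <= x)%R%:R.
  exact: cvg_segment_ray.
have E : (\int[leb]_x (B x * (a <= x)%R%:R)%:E <= K%:E)%E.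
  have -> : (\int[leb]_x (B x * (a <= x)%R%:R)%:E =
      limn (fun n => \int[leb]_x (Bn n x)%:E))%E.
    rewrite -monotone_convergence//.
    - apply: eq_integral => x _; apply/esym/cvg_lim => //.
      by apply/fine_cvgP; split; [exact: nearW|exact: Bcvg].
    - by move=> n; apply/measurable_EFinP/intg_measurable/iBn.
    - by move=> n x _; rewrite lee_fin.
    - move=> x _ m n mn; rewrite lee_fin /Bn.
      case: (leP a x) => [ax|_] /=; last by rewrite !mulr0.
      apply: ler_wpM2l; first exact: B0.
      have [xm|_] := leP x (a + m%:R); last by rewrite ler0n.
      by rewrite (le_trans xm)// lerD2l ler_nat.
  apply: lime_le.
    apply: ereal_nondecreasing_is_cvgn => m n mn; apply: ge0_le_integral => //.
    - by move=> x _; rewrite lee_fin.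
    - by apply/measurable_EFinP/intg_measurable/iBn.
    - by apply/measurable_EFinP/intg_measurable/iBn.
    - move=> x _; rewrite lee_fin /Bn.
      case: (leP a x) => [ax|_] /=; last by rewrite !mulr0.
      apply: ler_wpM2l; first exact: B0.
      have [xm|_] := leP x (a + m%:R); last by rewrite ler0n.
      by rewrite (le_trans xm)// lerD2l ler_nat.
  by apply: nearW => n; rewrite (ExpE (iBn n)) lee_fin.
have iB : intg leb (fun x => B x * (a <= x)%R%:R).
  apply/integrableP; split; first exact/measurable_EFinP.
  rewrite (le_lt_trans _ (ltry K))//= (le_trans _ E)//.
  apply: ge0_le_integral => //.
  - by apply/measurable_EFinP; exact: measurableT_comp.
  - exact/measurable_EFinP.
  - move=> x _; rewrite lee_fin ger0_norm//.
    by case: (leP a x) => [ax|_]; rewrite ?mulr1 ?mulr0 ?B0.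
by split=> //; rewrite -lee_fin -ExpE.
Qed.

End LineIntegrals.

(** * Integration by parts with vanishing boundary terms at infinity *)

Section WholeLine.
Context (R : realType).
Local Notation leb := (@lebesgue_measure R).
Implicit Types (f U dU : R -> R) (a b : R).

(** Otherwise [|f| >= e] beyond some point [b], and the integral of [|f|] over [[b, b + n]] would be
    at least [e * n] for every [n]. *)
Lemma integrable_small_far f a :
  intg leb (fun x => f x * (a <= x)%R%:R) ->
  forall M e, 0 < e -> exists x, [/\ M <= x, a <= x & `|f x| < e].
Proof.
move=> fi M e e0; apply: contrapT => H.
pose b := Num.max M a.
have H' x : b <= x -> e <= `|f x|.
  rewrite /b ge_max => /andP[h1 h2]; rewrite leNgt; apply/negP => h3.
  by apply: H; exists x.
pose K := Exp leb (fun x => `|f x * (a <= x)%R%:R|).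
have K0 : 0 <= K by exact: Exp_ge0.
have bd n : e * n%:R <= K.
  have ed : der (fun x => e * x) (fun=> e).
    by move=> x; apply: is_derive_eq (is_derive_scale e (is_derive_idfun x)) (mulr1 e).
  have bn : b <= b + n%:R by rewrite lerDl.
  have := Exp_FTC ed (@continuous_const R e) bn.
  rewrite mulrDr addrAC subrr add0r => <-.
  apply: le_Exp => [||x]; [exact/intg_segment/continuous_const|exact: intg_norm|].
  case: (leP b x) => [bx|_] /=; last by rewrite mulr0.
  have ax : a <= x by move: bx; rewrite /b ge_max => /andP[].
  rewrite ax mulr1 (le_trans _ (H' _ bx))//.
  by case: (x <= _); rewrite ?mulr1// mulr0 ltW.
have [n nK] : exists n : nat, K / e < n%:R.
  by exists (Num.truncn (K / e)).+1; exact: truncnS_gt.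
have := bd n; rewrite leNgt => /negP; apply.
by rewrite mulrC -ltr_pdivrMr.
Qed.

(** An integrable function need not tend to 0 at infinity, but boundary terms only have to vanish
    along one sequence of end points. *)
Lemma far_sequence f a : intg leb (fun x => f x * (a <= x)%R%:R) ->
  exists u : nat -> R, [/\ forall n, a <= u n, forall n, n%:R <= u n &
    f (u n) @[n --> \oo] --> 0].
Proof.
move=> /integrable_small_far H.
have [u Hu] : {u : nat -> R & forall n,
    [/\ n%:R <= u n, a <= u n & `|f (u n)| < n.+1%:R^-1]}.
  apply: (@choice _ _ (fun (n : nat) x => [/\ n%:R <= x, a <= x & `|f x| < n.+1%:R^-1])) => n.
  by apply: H; rewrite invr_gt0.
exists u; split; [by move=> n; case: (Hu n)|by move=> n; case: (Hu n)|].
apply/cvgr0Pnorm_lt => e e0.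
near=> n; case: (Hu n) => _ _ /lt_trans; apply.
near: n; exact: (near_infty_natSinv_lt (PosNum e0)).
Unshelve. all: by end_near. Qed.

Lemma cvg_far_window (v : nat -> bool) (y : R) : (\forall n \near \oo, v n) ->
  y * (v n)%:R @[n --> \oo] --> y.
Proof.
move=> vn; apply: cvg_near_cst.
by near=> n; rewrite (_ : v n) ?mulr1//; near: n.
Unshelve. all: by end_near. Qed.

Lemma ray_ibp U dU a : der U dU -> continuous dU ->
  intg leb (fun x => U x * (a <= x)%R%:R) ->
  intg leb (fun x => dU x * (a <= x)%R%:R) ->
  Exp leb (fun x => dU x * (a <= x)%R%:R) = - U a.
Proof.
move=> Ud dUc iU idU; have [u [ua un Uu]] := far_sequence iU.
have [||||_ cv] := @Exp_dct _ _ _ leb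
    (fun n x => dU x * (a <= x <= u n)%R%:R) (fun x => dU x * (a <= x)%R%:R)
    (fun x => `|dU x * (a <= x)%R%:R|).
- by move=> n; exact/intg_measurable/intg_segment.
- move=> x; have [ax|xa] := leP a x; last first.
    by under eq_fun do rewrite /= mulr0; rewrite mulr0; exact: cvg_cst.
  rewrite mulr1; apply: cvg_far_window; near=> n.
  by apply: le_trans (un n); near: n; exact: nbhs_infty_ger.
- move=> n x; case: (leP a x) => ax; rewrite /= ?mulr1 ?mulr0//.
  by case: (x <= _); rewrite ?mulr1// mulr0 normr0.
- exact: intg_norm.
have cv2 : U (u n) - U a @[n --> \oo] --> 0 - U a.
  by apply: cvgB => //; exact: cvg_cst.
rewrite sub0r in cv2; apply: cvg_unique cv2; first exact: Rhausdorff.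
apply: cvg_trans cv; apply: near_eq_cvg; apply: nearW => n.
by rewrite (Exp_FTC Ud).
Unshelve. all: by end_near. Qed.

Lemma line_ibp U dU : der U dU -> continuous dU -> intg leb U -> intg leb dU ->
  Exp leb dU = 0.
Proof.
move=> Ud dUc iU idU.
have mUr (f : R -> R) : continuous f -> intg leb f ->
    intg leb (fun x => f x * (0 <= x)%R%:R).
  move=> fc fi; apply: (intg_le _ _ (intg_norm fi)).
    by apply: measurable_funM; [exact: continuous_meas|exact: measurable_ray].
  by move=> x; case: (0 <= x); rewrite ?mulr1// mulr0 normr0.
have Uc := der_continuous Ud.
have [u [u0 un Uu]] := far_sequence (mUr _ Uc iU).
have Uoc : continuous (fun x => U (- x)).
  by apply: continuous_o => //; exact: opp_continuous.
have iUo := intg_leb_opp (continuous_meas Uc) iU.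
have [v [v0 vn Uv]] := far_sequence (mUr _ Uoc iUo).
have [||||_ cv] := @Exp_dct _ _ _ leb
    (fun n x => dU x * (- v n <= x <= u n)%R%:R) dU (fun x => `|dU x|).
- by move=> n; exact/intg_measurable/intg_segment.
- move=> x; apply: cvg_far_window; near=> n; apply/andP; split.
    rewrite lerNl; apply: le_trans (vn n); near: n; exact: nbhs_infty_ger.
  by apply: le_trans (un n); near: n; exact: nbhs_infty_ger.
- by move=> n x; case: andP => _; rewrite ?mulr1// mulr0 normr0.
- exact: intg_norm.
have cv2 : U (u n) - U (- v n) @[n --> \oo] --> (0 - 0 : R) by exact: cvgB.
rewrite subrr in cv2; apply: cvg_unique cv2; first exact: Rhausdorff.
apply: cvg_trans cv; apply: near_eq_cvg; apply: nearW => n.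
by rewrite (Exp_FTC Ud)// (@le_trans _ _ 0)// oppr_le0.
Unshelve. all: by end_near. Qed.

End WholeLine.

(** * The standard normal law *)

Section Gauss.
Context (R : realType).
Local Notation leb := (@lebesgue_measure R).
Implicit Types (f h dh : R -> R) (a b x : R).

Definition gauss : probability (measurableTypeR R) R := normal_prob 0 1.
Definition gpdf : R -> R := normal_pdf 0 1.
Local Notation p := gpdf.

Lemma gpdfE x : p x = normal_peak 1 * expR (- (x ^+ 2 / 2)).
Proof.
rewrite /gpdf normal_pdfE ?oner_neq0// /normal_fun subr0 expr1n.
by rewrite mulNr.
Qed.

Lemma gpeak_gt0 : 0 < normal_peak 1 :> R.
Proof. by rewrite normal_peak_gt0// oner_neq0. Qed.

Lemma gpdf_gt0 x : 0 < p x.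
Proof. by rewrite gpdfE mulr_gt0 ?expR_gt0// gpeak_gt0. Qed.

Lemma gpdf_ge0 x : 0 <= p x. Proof. exact/ltW/gpdf_gt0. Qed.

Lemma gpdfN x : p (- x) = p x.
Proof. by rewrite !gpdfE sqrrN. Qed.

Lemma der_expR_comp (x : R) f d : is_derive x 1 f d ->
  is_derive x 1 (fun y => expR (f y)) (expR (f x) * d).
Proof. by move=> fd; apply: (is_derive_o (f := expR)). Qed.

Lemma der_gpdf : der p (fun x => - x * p x).
Proof.
move=> x; have -> : p = fun x => normal_peak 1 * expR (- (x ^+ 2 / 2)).
  by apply/funext => y; exact: gpdfE.
have D := is_derive_scale (normal_peak 1) (der_expR_comp (is_derive_opp
  (is_derive_mul (is_derive_exp 2 (is_derive_idfun x)) (is_derive_const x 2^-1)))).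
apply: is_derive_eq D _; rewrite /= expr1; lra.
Qed.

Lemma continuous_gpdf : continuous p.
Proof. exact: der_continuous der_gpdf. Qed.

Lemma intg_gpdf : intg leb p.
Proof. exact: integrable_normal_pdf. Qed.

Lemma Exp_gpdf : Exp leb p = 1.
Proof. by rewrite /Exp /Rintegral integral_normal_pdf. Qed.

Lemma intg_gauss f : measurable_fun setT f ->
  intg gauss f <-> intg leb (fun x => f x * p x).
Proof. exact: normal_prob_intg. Qed.

Lemma Exp_gauss f : measurable_fun setT f ->
  Exp gauss f = Exp leb (fun x => f x * p x).
Proof. exact: normal_prob_Exp. Qed.

Lemma intg_cut f a : measurable_fun setT f -> intg leb f ->
  intg leb (fun x => f x * (a <= x)%R%:R).
Proof.
move=> mf fi; apply: (intg_le _ _ (intg_norm fi)).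
  by apply: measurable_funM => //; exact: measurable_ray.
by move=> x; case: (a <= x); rewrite ?mulr1// mulr0 normr0.
Qed.

Lemma intg_cut_le f a b : a <= b -> measurable_fun setT f ->
  intg leb (fun x => f x * (a <= x)%R%:R) ->
  intg leb (fun x => f x * (b <= x)%R%:R).
Proof.
move=> ab mf fi; apply: (intg_le _ _ (intg_norm fi)).
  by apply: measurable_funM => //; exact: measurable_ray.
move=> x; case: (leP b x) => bx; rewrite ?mulr0 ?normr0//.
by rewrite (le_trans ab bx).
Qed.

(** Continuity takes care of [[- a, a]]. Only tails need estimates, and the left tail is a right
    tail after reflection. *)
Lemma intg_patch f a : 0 <= a -> continuous f ->
  intg leb (fun x => f x * (a <= x)%R%:R) ->
  intg leb (fun x => f (- x) * (a <= x)%R%:R) -> intg leb f.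
Proof.
move=> a0 fc i1 i2.
have mo : measurable_fun setT (fun x : R => f (- x)).
  apply: continuous_meas; apply: continuous_o => //; exact: opp_continuous.
have m2 : measurable_fun setT (fun x => f (- x) * (a <= x)%R%:R).
  by apply: measurable_funM => //; exact: measurable_ray.
have i3 := intg_leb_opp m2 i2.
have i4 := @intg_segment R f (- a) a fc.
apply: (intg_le _ _
  (intgD (intgD (intg_norm i1) (intg_norm i3)) (intg_norm i4))) => [|x].
  exact: continuous_meas.
rewrite opprK; case: (leP a x) => ax /=.
  by rewrite mulr1 -addrA lerDl addr_ge0.
have [ax2|ax2] := leP a (- x).
  by rewrite !mulr0 normr0 add0r mulr1 lerDl.
have -> : - a <= x by lra.
by rewrite (ltW ax) !mulr0 normr0 !add0r mulr1.
Qed.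

Lemma young_cube (s t : R) : 4 * s ^+ 3 * t <= 3 * s ^+ 4 + t ^+ 4.
Proof.
rewrite -subr_ge0.
have -> : 3 * s ^+ 4 + t ^+ 4 - 4 * s ^+ 3 * t =
    (s - t) ^+ 2 * (2 * s ^+ 2 + (s + t) ^+ 2) by ring.
by rewrite mulr_ge0 ?sqr_ge0// addr_ge0 ?sqr_ge0// mulr_ge0// sqr_ge0.
Qed.

Lemma continuous_gM f : continuous f -> continuous (fun x => f x * p x).
Proof. by move=> fc; apply: continuous_mul => //; exact: continuous_gpdf. Qed.

Lemma expr4_ge0 (s : R) : 0 <= s ^+ 4.
Proof. by rewrite -[4%N]/(2 * 2)%N exprM sqr_ge0. Qed.

Lemma expr4N (s : R) : (- s) ^+ 4 = s ^+ 4.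
Proof. by ring. Qed.

(** [energy] with U = h^4 p, whose derivative is (4 h^3 h' - x h^4) p. By Young's inequality 4 h^3
    h' <= 3 h^4 + h'^4, and for x >= 4 the term - x h^4 absorbs 3 h^4 and still leaves - h^4. *)
Lemma L4_primitive_ray h dh : der h dh -> continuous dh ->
  intg leb (fun x => dh x ^+ 4 * p x * (4 <= x)%R%:R) ->
  intg leb (fun x => h x ^+ 4 * p x * (4 <= x)%R%:R).
Proof.
move=> hd dc i1; have hc := der_continuous hd.
apply: proj1; apply: (@energy R (fun x => h x ^+ 4 * p x)
  (fun x => h x ^+ 4 * (- x * p x) + p x * (4 * h x ^+ 3 * dh x))
  (fun x => dh x ^+ 4 * p x) (fun x => h x ^+ 4 * p x) 4 0) => //.
- move=> x; apply: is_derive_mul; last exact: der_gpdf.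
  exact: is_derive_exp.
- apply: continuous_add; apply: continuous_mul.
  + exact: continuous_exp.
  + by apply: continuous_gM; exact: opp_continuous.
  + exact: continuous_gpdf.
  + apply: continuous_mul => //; apply: continuous_mul.
      exact: continuous_const.
    exact: continuous_exp.
- by apply: continuous_gM; exact: continuous_exp.
- by apply: continuous_gM; exact: continuous_exp.
- by move=> x _; rewrite mulr_ge0 ?gpdf_ge0 ?expr4_ge0.
- by move=> x _; rewrite mulr_ge0 ?gpdf_ge0 ?expr4_ge0.
- move=> x x4; have := young_cube (h x) (dh x); have := expr4_ge0 (h x).
  set P := p x; have : 0 <= P := gpdf_ge0 x.
  set H4 := h x ^+ 4; set Y := 4 * _ * _; set D4 := dh x ^+ 4.
  move=> P0 H0 HY; rewrite -subr_ge0.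
  have -> : D4 * P - H4 * P - (H4 * (- x * P) + P * Y) =
    P * ((D4 + 3 * H4 - Y) + (x - 4) * H4) by ring.
  apply: mulr_ge0 => //; apply: addr_ge0; first by lra.
  by apply: mulr_ge0 => //; lra.
- by move=> x _; rewrite oppr0 mulr_ge0 ?gpdf_ge0 ?expr4_ge0.
Qed.

Lemma der_reflect h dh : der h dh -> der (fun x => h (- x)) (fun x => - dh (- x)).
Proof.
move=> hd x.
by apply: is_derive_eq (is_derive_o (hd (- x)) (is_derive_opp (is_derive_idfun x))) _;
  rewrite mulrN1.
Qed.

Lemma continuous_reflect f : continuous f -> continuous (fun x => f (- x)).
Proof. by move=> fc; apply: continuous_o => //; exact: opp_continuous. Qed.

Lemma L4_primitive h dh : der h dh -> continuous dh ->
  intg gauss (fun x => dh x ^+ 4) -> intg gauss (fun x => h x ^+ 4).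
Proof.
move=> hd dc; have hc := der_continuous hd.
have c4 f : continuous f -> continuous (fun x => f x ^+ 4 * p x).
  by move=> fc; apply: continuous_gM; exact: continuous_exp.
rewrite !intg_gauss; try by apply: continuous_meas; exact: continuous_exp.
move=> i1; apply: (@intg_patch _ 4) => //; first exact: c4.
  apply: L4_primitive_ray => //; apply: intg_cut => //; exact: continuous_meas (c4 _ dc).
under eq_fun do rewrite gpdfN.
apply: (L4_primitive_ray (der_reflect hd)).
  by apply: (continuous_o opp_continuous); exact: continuous_reflect.
under eq_fun do rewrite expr4N -gpdfN.
have := intg_leb_opp (continuous_meas (c4 _ dc)) i1.
apply: intg_cut; apply: continuous_meas.
exact: (continuous_reflect (c4 _ dc)).
Qed.

End Gauss.

(** * Poincare inequality for one standard normal variable *)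

Section GaussPoincare.
Context (R : realType).
Local Notation leb := (@lebesgue_measure R).
Local Notation p := (@gpdf R).
Local Notation gauss := (gauss R).
Implicit Types (f h dh : R -> R) (a b x : R).

(* The weight [1 + exp (- x)] is bounded on the half-line while its product
   with [p] has derivative at most [- p]. *)
Lemma poincare_ray h dh : der h dh -> continuous dh -> h 0 = 0 ->
  intg leb (fun x => dh x ^+ 2 * p x * (0 <= x)%R%:R) ->
  intg leb (fun x => h x ^+ 2 * p x * (0 <= x)%R%:R) /\
  Exp leb (fun x => h x ^+ 2 * p x * (0 <= x)%R%:R) <=
    16 * Exp leb (fun x => dh x ^+ 2 * p x * (0 <= x)%R%:R).
Proof.
move=> hd dc h0 i1; have hc := der_continuous hd.
pose kap x : R := 1 + expR (- x).
have kd : der kap (fun x => - expR (- x)).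
  move=> x; have D := is_derive_add (is_derive_const x 1)
    (der_expR_comp (is_derive_opp (is_derive_idfun x))).
  by apply: is_derive_eq D _; rewrite add0r mulrN1.
have kc := der_continuous kd.
pose U x := h x ^+ 2 * (kap x * p x).
pose dU x := h x ^+ 2 * (kap x * (- x * p x) + p x * - expR (- x)) +
  kap x * p x * (2%:R * h x ^+ 1 * dh x).
have Ud : der U dU.
  move=> x; apply: is_derive_mul; first exact: is_derive_exp.
  by apply: is_derive_mul; [exact: kd|exact: der_gpdf].
have dUc : continuous dU.
  apply: continuous_add; apply: continuous_mul.
  - exact: continuous_exp.
  - apply: continuous_add; apply: continuous_mul => //.
    + by apply: continuous_gM; exact: opp_continuous.
    + exact: continuous_gpdf.
    + apply: continuous_o; first exact: opp_continuous.
      apply: continuous_o; [exact: continuous_expR|exact: opp_continuous].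
  - exact: continuous_gM.
  - apply: continuous_mul => //; apply: continuous_mul.
      exact: continuous_const.
    exact: continuous_exp.
have c2 f k : continuous f -> continuous (fun x => k * (f x ^+ 2 * p x)).
  move=> fc; apply: continuous_mul; first exact: continuous_const.
  by apply: continuous_gM; exact: continuous_exp.
have f0 f k x : 0 <= k -> 0 <= k * (f x ^+ 2 * p x).
  by move=> k0; rewrite mulr_ge0// mulr_ge0 ?gpdf_ge0 ?sqr_ge0.
have i1' : intg leb (fun x => 8 * (dh x ^+ 2 * p x) * (0 <= x)%R%:R).
  by under eq_fun do rewrite -mulrA; exact: intgZ.
have [|||||iB leB] := @energy R U dU (fun x => 8 * (dh x ^+ 2 * p x))
  (fun x => 2^-1 * (h x ^+ 2 * p x)) 0 0 Ud dUc (c2 _ _ dc) (c2 _ _ hc).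
- by move=> x _; exact: f0.
- by move=> x _; apply: f0; rewrite invr_ge0.
- move=> x x0; rewrite /dU /kap.
  have e0 := expR_gt0 (- x); have e1 := expR_ge1Dx (- x).
  have e2 : expR (- x) <= 1 by rewrite -expR0 ler_expR; lra.
  have P0 := gpdf_ge0 x.
  set e := expR (- x) in e0 e1 e2 *; set P := p x in P0 *.
  set H := h x; set D := dh x.
  rewrite -subr_ge0.
  (* The cross term is completed to a square, which uses up 2 (1 + e)^2 D^2. Since e <= 1, the
     coefficient 8 covers this, with remainder 8 - 2 (1 + e)^2 = 2 (3 + e) (1 - e). The factor 16 of
     the statement is 8 divided by the 1/2 in front of H^2. *)
  have -> : 8 * (D ^+ 2 * P) - 2^-1 * (H ^+ 2 * P) -
      (H ^+ 2 * ((1 + e) * (- x * P) + P * - e) +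
       (1 + e) * P * (2 * H ^+ 1 * D)) =
    P * (H ^+ 2 * (x + (x + 1) * e - 1) + 2^-1 * (H - 2 * (1 + e) * D) ^+ 2 +
         2 * (3 + e) * (1 - e) * D ^+ 2) by field.
  apply: mulr_ge0 => //; apply: addr_ge0; last first.
    by apply: mulr_ge0; [nra|exact: sqr_ge0].
  apply: addr_ge0; last by apply: mulr_ge0; [lra|exact: sqr_ge0].
  apply: mulr_ge0; first exact: sqr_ge0.
  (* For x <= 1, the bound e >= 1 - x gives x + (x + 1) e - 1 >= x (1 - x) >= 0; for x > 1 the
     expression is clearly positive. *)
  case: (leP x 1) => x1; nra.
- move=> x _; rewrite oppr0 mulr_ge0 ?sqr_ge0// mulr_ge0 ?gpdf_ge0//.
  by rewrite /kap addr_ge0// expR_ge0.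
- exact: i1'.
have E1 : (fun x => h x ^+ 2 * p x * (0 <= x)%R%:R) =
    fun x => 2 * (2^-1 * (h x ^+ 2 * p x) * (0 <= x)%R%:R).
  by apply/funext => x; field.
have E2 : (fun x => 8 * (dh x ^+ 2 * p x) * (0 <= x)%R%:R) =
    fun x => 8 * (dh x ^+ 2 * p x * (0 <= x)%R%:R).
  by apply/funext => x; ring.
split; first by rewrite E1; exact: intgZ.
rewrite E1 ExpZ//; move: leB; rewrite E2 ExpZ//.
rewrite /U h0 expr0n/= mul0r; lra.
Qed.

Lemma gauss_poincare_point h dh : der h dh -> continuous dh -> h 0 = 0 ->
  intg gauss (fun x => dh x ^+ 2) ->
  intg gauss (fun x => h x ^+ 2) /\
  Exp gauss (fun x => h x ^+ 2) <= 32 * Exp gauss (fun x => dh x ^+ 2).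
Proof.
move=> hd dc h0; have hc := der_continuous hd.
have c2 f : continuous f -> continuous (fun x => f x ^+ 2 * p x).
  by move=> fc; apply: continuous_gM; exact: continuous_exp.
rewrite !intg_gauss; try by apply: continuous_meas; exact: continuous_exp.
rewrite !Exp_gauss; try by apply: continuous_meas; exact: continuous_exp.
move=> i1.
have iray f : continuous f -> intg leb f ->
    intg leb (fun x => f x * (0 <= x)%R%:R) /\
    ((forall x, 0 <= f x) ->
    Exp leb (fun x => f x * (0 <= x)%R%:R) <= Exp leb f).
  move=> fc fi; have fi1 : intg leb (fun x => f x * (0 <= x)%R%:R).
    by apply: intg_cut => //; exact: continuous_meas.
  split=> // f0; apply: le_Exp => // x.
  by case: (0 <= x); rewrite ?mulr1// mulr0.
have dh0 x : 0 <= dh x ^+ 2 * p x by rewrite mulr_ge0 ?sqr_ge0 ?gpdf_ge0.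
have hh0 x : 0 <= h x ^+ 2 * p x by rewrite mulr_ge0 ?sqr_ge0 ?gpdf_ge0.
have [j1 l1] := iray _ (c2 _ dc) i1.
have [i2 l2] := poincare_ray hd dc h0 j1.
have E f x : f (- x) ^+ 2 * p (- x) = f (- x) ^+ 2 * p x by rewrite gpdfN.
have i3 := intg_leb_opp (continuous_meas (c2 _ dc)) i1.
have [j3 l3] := iray _ (continuous_reflect (c2 _ dc)) i3.
have [|||i4 l4] := poincare_ray (der_reflect hd).
- by apply: (continuous_o opp_continuous); exact: continuous_reflect.
- by rewrite oppr0.
- by move: j3; under eq_fun do rewrite E -sqrrN.
have i4' : intg leb (fun x => h (- x) ^+ 2 * p (- x) * (0 <= x)%R%:R).
  by under eq_fun do rewrite E.
have ih : intg leb (fun x => h x ^+ 2 * p x).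
  by apply: (intg_patch (lexx 0)) => //; exact: c2.
split=> //.
pose f1 x := h x ^+ 2 * p x * (0 <= x)%R%:R.
pose f2 x := h (- x) ^+ 2 * p (- x) * (0 <= x)%R%:R.
have mf2 : measurable_fun setT f2.
  apply: measurable_funM; last exact: measurable_ray.
  exact: continuous_meas (continuous_reflect (c2 _ hc)).
have L : Exp leb (fun x => h x ^+ 2 * p x) <= Exp leb f1 + Exp leb f2.
  rewrite -(Exp_leb_opp mf2) -ExpD//; last exact: intg_leb_opp.
  apply: le_Exp => // [|x]; first by apply: intgD => //; exact: intg_leb_opp.
  rewrite /f1 /f2 opprK.
  case: (leP 0 x) => x0; case: (leP 0 (- x)) => x0'; rewrite ?mulr1 ?mulr0 ?addr0 ?add0r//.
    by rewrite lerDl.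
  by move: x0'; rewrite oppr_lt0 ltNge (ltW x0).
have {}l3 := l3 (fun x => dh0 _); have {}l1 := l1 dh0.
have mdd := continuous_meas (c2 _ dc).
rewrite (Exp_leb_opp mdd) in l3.
have E4 : (fun x => (- dh (- x)) ^+ 2 * p x * (0 <= x)%R%:R) =
   (fun x => dh (- x) ^+ 2 * p (- x) * (0 <= x)%R%:R).
  by apply/funext => x; rewrite sqrrN gpdfN.
rewrite E4 in l4.
have E5 : (fun x => h (- x) ^+ 2 * p x * (0 <= x)%R%:R) = f2.
  by apply/funext => x; rewrite /f2 gpdfN.
rewrite E5 in l4; apply: (le_trans L); apply: (le_trans (lerD l2 l4)).
(* Each of the two half-line integrals of the squared derivative is bounded by the integral over the
   whole line, hence the doubling. *)
rewrite (_ : 32 = 16 + 16 :> R); last by rewrite -natrD.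
by rewrite [leRHS]mulrDl lerD ?ler_pM2l.
Qed.

(* The variance of [h] is at most the second moment of [h - h 0]. *)
Lemma gauss_poincare h dh : der h dh -> continuous dh ->
  intg gauss (fun x => dh x ^+ 2) ->
  [/\ intg gauss h, intg gauss (fun x => h x ^+ 2) &
  Exp gauss (fun x => h x ^+ 2) - (Exp gauss h) ^+ 2 <=
    32 * Exp gauss (fun x => dh x ^+ 2)].
Proof.
move=> hd dc i1; have hc := der_continuous hd.
pose k x := h x - h 0.
have kd : der k dh.
  move=> x; have D := is_derive_sub (hd x) (is_derive_const x (h 0)).
  by apply: is_derive_eq D _; rewrite subr0.
have [|i2 l2] := gauss_poincare_point kd dc _ i1; first by rewrite /k subrr.
have mk := continuous_meas (der_continuous kd).
have ik : intg gauss k.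
  apply: (intg_le _ _ (intgD (intg_cst gauss 1) i2)) => [|x]; first exact: mk.
  rewrite -real_normK ?num_real//; have := normr_ge0 (k x); nra.
have hk : h = fun x => k x + h 0 by apply/funext => x; rewrite /k subrK.
have h2 : (fun x => h x ^+ 2) = fun x => k x ^+ 2 + ((h 0 *+ 2) * k x + h 0 ^+ 2).
  by apply/funext => x; rewrite /k; ring.
have ic c := intg_cst gauss c.
have iz : intg gauss (fun x => (h 0 *+ 2) * k x + h 0 ^+ 2).
  by apply: intgD => //; exact: intgZ.
split; first by rewrite hk; exact: intgD.
  by rewrite h2; exact: intgD.
rewrite h2 ExpD// ExpD//; last exact: intgZ.
rewrite (ExpZ (h 0 *+ 2))//.
have Eh : Exp gauss h = Exp gauss k + h 0.
  by rewrite {1}hk ExpD// (Exp_cst gauss (h 0)).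
rewrite (Exp_cst gauss (h 0 ^+ 2)) Eh.
apply: le_trans l2; have := sqr_ge0 (Exp gauss k); nra.
Qed.

End GaussPoincare.

(** * Stein's equation *)

Section Tails.
Context (R : realType).
Local Notation leb := (@lebesgue_measure R).
Implicit Types (f F : R -> R) (a b x : R).

Lemma has_primitive f : continuous f -> intg leb f -> exists F, der F f.
Proof.
move=> fc fi.
exists (fun x => \int[leb]_(t in [set` Interval -oo%O (BRight x)]) f t) => x.
have [||||D1 D2] := @continuous_FTC1 R f -oo%O x (x + 1).
- by rewrite ltrDl.
- exact: (integrableS measurableT) fi.
- by rewrite ltNyr.
- exact: fc.
split; first exact: D1.
by rewrite -derive1E.
Qed.

Lemma primitive_limit F f x : der F f -> continuous f ->
  intg leb (fun y => f y * (x <= y)%R%:R) ->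
  F n%:R @[n --> \oo] --> F x + Exp leb (fun y => f y * (x <= y)%R%:R).
Proof.
move=> Fd fc fi.
have [||||_ cv] := @Exp_dct _ _ _ leb
    (fun n y => f y * (x <= y <= n%:R)%R%:R) (fun y => f y * (x <= y)%R%:R)
    (fun y => `|f y * (x <= y)%R%:R|).
- by move=> n; exact/intg_measurable/intg_segment.
- move=> y; have [xy|yx] := leP x y; last first.
    by under eq_fun do rewrite /= mulr0; rewrite mulr0; exact: cvg_cst.
  rewrite mulr1; apply: cvg_far_window; near=> n.
  by near: n; exact: nbhs_infty_ger.
- move=> n y; case: (leP x y) => xy; rewrite /= ?mulr1 ?mulr0//.
  by case: (y <= _); rewrite ?mulr1// mulr0 normr0.
- exact: intg_norm.
have cv2 : F x + Exp leb (fun y => f y * (x <= y <= n%:R)%R%:R) @[n --> \oo] -->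
    F x + Exp leb (fun y => f y * (x <= y)%R%:R).
  by apply: cvgD => //; exact: cvg_cst.
apply: cvg_trans cv2; apply: near_eq_cvg; near=> n.
rewrite (Exp_FTC Fd)//; first by rewrite addrC subrK.
by near: n; exact: nbhs_infty_ger.
Unshelve. all: by end_near. Qed.

(** One primitive with its limits at both ends expresses the upper tails, the lower tails and the
    total integral, so that a vanishing total turns one kind of tail into the other. The constancy
    of [F x] plus the upper tail at [x] follows from the uniqueness of the limit of [F n]. *)
Lemma tails f : continuous f -> intg leb f -> exists F L L',
  [/\ der F f, forall x, Exp leb (fun y => f y * (x <= y)%R%:R) = L - F x,
    forall x, Exp leb (fun y => f (- y) * (x <= y)%R%:R) = F (- x) - L' &
    Exp leb f = L - L'].
Proof.
move=> fc fi; have [F Fd] := has_primitive fc fi.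
have mf := continuous_meas fc.
have rc := continuous_reflect fc.
have Gd : der (fun y => - F (- y)) (fun y => f (- y)).
  move=> x; apply: is_derive_eq (is_derive_opp (der_reflect Fd x)) _.
  by rewrite opprK.
have i1 x := intg_cut x mf fi.
have i2 x := intg_cut x (continuous_meas rc) (intg_leb_opp mf fi).
pose L := F 0 + Exp leb (fun y => f y * (0 <= y)%R%:R).
pose L2 := - F (- 0) + Exp leb (fun y => f (- y) * (0 <= y)%R%:R).
have E1 x : F x + Exp leb (fun y => f y * (x <= y)%R%:R) = L.
  apply: cvg_unique (primitive_limit Fd fc (i1 x)) (primitive_limit Fd fc (i1 0)).
  exact: Rhausdorff.
have E2 x : - F (- x) + Exp leb (fun y => f (- y) * (x <= y)%R%:R) = L2.
  apply: cvg_unique (primitive_limit Gd rc (i2 x)) (primitive_limit Gd rc (i2 0)).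
  exact: Rhausdorff.
exists F, L, (- L2); split => [//|x|x|].
- by rewrite -(E1 x) addrAC subrr add0r.
- by rewrite -(E2 x); lra.
have [||||_ cv] := @Exp_dct _ _ _ leb
    (fun n x => f x * (- n%:R <= x <= n%:R)%R%:R) f (fun x => `|f x|).
- by move=> n; exact/intg_measurable/intg_segment.
- move=> x; apply: cvg_far_window; near=> n; apply/andP; split.
    by rewrite lerNl; near: n; exact: nbhs_infty_ger.
  by near: n; exact: nbhs_infty_ger.
- by move=> n x; case: andP => _; rewrite ?mulr1// mulr0 normr0.
- exact: intg_norm.
have cv2 : F n%:R + - F (- n%:R) @[n --> \oo] --> L + L2.
  apply: cvgD; first exact: (primitive_limit Fd fc (i1 0)).
  exact: (primitive_limit Gd rc (i2 0)).
rewrite opprK; apply: cvg_unique cv2; first exact: Rhausdorff.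
apply: cvg_trans cv; apply: near_eq_cvg; apply: nearW => n.
by rewrite (Exp_FTC Fd)// (@le_trans _ _ 0)// oppr_le0.
Unshelve. all: by end_near. Qed.

End Tails.

(** * The solution of Stein's equation and its bounds for bounded data *)

Section SteinOperator.
Context (R : realType).
Local Notation leb := (@lebesgue_measure R).
Local Notation p := (@gpdf R).
Local Notation gauss := (gauss R).
Implicit Types (f v phi psi dphi : R -> R) (a b x : R).

Lemma continuous_id_gpdf : continuous (fun x => x * p x).
Proof. by apply: continuous_gM; exact: continuous_idfun. Qed.

Lemma der_gpdfN : der (fun x => - p x) (fun x => x * p x).
Proof.
move=> x; apply: is_derive_eq (is_derive_opp (der_gpdf x)) _.
by rewrite mulNr opprK.
Qed.

Lemma intg_id_gpdf : intg leb (fun x => x * p x).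
Proof.
have i1 : intg leb (fun x => x * p x * (0 <= x)%R%:R).
  apply: proj1; apply: (@energy R p (fun x => - x * p x) (fun=> 0)
    (fun x => x * p x) 0 0) => //.
  - exact: der_gpdf.
  - by apply: continuous_gM; exact: opp_continuous.
  - exact: continuous_const.
  - exact: continuous_id_gpdf.
  - by move=> x x0; rewrite mulr_ge0 ?gpdf_ge0.
  - by move=> x x0; rewrite sub0r mulNr.
  - by move=> x _; rewrite oppr0 gpdf_ge0.
  - by under eq_fun do rewrite mul0r; exact: intg0.
apply: (intg_patch (lexx 0)) => //; first exact: continuous_id_gpdf.
have := intgN i1; congr intg; apply/funext => x.
by rewrite gpdfN !mulNr.
Qed.

(** [- p] is a primitive of the integrand. Other Gaussian tails are estimated by comparison with
    this explicit one. *)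
Lemma mills a : Exp leb (fun x => x * p x * (a <= x)%R%:R) = p a.
Proof.
rewrite (ray_ibp der_gpdfN) ?opprK//.
- exact: continuous_id_gpdf.
- under eq_fun do rewrite mulNr; apply: intgN; apply: intg_cut.
    exact: continuous_meas (@continuous_gpdf R).
  exact: intg_gpdf.
- apply: intg_cut; first exact: continuous_meas continuous_id_gpdf.
  exact: intg_id_gpdf.
Qed.

(** Variation of constants: the equation u' = x u - phi is equivalent to (u p)' = - phi p, and the
    solution chosen is the one for which u p vanishes at plus infinity. *)
Definition stein phi x := Exp leb (fun y => phi y * p y * (x <= y)%R%:R) / p x.

Lemma stein_gpdf phi x :
  stein phi x * p x = Exp leb (fun y => phi y * p y * (x <= y)%R%:R).
Proof. by rewrite /stein divfK// gt_eqF// gpdf_gt0. Qed.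

Section Equation.
Variable phi : R -> R.
Hypotheses (phic : continuous phi) (phii : intg gauss phi)
  (phi0 : Exp gauss phi = 0).

Let mphi := continuous_meas phic.
Let phipc := continuous_gM phic.
Let phipi : intg leb (fun x => phi x * p x).
Proof. exact/(intg_gauss mphi). Qed.

Lemma der_stein : der (stein phi) (fun x => x * stein phi x - phi x).
Proof.
have [F [L [L' [Fd E1 _ _]]]] := tails phipc phipi.
have E x : stein phi x = (L - F x) * ((normal_peak 1)^-1 * expR (x ^+ 2 / 2)).
  rewrite /stein E1 gpdfE invfM -expRN opprK; ring.
move=> x; rewrite (_ : stein phi = fun x =>
    (L - F x) * ((normal_peak 1)^-1 * expR (x ^+ 2 / 2))); last exact/funext.
have D1 := is_derive_scale (normal_peak 1)^-1 (der_expR_comp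
  (is_derive_mul (is_derive_exp 2 (is_derive_idfun x)) (is_derive_const x 2^-1))).
have D2 := is_derive_mul (is_derive_sub (is_derive_const x L) (Fd x)) D1.
apply: is_derive_eq D2 _.
rewrite gpdfE expRN; have e0 := gt_eqF (expR_gt0 (x ^+ 2 / 2)).
have k0 := gt_eqF (@gpeak_gt0 R); rewrite /= expr1; field.
by rewrite e0 k0.
Qed.

(** As [phi] is centered, the lower tail of [phi p] is minus the upper one; hence x |-> - u(- x) is
    the solution for the reflected data, and estimates on the right half-line carry over to the
    left. *)
Lemma stein_reflect x : - stein phi (- x) * p x =
  Exp leb (fun y => phi (- y) * p y * (x <= y)%R%:R).
Proof.
have [F [L [L' [Fd E1 E2 E3]]]] := tails phipc phipi.
rewrite -[p x]gpdfN mulNr stein_gpdf E1 opprB.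
rewrite -(Exp_gauss mphi) phi0 in E3.
have -> : (fun y => phi (- y) * p y * (x <= y)%R%:R) =
    (fun y => phi (- y) * p (- y) * (x <= y)%R%:R).
  by apply/funext => y; rewrite gpdfN.
by rewrite E2; lra.
Qed.

End Equation.

(** On the domain of integration x <= y, so the factor x is replaced under the integral by y, and
    [mills] evaluates the result. *)
Lemma tail_bound phi x : continuous phi -> (forall y, `|phi y| <= 1) -> 0 <= x ->
  `|x * Exp leb (fun y => phi y * p y * (x <= y)%R%:R)| <= p x.
Proof.
move=> phic phi1 x0.
have m1 : measurable_fun setT (fun y => phi y * p y * (x <= y)%R%:R).
  apply: measurable_funM; last exact: measurable_ray.
  exact: continuous_meas (continuous_gM phic).
have i1 : intg leb (fun y => phi y * p y * (x <= y)%R%:R).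
  apply: (intg_le _ _ (@intg_gpdf R)) => [|y]; first exact: m1.
  rewrite !normrM (ger0_norm (gpdf_ge0 y)).
  have := phi1 y; have := gpdf_ge0 y; case: (x <= y) => P0 Q1.
    by rewrite normr1 mulr1 ler_piMl.
  by rewrite normr0 mulr0.
rewrite -ExpZ// -mills; apply: Exp_norm_le.
- exact: intg_measurable (intgZ x i1).
- move=> y; case: (leP x y) => xy; rewrite ?mulr0 ?normr0// !mulr1.
  rewrite !normrM (ger0_norm (gpdf_ge0 y)) (ger0_norm x0) mulrA.
  apply: ler_wpM2r; first exact: gpdf_ge0.
  by rewrite -[leRHS]mulr1 ler_pM.
- apply: intg_cut; first exact: continuous_meas continuous_id_gpdf.
  exact: intg_id_gpdf.
Qed.

(** The constant 2 is the sum of |x u| <= 1 and |phi| <= 1. The first bound also gives |u| <= 1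
    where |x| >= 1; elsewhere p is at least p(1), so division by p is harmless. *)
Lemma stein_bounded phi : continuous phi -> (forall y, `|phi y| <= 1) ->
  Exp gauss phi = 0 ->
  exists u, [/\ der u (fun x => x * u x - phi x),
    (forall x, `|x * u x - phi x| <= 2) & exists C, forall x, `|u x| <= C].
Proof.
move=> phic phi1 phi0.
have phii : intg gauss phi.
  apply: (intg_le _ _ (intg_cst gauss 1)) => //; exact: continuous_meas.
have b1 x : `|x * stein phi x| <= 1.
  have p0 := gpdf_gt0 x.
  suff : `|x * (stein phi x * p x)| <= p x.
    by rewrite mulrA normrM (gtr0_norm p0) -[leRHS]mul1r ler_pM2r.
  have [x0|x0] := leP 0 x; first by rewrite stein_gpdf tail_bound.
  have := stein_reflect phic phii phi0 (- x); rewrite opprK gpdfN => E.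
  have -> : x * (stein phi x * p x) = (- x) * (- stein phi x * p x) by ring.
  rewrite E -[p x]gpdfN; apply: tail_bound; last by lra.
    exact: continuous_reflect.
  by move=> y; exact: phi1.
exists (stein phi); split.
- exact: der_stein.
- move=> x; rewrite (le_trans (ler_normB _ _))//.
  by have := b1 x; have := phi1 x; lra.
exists ((p 1)^-1 + 1) => x; have [x1|x1] := leP 1 `|x|.
  have := b1 x; rewrite normrM => h.
  have : `|stein phi x| <= 1.
    by apply: le_trans h; rewrite -[leLHS]mul1r ler_wpM2r.
  by move=> /le_trans; apply; rewrite lerDr invr_ge0 gpdf_ge0.
have p1 : p 1 <= p x.
  rewrite !gpdfE ler_wpM2l ?normal_peak_ge0// ler_expR lerN2 expr1n.
  by move: x1; rewrite ltr_norml => /andP[h1 h2]; nra.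
have h : `|stein phi x| * p x <= 1.
  rewrite -[p x]ger0_norm ?gpdf_ge0// -normrM stein_gpdf -[leRHS](@Exp_gpdf R).
  apply: Exp_norm_le; last exact: (@intg_gpdf R).
    apply: measurable_funM; last exact: measurable_ray.
    exact: continuous_meas (continuous_gM phic).
  move=> y; rewrite !normrM (ger0_norm (gpdf_ge0 y)).
  have := phi1 y; have := gpdf_ge0 y; case: (x <= y) => P0 Q1.
    by rewrite normr1 mulr1 ler_piMl.
  by rewrite normr0 mulr0.
have : `|stein phi x| <= (p 1)^-1.
  rewrite -[leRHS]mul1r ler_pdivlMr ?gpdf_gt0//.
  by apply: le_trans h; rewrite ler_wpM2l.
by move=> /le_trans; apply; rewrite lerDl.
Qed.

End SteinOperator.

(** * Fourth moments of the Stein solution and of its derivative *)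

Section SteinL4.
Context (R : realType).
Local Notation leb := (@lebesgue_measure R).
Local Notation p := (@gpdf R).
Local Notation gauss := (gauss R).
Implicit Types (f v u phi psi dphi : R -> R) (a b x : R).

(** One of the two terms alone dominates, according to whether t |s| <= 1. With its free parameter
    the inequality replaces Hoelder's inequality and avoids fractional powers. *)
Lemma le_norm_expr4 (s t : R) : 0 < t -> `|s| <= t ^+ 3 * s ^+ 4 + t^-1.
Proof.
move=> t0; set y := `|s|; have y0 : 0 <= y := normr_ge0 s.
have -> : s ^+ 4 = y ^+ 4.
  by rewrite /y -normrX ger0_norm ?expr4_ge0.
have [ty|ty] := leP (t * y) 1.
  have : y <= t^-1 by rewrite -[leRHS]mul1r ler_pdivlMr// mulrC.
  move=> /le_trans; apply; rewrite lerDr mulr_ge0 ?expr4_ge0//.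
  by rewrite exprn_ge0// ltW.
have -> : t ^+ 3 * y ^+ 4 = (t * y) ^+ 3 * y by ring.
have : 1 <= (t * y) ^+ 3 by apply: exprn_ege1; exact: ltW.
have : 0 < t^-1 by rewrite invr_gt0.
by nra.
Qed.

Lemma cut_monotone f a b : a <= b -> (forall x, 0 <= f x) ->
  measurable_fun setT f -> intg leb (fun x => f x * (a <= x)%R%:R) ->
  Exp leb (fun x => f x * (b <= x)%R%:R) <= Exp leb (fun x => f x * (a <= x)%R%:R).
Proof.
move=> ab f0 mf fi; apply: le_Exp => [|//|x]; first exact: intg_cut_le fi.
case: (leP b x) => bx; first by rewrite (le_trans ab bx).
by rewrite mulr0 mulr_ge0 ?ler0n.
Qed.

Lemma intg_expr4_weaken f a : continuous f ->
  intg leb (fun x => f x ^+ 4 * p x * (a <= x)%R%:R) ->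
  intg leb (fun x => f x * p x * (a <= x)%R%:R).
Proof.
move=> fc fi.
have ip : intg leb (fun x => p x * (a <= x)%R%:R).
  by apply: intg_cut; [exact: continuous_meas (@continuous_gpdf R)|
    exact: (@intg_gpdf R)].
apply: (intg_le _ _ (intgD fi ip)) => [|x].
  apply: measurable_funM; last exact: measurable_ray.
  exact: continuous_meas (continuous_gM fc).
have := gpdf_ge0 x; have := @le_norm_expr4 (f x) 1 ltr01.
rewrite expr1n invr1 mul1r !normrM => h P0; rewrite (ger0_norm P0).
rewrite [`| _%:R|]ger0_norm ?ler0n//.
have w0 : 0 <= p x * (a <= x)%R%:R by rewrite mulr_ge0 ?ler0n.
by have := ler_wpM2r w0 h; rewrite mulrDl mul1r !(mulrA _ (p x)).
Qed.

(** [energy] with U = - v^4 p: Stein's equation gives U' = (4 v^3 psi - 3 x v^4) p, at most (psi^4 +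
    3 v^4 - 3 x v^4) p by Young's inequality, and 3 x - 3 >= x for x >= 2. As U is nonpositive here,
    its lower bound is not free: v^4 p has to be bounded beforehand, from the tail formula for v
    p. *)
Lemma stein_L4_ray v psi a : 2 <= a -> der v (fun x => x * v x - psi x) ->
  continuous psi ->
  intg leb (fun x => psi x ^+ 4 * p x * (a <= x)%R%:R) ->
  (forall x, a <= x -> v x * p x = Exp leb (fun y => psi y * p y * (x <= y)%R%:R)) ->
  intg leb (fun x => x * (v x ^+ 4 * p x) * (a <= x)%R%:R).
Proof.
move=> a2 vd psic ipsi vE; have vc := der_continuous vd.
pose M := Exp leb (fun x => psi x ^+ 4 * p x * (a <= x)%R%:R).
pose k : R := normal_peak 1; have k0 : 0 < k := @gpeak_gt0 R.
(* [q] is the fourth root of [p / k], so that a bound on [|v| * q] is a bound on v^4 p. *)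
pose q x : R := expR (- (x ^+ 2 / 8)).
have pq x : p x = k * q x ^+ 4.
  rewrite gpdfE /q -expRM_natl; congr (_ * expR _); lra.
have c4 f : continuous f -> continuous (fun x => f x ^+ 4 * p x).
  by move=> fc; apply: continuous_gM; exact: continuous_exp.
have g4 f y : 0 <= f y ^+ 4 * p y by rewrite mulr_ge0 ?gpdf_ge0 ?expr4_ge0.
have bound x : a <= x -> k * (`|v x| * q x) <= M + k.
  move=> ax; have q0 : 0 < q x := expR_gt0 _.
  have i1 : intg leb (fun y => psi y ^+ 4 * p y * (x <= y)%R%:R).
    by apply: intg_cut_le ipsi => //; exact: continuous_meas (c4 _ psic).
  have i2 : intg leb (fun y => p y * (x <= y)%R%:R).
    by apply: intg_cut; [exact: continuous_meas (@continuous_gpdf R)|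
      exact: (@intg_gpdf R)].
  (* [le_norm_expr4] with t = q x, the value for which both terms are of order q^3. The tail of [p]
     at [x] is at most [p x] by [mills], because [x >= 1]. *)
  have h1 : `|v x| * p x <= q x ^+ 3 * M + (q x)^-1 * p x.
    rewrite -[p x in leLHS]ger0_norm ?gpdf_ge0// -normrM vE//.
    apply: (@le_trans _ _ (Exp leb (fun y =>
      q x ^+ 3 * (psi y ^+ 4 * p y * (x <= y)%R%:R) +
      (q x)^-1 * (p y * (x <= y)%R%:R)))).
      apply: Exp_norm_le.
      - apply: measurable_funM; last exact: measurable_ray.
        exact: continuous_meas (continuous_gM psic).
      - move=> y; rewrite !normrM (ger0_norm (gpdf_ge0 y)).
        rewrite [`| _%:R|]ger0_norm ?ler0n//.
        have w0 : 0 <= p y * (x <= y)%R%:R by rewrite mulr_ge0 ?gpdf_ge0 ?ler0n.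
        have := ler_wpM2r w0 (le_norm_expr4 (psi y) q0).
        by rewrite mulrDl -(mulrA (q x ^+ 3)) -!(mulrA _ (p y)).
      - by apply: intgD; exact: intgZ.
    rewrite ExpD; [|exact: intgZ|exact: intgZ].
    rewrite !ExpZ//; apply: lerD.
      rewrite ler_wpM2l ?exprn_ge0 ?(ltW q0)//.
      by apply: cut_monotone => //; exact: continuous_meas (c4 _ psic).
    rewrite ler_wpM2l ?invr_ge0 ?(ltW q0)// -[leRHS]mills.
    apply: le_Exp => // [|y].
      apply: intg_cut; last exact: (@intg_id_gpdf R).
      exact: continuous_meas (@continuous_id_gpdf R).
    case: (leP x y) => xy; rewrite ?mulr0// !mulr1 ler_peMl ?gpdf_ge0//; lra.
  have h2 : q x ^+ 3 * (k * (`|v x| * q x)) <= q x ^+ 3 * (M + k).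
    move: h1; rewrite pq.
    have -> : (q x)^-1 * (k * q x ^+ 4) = q x ^+ 3 * k.
      by field; rewrite gt_eqF.
    rewrite -mulrDr; congr (_ <= _); ring.
  by move: h2; rewrite ler_pM2l// exprn_gt0.
pose C := k * ((M + k) / k) ^+ 4.
have [||||||||iB _] := @energy R (fun x => - (v x ^+ 4 * p x))
  (fun x => - (v x ^+ 4 * (- x * p x) +
               p x * (4%:R * v x ^+ 3 * (x * v x - psi x))))
  (fun x => psi x ^+ 4 * p x) (fun x => x * (v x ^+ 4 * p x)) a C _ _ (c4 _ psic).
- move=> x; apply: is_derive_opp; apply: is_derive_mul; last exact: der_gpdf.
  by apply: is_derive_exp; exact: vd.
- apply: (continuous_o opp_continuous); apply: continuous_add; apply: continuous_mul.
  + exact: continuous_exp.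
  + by apply: continuous_gM; exact: opp_continuous.
  + exact: continuous_gpdf.
  + apply: continuous_mul.
      apply: continuous_mul; first exact: continuous_const.
      exact: continuous_exp.
    apply: continuous_sub => //; apply: continuous_mul => //.
    exact: continuous_idfun.
- by apply: continuous_mul; [exact: continuous_idfun|exact: c4].
- by move=> x _; exact: g4.
- by move=> x ax; apply: mulr_ge0; [lra|exact: g4].
- move=> x ax; have := young_cube (v x) (psi x); have := expr4_ge0 (v x).
  have P0 := gpdf_ge0 x.
  set P := p x in P0 *; set V4 := v x ^+ 4; set Q4 := psi x ^+ 4.
  set Y := 4 * _ * _ => V0 HY.
  rewrite -subr_ge0.
  have -> : Q4 * P - x * (V4 * P) -
      - (V4 * (- x * P) + P * (4 * v x ^+ 3 * (x * v x - psi x))) =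
     P * ((Q4 + 3 * V4 - Y) + (2 * x - 3) * V4).
    rewrite /V4 /Y; ring.
  apply: mulr_ge0 => //; apply: addr_ge0; first by lra.
  by apply: mulr_ge0 => //; lra.
- move=> x ax; rewrite lerN2 pq mulrCA /C ler_wpM2l ?(ltW k0)//.
  have -> : v x ^+ 4 * q x ^+ 4 = (`|v x| * q x) ^+ 4.
    by rewrite exprMn -normrX ger0_norm ?expr4_ge0.
  apply: lerXn2r; rewrite ?nnegrE.
  + by rewrite mulr_ge0// expR_ge0.
  + rewrite divr_ge0 ?(ltW k0)// addr_ge0 ?(ltW k0)//; apply: Exp_ge0 => y.
    by rewrite mulr_ge0 ?ler0n.
  + by rewrite ler_pdivlMr// mulrC bound.
- exact: ipsi.
- exact: iB.
Qed.

End SteinL4.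

Section SteinSolution.
Context (R : realType).
Local Notation leb := (@lebesgue_measure R).
Local Notation p := (@gpdf R).
Local Notation gauss := (gauss R).
Implicit Types (f v u phi psi dphi : R -> R) (a b x : R).

Lemma expr4_sub (s t : R) : (s - t) ^+ 4 <= 8 * s ^+ 4 + 8 * t ^+ 4.
Proof.
rewrite -subr_ge0.
have -> : 8 * s ^+ 4 + 8 * t ^+ 4 - (s - t) ^+ 4 =
  (s + t) ^+ 2 * ((s + t) ^+ 2 + 6 * (s - t) ^+ 2).
  by ring.
apply: mulr_ge0; first exact: sqr_ge0.
by apply: addr_ge0; rewrite ?sqr_ge0// mulr_ge0 ?sqr_ge0.
Qed.

(** The derivative v = x u - phi of u solves Stein's equation again, with data phi' - u, so
    [stein_L4_ray] is applied twice. The factor x in its conclusion for u makes x u p, hence v p,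
    integrable; this is what allows v p to be written as a tail integral for the second
    application. *)
Lemma stein_derivative_L4_ray u phi dphi : der u (fun x => x * u x - phi x) ->
  der phi dphi -> continuous dphi ->
  intg leb (fun x => phi x ^+ 4 * p x * (2 <= x)%R%:R) ->
  intg leb (fun x => dphi x ^+ 4 * p x * (2 <= x)%R%:R) ->
  (forall x, u x * p x = Exp leb (fun y => phi y * p y * (x <= y)%R%:R)) ->
  intg leb (fun x => u x ^+ 4 * p x * (2 <= x)%R%:R) /\
  intg leb (fun x => (x * u x - phi x) ^+ 4 * p x * (2 <= x)%R%:R).
Proof.
move=> ud phid dc iphi idphi uE.
have uc := der_continuous ud; have phic := der_continuous phid.
have c4 f : continuous f -> continuous (fun x => f x ^+ 4 * p x).
  by move=> fc; apply: continuous_gM; exact: continuous_exp.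
have m4 f : continuous f -> measurable_fun setT (fun x => f x ^+ 4 * p x * (2 <= x)%R%:R).
  move=> fc; apply: measurable_funM; last exact: measurable_ray.
  exact: continuous_meas (c4 _ fc).
have g4 f y : 0 <= f y ^+ 4 * p y * (2 <= y)%R%:R.
  by apply: mulr_ge0; rewrite ?ler0n// mulr_ge0 ?gpdf_ge0 ?expr4_ge0.
have weaken v : intg leb (fun x => x * (v x ^+ 4 * p x) * (2 <= x)%R%:R) ->
    continuous v -> intg leb (fun x => v x ^+ 4 * p x * (2 <= x)%R%:R).
  move=> iv vc; apply: (intg_le _ _ iv) => [|x]; first exact: m4.
  rewrite ger0_norm//; case: (leP 2 x) => x2; rewrite ?mulr0// !mulr1.
  apply: ler_peMl; last by lra.
  by rewrite mulr_ge0 ?gpdf_ge0 ?expr4_ge0.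
have ixu := stein_L4_ray (lexx 2) ud phic iphi (fun x _ => uE x).
have iu := weaken _ ixu uc.
split=> //.
pose v x := x * u x - phi x; pose psi x := dphi x - u x.
have vd : der v (fun x => x * v x - psi x).
  move=> x; have D := is_derive_sub (is_derive_mul (is_derive_idfun x) (ud x)) (phid x).
  by apply: is_derive_eq D _; rewrite /v /psi; ring.
have vc := der_continuous vd.
have psic : continuous psi by exact: continuous_sub.
have ipsi : intg leb (fun x => psi x ^+ 4 * p x * (2 <= x)%R%:R).
  apply: (intg_le _ _ (intgD (intgZ 8 idphi) (intgZ 8 iu))) => [|x].
    exact: m4.
  rewrite ger0_norm//.
  have w0 : 0 <= p x * (2 <= x)%R%:R by rewrite mulr_ge0 ?gpdf_ge0 ?ler0n.
  have := ler_wpM2r w0 (expr4_sub (dphi x) (u x)).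
  by rewrite -/(psi x) mulrDl -!(mulrA 8) -!(mulrA _ (p x)).
apply: (weaken v) => //; apply: (stein_L4_ray (lexx 2) vd psic ipsi) => x x2.
have cut2 f : continuous f -> intg leb (fun x => f x * p x * (2 <= x)%R%:R) ->
    intg leb (fun y => f y * p y * (x <= y)%R%:R).
  by move=> fc; apply: intg_cut_le => //; exact: continuous_meas (continuous_gM fc).
have iv : intg leb (fun y => v y * p y * (2 <= y)%R%:R).
  have ixp := intg_cut 2 (continuous_meas (@continuous_id_gpdf R)) (@intg_id_gpdf R).
  have i1 := intg_expr4_weaken phic iphi.
  apply: (intg_le _ _ (intgD (intgD ixu ixp) (intg_norm i1))) => [|y].
    apply: measurable_funM; last exact: measurable_ray.
    exact: continuous_meas (continuous_gM vc).
  case: (leP 2 y) => y2; last by rewrite !mulr0 normr0 !addr0.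
  rewrite !mulr1 /v mulrBl (le_trans (ler_normB _ _))// lerD2r.
  rewrite -mulrA -mulrDr !normrM (ger0_norm (gpdf_ge0 y)) [`|y|]ger0_norm; last lra.
  rewrite ler_wpM2l//; first by lra.
  rewrite -[X in _ + X]mul1r -mulrDl ler_wpM2r ?gpdf_ge0//.
  by have := @le_norm_expr4 R (u y) 1 ltr01; rewrite expr1n invr1 mul1r.
have Ud : der (fun y => - (v y * p y)) (fun y => psi y * p y).
  move=> y; apply: is_derive_eq (is_derive_opp (is_derive_mul (vd y) (der_gpdf y))) _.
  ring.
rewrite (ray_ibp Ud) ?opprK//.
- exact: continuous_gM.
- by under eq_fun do rewrite mulNr; apply: intgN; exact: cut2.
- by apply: cut2 => //; exact: intg_expr4_weaken.
Qed.

Lemma intg_expr4 d (T : measurableType d) (P : probability T R)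
    (X : T -> R) : measurable_fun setT X ->
  intg P (fun w => X w ^+ 4) -> intg P X.
Proof.
move=> mX iX; apply: (intg_le _ _ (intgD iX (intg_cst P 1))) => // w.
by have := @le_norm_expr4 R (X w) 1 ltr01; rewrite expr1n invr1 mul1r.
Qed.

(** The right tails are given by [stein_derivative_L4_ray], the left ones by the same result for x
    |-> - u(- x), and continuity fills the middle. *)
Lemma stein_L4 phi dphi : der phi dphi -> continuous dphi ->
  intg gauss (fun x => dphi x ^+ 4) -> Exp gauss phi = 0 ->
  exists u, [/\ der u (fun x => x * u x - phi x),
    intg gauss (fun x => u x ^+ 4) &
    intg gauss (fun x => (x * u x - phi x) ^+ 4)].
Proof.
move=> phid dc idphi phi0; have phic := der_continuous phid.
have iphi4 := L4_primitive phid dc idphi.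
have mphi := continuous_meas phic.
have phii : intg gauss phi by exact: intg_expr4 iphi4.
have ud := der_stein phic phii.
have uc := der_continuous ud.
have c4 f : continuous f -> continuous (fun x => f x ^+ 4 * p x).
  by move=> fc; apply: continuous_gM; exact: continuous_exp.
have vc : continuous (fun x => x * stein phi x - phi x).
  by apply: continuous_sub => //; apply: continuous_mul => //; exact: continuous_idfun.
have g4 f : continuous f -> intg gauss (fun x => f x ^+ 4) <->
    intg leb (fun x => f x ^+ 4 * p x).
  by move=> fc; apply: intg_gauss; apply: continuous_meas; exact: continuous_exp.
move: idphi iphi4; rewrite !g4// => idphi iphi4.
have refl f : continuous f -> intg leb (fun x => f x ^+ 4 * p x) ->
    intg leb (fun x => f (- x) ^+ 4 * p x * (2 <= x)%R%:R).
  move=> fc fi; under eq_fun do rewrite -gpdfN; apply: intg_cut.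
    exact: continuous_meas (continuous_reflect (c4 _ fc)).
  exact: intg_leb_opp (continuous_meas (c4 _ fc)) fi.
have cut2 f : continuous f -> intg leb (fun x => f x ^+ 4 * p x) ->
    intg leb (fun x => f x ^+ 4 * p x * (2 <= x)%R%:R).
  by move=> fc; apply: intg_cut; exact: continuous_meas (c4 _ fc).
have [i1 i2] := stein_derivative_L4_ray ud phid dc (cut2 _ phic iphi4)
  (cut2 _ dc idphi) (stein_gpdf phi).
pose u' x := - stein phi (- x).
have ud' : der u' (fun x => x * u' x - phi (- x)).
  move=> x; apply: is_derive_eq (is_derive_opp (der_reflect ud x)) _.
  by rewrite /u'; ring.
have id' : intg leb (fun x => (- dphi (- x)) ^+ 4 * p x * (2 <= x)%R%:R).
  by under eq_fun do rewrite expr4N; exact: refl.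
have [|j1 j2] := stein_derivative_L4_ray ud' (der_reflect phid) _ (refl _ phic iphi4)
  id' (stein_reflect phic phii phi0).
  by apply: (continuous_o opp_continuous); exact: continuous_reflect.
exists (stein phi); split; first exact: ud.
  apply/g4 => //; apply: (@intg_patch _ _ 2) => //; first exact: c4.
  by move: j1; under eq_fun do rewrite /u' expr4N -gpdfN.
apply/g4 => //; apply: (@intg_patch _ _ 2) => //; first exact: c4.
move: j2; congr intg; apply/funext => x; rewrite gpdfN /u'.
by congr (_ ^+ 4 * _ * _); ring.
Qed.

(** The derivative of u psi p is (u psi' - phi psi) p: the two terms in x u psi p cancel by Stein's
    equation. Boundedness of [psi] ensures that u psi and phi psi are integrable. *)
Lemma gauss_ibp phi u psi dpsi C : continuous phi ->
  der u (fun x => x * u x - phi x) -> intg gauss phi -> intg gauss u ->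
  der psi dpsi -> continuous dpsi -> (forall x, `|psi x| <= C) ->
  intg gauss (fun x => u x * dpsi x) ->
  Exp gauss (fun x => phi x * psi x) = Exp gauss (fun x => u x * dpsi x).
Proof.
move=> phic ud iphi iu psid dc psiC iud.
have uc := der_continuous ud; have psic := der_continuous psid.
have C0 : 0 <= C by apply: le_trans (psiC 0).
have bdd f : continuous f -> intg gauss f -> intg gauss (fun x => f x * psi x).
  move=> fc fi; apply: (intg_le _ _ (intgZ C (intg_norm fi))) => [|x].
    by apply: continuous_meas; exact: continuous_mul.
  by rewrite normrM mulrC ler_wpM2r.
have m2 f g : continuous f -> continuous g -> measurable_fun setT (fun x => f x * g x).
  by move=> fc gc; apply: continuous_meas; exact: continuous_mul.
have i1 := bdd _ phic iphi; have i2 := bdd _ uc iu.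
rewrite !Exp_gauss; try exact: m2.
rewrite !intg_gauss in i1 i2 iud; try exact: m2.
have Ud : der (fun x => u x * psi x * p x)
    (fun x => u x * dpsi x * p x - phi x * psi x * p x).
  move=> x; have D := is_derive_mul (is_derive_mul (ud x) (psid x)) (der_gpdf x).
  by apply: is_derive_eq D _; ring.
have E := line_ibp Ud _ i2 (intgB iud i1).
apply/eqP; rewrite eq_sym -subr_eq0 -ExpB//; apply/eqP; apply: E.
by apply: continuous_sub; apply: continuous_gM; exact: continuous_mul.
Qed.

End SteinSolution.

(** * Uniqueness of Gaussian laws *)

Section Threshold.
Context (R : realType).
Implicit Types (x y p : R).

Let cst_cvg (k : R) : k @[n --> \oo] --> k.
Proof. exact: cvg_cst. Qed.

Lemma bernoulli_ge x n : 0 <= x -> 1 + n%:R * x <= (1 + x) ^+ n.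
Proof.
move=> x0; elim: n => [|n IH]; first by rewrite mul0r addr0 expr0.
rewrite exprS -natr1.
have : (1 + x) * (1 + n%:R * x) <= (1 + x) * (1 + x) ^+ n.
  by apply: ler_wpM2l => //; lra.
apply: le_trans; have : 0 <= n%:R * x * x by rewrite !mulr_ge0.
lra.
Qed.

Lemma bernoulli_sub x n : 0 <= x <= 1 -> 1 - n%:R * x <= (1 - x) ^+ n.
Proof.
move=> /andP[x0 x1]; elim: n => [|n IH]; first by rewrite mul0r subr0 expr0.
rewrite exprS -natr1.
have : (1 - x) * (1 - n%:R * x) <= (1 - x) * (1 - x) ^+ n.
  by apply: ler_wpM2l => //; lra.
apply: le_trans; have : 0 <= n%:R * x * x by rewrite !mulr_ge0.
lra.
Qed.

(** With y = sqrt x, one factor y^n of x^n absorbs n by Bernoulli's inequality and the other tends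
    to 0. *)
Lemma cvg_natr_exp x : 0 <= x < 1 -> n%:R * x ^+ n @[n --> \oo] --> 0.
Proof.
move=> /andP[x0 x1].
have [->|xn0] := eqVneq x 0.
  apply: cvg_near_cst; near=> n; rewrite expr0n.
  have -> : n == 0%N = false by apply/negbTE; rewrite -lt0n; near: n; exact: nbhs_infty_gt.
  by rewrite mulr0.
have {}x0 : 0 < x by rewrite lt_neqAle eq_sym xn0.
pose y := Num.sqrt x; have y0 : 0 < y by rewrite sqrtr_gt0.
have yx : y ^+ 2 = x by rewrite sqr_sqrtr// ltW.
have y1 : y < 1 by rewrite /y -sqrtr1 ltr_sqrt// ltr01.
pose c := y^-1 - 1; have c0 : 0 < c by rewrite subr_gt0 invf_gt1.
have ny n : n%:R * y ^+ n <= c^-1.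
  rewrite -[leRHS]mul1r ler_pdivlMr//.
  have := bernoulli_ge n (ltW c0).
  have -> : 1 + c = y^-1 by rewrite /c addrC subrK.
  rewrite exprVn => h.
  have yn0 : 0 < y ^+ n by rewrite exprn_gt0.
  have : n%:R * c * y ^+ n <= 1.
    rewrite -ler_pdivlMr// mul1r; apply: le_trans h.
    by rewrite lerDr.
  by rewrite -!mulrA [c * _]mulrC.
have yn : c^-1 * y ^+ n @[n --> \oo] --> 0.
  rewrite -[X in _ --> X](mulr0 c^-1); apply: cvgM; first exact: cvg_cst.
  by apply: cvg_expr; rewrite gtr0_norm.
have H : \forall n \near \oo, 0 <= n%:R * x ^+ n <= c^-1 * y ^+ n; last first.
  by apply: (squeeze_cvgr H); [exact: cst_cvg|exact: yn].
apply: nearW => n; rewrite mulr_ge0 ?exprn_ge0 ?(ltW x0)//=.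
by rewrite -yx -exprM mul2n -addnn exprD mulrA ler_wpM2r// exprn_ge0// ltW.
Unshelve. all: by end_near. Qed.

(* [(1 - p ^+ n) ^+ N] is at least [1 - N p ^+ n] and at most [1 / (N p ^+ n)];
   with [N = n 2 ^ n] this separates [p < 1 / 2] from [p >= 1 / 2]. *)
Definition smooth_threshold n p := 1 - (1 - p ^+ n) ^+ (n * 2 ^ n).

Lemma smooth_threshold_cvg p : 0 <= p <= 1 ->
  smooth_threshold n p @[n --> \oo] --> ((2^-1 <= p)%R%:R : R).
Proof.
move=> /andP[p0 p1]; rewrite -[X in _ --> X](subKr 1) /smooth_threshold.
apply: cvgB; first exact: cvg_cst.
have pn n : 0 <= p ^+ n <= 1 by rewrite exprn_ge0//= exprn_ile1.
have [hp|hp] := leP 2^-1 p; last first.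
  rewrite subr0; have c : 1 - n%:R * (2 * p) ^+ n @[n --> \oo] --> (1 : R).
    rewrite -[X in _ --> X]subr0; apply: cvgB; first exact: cvg_cst.
    by apply: cvg_natr_exp; lra.
  have H : \forall n \near \oo, 1 - n%:R * (2 * p) ^+ n <=
      (1 - p ^+ n) ^+ (n * 2 ^ n) <= 1; last first.
    by apply: (squeeze_cvgr H); [exact: c|exact: cst_cvg].
  apply: nearW => n; apply/andP; split; last first.
    by apply: exprn_ile1; have := pn n; lra.
  have := bernoulli_sub (n * 2 ^ n) (pn n).
  by rewrite natrM natrX exprMn mulrA.
rewrite subrr.
have c : (n.+1%:R : R)^-1 @[n --> \oo] --> 0 by exact: cvg_harmonic.
have c' : (n%:R : R)^-1 @[n --> \oo] --> 0 by rewrite -cvg_shiftS.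
have H : \forall n \near \oo, 0 <= (1 - p ^+ n) ^+ (n * 2 ^ n) <= n%:R^-1;
  last by apply: (squeeze_cvgr H); [exact: cst_cvg|exact: c'].
near=> n; apply/andP; split; first by rewrite exprn_ge0//; have := pn n; lra.
have n0 : (0 < n)%N by near: n; exact: nbhs_infty_gt.
set N := (n * 2 ^ n)%N; set x := p ^+ n.
have /andP[x0 x1] := pn n.
have h1 : (1 - x) ^+ N * (1 + x) ^+ N <= 1.
  by rewrite -exprMn exprn_ile1//; rewrite -/x in x0 x1; nra.
have h2 : n%:R <= (1 + x) ^+ N.
  apply: le_trans (bernoulli_ge N x0); rewrite /N natrM natrX -mulrA -exprMn.
  have : 1 <= (2 * p) ^+ n by apply: exprn_ege1; lra.
  have : 0 < n%:R :> R by rewrite ltr0n.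
  by nra.
rewrite -[leRHS]mul1r ler_pdivlMr ?ltr0n//; apply: le_trans h1.
by rewrite ler_wpM2l// exprn_ge0//; rewrite -/x in x1; lra.
Unshelve. all: by end_near. Qed.

(** As soon as |t| < (n + 1) pi, the sine of t / (n + 1) has the sign of t. Periodic functions of
    growing period thus detect a half-line. *)
Lemma sin_threshold (t : R) :
  (2^-1 <= (1 + sin (n.+1%:R^-1 * t)) / 2)%R%:R @[n --> \oo] --> ((0 <= t)%R%:R : R).
Proof.
apply: cvg_near_cst; near=> n.
have E : (2^-1 <= (1 + sin (n.+1%:R^-1 * t)) / 2) = (0 <= sin (n.+1%:R^-1 * t)).
  by apply/idP/idP; lra.
rewrite E; have pi0 := pi_gt0 R.
have n0 : 0 < n.+1%:R^-1 :> R by rewrite invr_gt0.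
have tpi : n.+1%:R^-1 * `|t| < pi.
  rewrite mulrC ltr_pdivrMr// mulrC -ltr_pdivrMr//.
  apply: lt_trans (_ : n%:R < _); last by rewrite ltr_nat.
  by near: n; exact: nbhs_infty_gtr.
congr (nat_of_bool _)%:R; case: (ltgtP 0 t) => [t0|t0|<-]; last by rewrite mulr0 sin0 lexx.
- rewrite ltW// sin_gt0_pi// mulr_gt0//=.
  by move: tpi; rewrite gtr0_norm.
- apply/negbTE; rewrite -ltNge -oppr_gt0 -sinN -mulrN; apply: sin_gt0_pi.
  by move: tpi; rewrite ltr0_norm// => ->; rewrite mulr_gt0// oppr_gt0.
Unshelve. all: by end_near. Qed.

End Threshold.

(** * Function classes closed under products, complements and pointwise limits *)

Section FunctionClass.
Context (S : Type) (R : realType) (K : (S -> R) -> Prop).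
Hypotheses (K1 : K (fun=> 1)) (KM : forall q r, K q -> K r -> K (fun s => q s * r s))
  (KC : forall q, K q -> K (fun s => 1 - q s))
  (Kcvg : forall (q : nat -> S -> R) r, (forall k, K (q k)) ->
    (forall s, q k s @[k --> \oo] --> r s) -> K r).

Definition kset (E : set S) : Prop := K (fun s => (s \in E)%:R).

Lemma kset_setT : kset setT.
Proof.
rewrite /kset; have := K1; congr K; apply/funext => s.
by rewrite in_setT.
Qed.

Lemma ksetC E : kset E -> kset (~` E).
Proof.
rewrite /kset => /KC; congr K; apply/funext => s.
by rewrite in_setC; case: (s \in E); rewrite ?subrr ?subr0.
Qed.

Lemma kset_bigcap (F : nat -> set S) : (forall k, kset (F k)) ->
  kset (\bigcap_k F k).
Proof.
move=> mF; apply: (@Kcvg (fun k s => \prod_(i < k) (s \in F i)%:R)).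
  elim=> [|k IH]; first by under eq_fun do rewrite big_ord0; exact: K1.
  under eq_fun do rewrite big_ord_recr /=; exact: (KM IH (mF k)).
move=> s; apply: cvg_near_cst; have [sF|sF] := pselect ((\bigcap_k F k) s).
  apply: nearW => k; rewrite mem_set// big1// => i _.
  by rewrite mem_set//; exact: sF.
have [j sj] : exists j, ~ F j s.
  by apply: contrapT => H; apply: sF => j _; apply: contrapT => h; apply: H; exists j.
near=> k; rewrite memNset//; apply/eqP.
have jk : (j < k)%N by near: k; exact: nbhs_infty_gt.
by rewrite (bigD1 (Ordinal jk))//= memNset// mul0r.
Unshelve. all: by end_near. Qed.

Lemma kset_bigcup (F : nat -> set S) : (forall k, kset (F k)) ->
  kset (\bigcup_k F k).
Proof.
move=> mF; rewrite -(setCK (\bigcup_k F k)) setC_bigcup.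
by apply/ksetC/kset_bigcap => k; exact/ksetC.
Qed.

(** By the closure properties the sets with indicator in [K] form a sigma-algebra, and rays generate
    the Borel sets. This is used both for the uniqueness of laws and for the approximation of Borel
    indicators by continuous functions. *)
Lemma kset_borel (f : S -> R) (A : set R) :
  (forall c : R, K (fun s => (c <= f s)%R%:R)) -> measurable A -> kset (f @^-1` A).
Proof.
move=> Kf.
rewrite -[measurable A]/((@ocitv R).-sigma.-measurable A) RGenCInfty.measurableE.
move: A; apply: smallest_sub; last first.
  move=> _ [x ->] /=; have := Kf x; congr K.
  apply/funext => s; congr (nat_of_bool _)%:R.
  by apply/idP/idP; rewrite inE/= in_itv/= andbT.
split=> [|A mA|F mF] /=.
- by rewrite preimage_set0 -setCT; exact/ksetC/kset_setT.
- by rewrite setTD preimage_setC; exact: ksetC.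
- by rewrite preimage_bigcup; exact: kset_bigcup.
Qed.

End FunctionClass.

(** * Laws are determined by expectations of cosines of linear forms *)

Section TrigUniqueness.
Context d (S : measurableType d) (R : realType) (P Q : probability S R)
  (n : nat) (z : 'I_n -> S -> R).
Hypothesis mz : forall i, measurable_fun setT (z i).

(** The phase [b] makes sines a special case, so these functions play the part of complex
    characters; products of two of them are combinations of others. *)
Definition trig (a : 'I_n -> R) (b : R) (s : S) : R :=
  cos (\sum_(i < n) a i * z i s + b).

Hypothesis trig_eq : forall a b, Exp P (trig a b) = Exp Q (trig a b).

Lemma measurable_lin (a : 'I_n -> R) :
  measurable_fun setT (fun s => \sum_(i < n) a i * z i s).
Proof.
by apply: measurable_sum => i; apply: measurable_funM => //; exact: measurable_cst.
Qed.

Lemma measurable_trig a b : measurable_fun setT (trig a b).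
Proof.
apply: measurableT_comp; first exact: (continuous_meas (@continuous_cos R)).
by apply: measurable_funD; [exact: measurable_lin|exact: measurable_cst].
Qed.

Lemma trig_le1 a b s : `|trig a b s| <= 1.
Proof. exact: cos_max. Qed.

Lemma intg_bounded1 (m : probability S R) (h : S -> R) :
  measurable_fun setT h -> (forall s, `|h s| <= 1) -> intg m h.
Proof. by move=> mh h1; apply: (intg_le _ _ (intg_cst m 1)). Qed.

(** The signed measures h P and h Q have the same characteristic function. Testing against every
    [trig], and not only against 1, is what makes the property stable under multiplication by a
    sine. *)
Definition agree (h : S -> R) : Prop := [/\ measurable_fun setT h,
  forall s, `|h s| <= 1 &
  forall a b, Exp P (fun s => h s * trig a b s) = Exp Q (fun s => h s * trig a b s)].

(* Closed under products, complements and pointwise limits; the addition formulas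
   give the multipliers [(1 + sin) / 2], hence their thresholds and the rays. *)
Definition multiplier (q : S -> R) : Prop := [/\ measurable_fun setT q,
  forall s, 0 <= q s <= 1 & forall h, agree h -> agree (fun s => h s * q s)].

Lemma agree1 : agree (fun=> 1).
Proof.
split=> [|s|a b]; [exact: measurable_cst|by rewrite normr1|].
have E : (fun s => 1 * trig a b s) = trig a b by apply/funext => s; rewrite mul1r.
by rewrite E trig_eq.
Qed.

Lemma agree_intg (m : probability S R) h a b : agree h ->
  intg m (fun s => h s * trig a b s).
Proof.
move=> [mh h1 _]; apply: intg_bounded1 => [|s].
  by apply: measurable_funM => //; exact: measurable_trig.
by rewrite normrM mulr_ile1// trig_le1.
Qed.

Lemma mul_bounded1 (h q : S -> R) : (forall s, `|h s| <= 1) ->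
  (forall s, 0 <= q s <= 1) -> forall s, `|h s * q s| <= 1.
Proof.
move=> h1 q1 s; rewrite normrM mulr_ile1//.
by rewrite ger0_norm; case/andP: (q1 s).
Qed.

Lemma multiplier1 : multiplier (fun=> 1).
Proof.
split=> [|s|h ah]; [exact: measurable_cst|by rewrite ler01 lexx|].
by under eq_fun do rewrite mulr1.
Qed.

Lemma multiplierM q r : multiplier q -> multiplier r ->
  multiplier (fun s => q s * r s).
Proof.
move=> [mq q1 aq] [mr r1 ar]; split=> [|s|h ah]; first exact: measurable_funM.
  have /andP[q0 q2] := q1 s; have /andP[r0 r2] := r1 s.
  by rewrite mulr_ge0//= mulr_ile1.
by under eq_fun do rewrite mulrA; exact/ar/aq.
Qed.

Lemma multiplierX q k : multiplier q -> multiplier (fun s => q s ^+ k).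
Proof.
move=> mq; elim: k => [|k IH]; first exact: multiplier1.
by under eq_fun do rewrite exprS; exact: multiplierM.
Qed.

Lemma multiplierC q : multiplier q -> multiplier (fun s => 1 - q s).
Proof.
move=> [mq q1 aq].
have q2 s : 0 <= 1 - q s <= 1 by have := q1 s; lra.
have m1 : measurable_fun setT (fun s => 1 - q s).
  by apply: measurable_funB => //; exact: measurable_cst.
split=> // h ah; have := aq _ ah; case: (ah) => mh h1 ht aqh.
split=> [||a b]; [exact: measurable_funM|exact: mul_bounded1|].
have E s : h s * (1 - q s) * trig a b s = h s * trig a b s - h s * q s * trig a b s.
  by ring.
rewrite (funext E).
rewrite !ExpB; try exact: agree_intg.
by rewrite ht; congr (_ - _); case: aqh.
Qed.

Lemma multiplier_cvg (q : nat -> S -> R) r : (forall k, multiplier (q k)) ->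
  (forall s, q k s @[k --> \oo] --> r s) -> multiplier r.
Proof.
move=> mq qr.
have mr : measurable_fun setT r.
  by apply: (@measurable_fun_cvg _ _ _ _ q) => // k; case: (mq k).
have r1 s : 0 <= r s <= 1.
  have cvq : cvgn (q ^~ s) by apply/cvg_ex; exists (r s); exact: qr.
  have -> : r s = limn (q ^~ s) by apply/esym/cvg_lim => //; exact: qr.
  by apply/andP; split; [apply: limr_ge|apply: limr_le] => //; apply: nearW => k;
    case: (mq k) => _ /(_ s) /andP[].
split=> // h ah; case: (ah) => mh h1 ht; split; [exact: measurable_funM|exact: mul_bounded1|].
move=> a b.
have H (m : probability S R) : Exp m (fun s => h s * q k s * trig a b s) @[k --> \oo] -->
    Exp m (fun s => h s * r s * trig a b s).
  have [||||_ //] := @Exp_dct _ _ _ m (fun k s => h s * q k s * trig a b s)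
    (fun s => h s * r s * trig a b s) (fun=> 1).
  - move=> k; apply: measurable_funM; last exact: measurable_trig.
    by apply: measurable_funM => //; case: (mq k).
  - move=> s; apply: cvgM; last exact: cvg_cst.
    by apply: cvgM; [exact: cvg_cst|exact: qr].
  - move=> k s; rewrite normrM mulr_ile1// ?trig_le1// mul_bounded1//.
    by move=> s'; case: (mq k).
  - exact: intg_cst.
apply: cvg_unique (H P) _; first exact: Rhausdorff.
rewrite (_ : (fun k => _) = fun k => Exp Q (fun s => h s * q k s * trig a b s)).
  exact: H.
by apply/funext => k; case: (mq k) => _ _ /(_ _ ah)[].
Qed.

Lemma multiplier_sin a c : multiplier (fun s => (1 + sin (\sum_(i < n) a i * z i s + c)) / 2).
Proof.
have sinE s : sin (\sum_(i < n) a i * z i s + c) = trig a (c - pi / 2) s.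
  by rewrite /trig addrA cosBpihalf.
have mq : measurable_fun setT (fun s => (1 + sin (\sum_(i < n) a i * z i s + c)) / 2).
  apply: measurable_funM; last exact: measurable_cst.
  apply: measurable_funD; first exact: measurable_cst.
  under eq_fun do rewrite sinE; exact: measurable_trig.
have q1 s : 0 <= (1 + sin (\sum_(i < n) a i * z i s + c)) / 2 <= 1.
  by have := trig_le1 a (c - pi / 2) s; rewrite -sinE ler_norml; lra.
split=> // h ah; case: (ah) => mh h1 ht.
split=> [||a' b]; [exact: measurable_funM|exact: mul_bounded1|].
pose ap i := a i + a' i; pose am i := a i - a' i.
have E s : h s * ((1 + sin (\sum_(i < n) a i * z i s + c)) / 2) * trig a' b s =
    2^-1 * (h s * trig a' b s) + (4^-1 * (h s * trig ap (c - pi / 2 + b) s) +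
      4^-1 * (h s * trig am (c - pi / 2 - b) s)).
  rewrite sinE.
  have -> : trig ap (c - pi / 2 + b) s =
      cos ((\sum_(i < n) a i * z i s + (c - pi / 2)) +
           (\sum_(i < n) a' i * z i s + b)).
    rewrite /trig addrACA -big_split/=; congr (cos (_ + _)).
    by apply: eq_bigr => i _; rewrite mulrDl.
  have -> : trig am (c - pi / 2 - b) s =
      cos ((\sum_(i < n) a i * z i s + (c - pi / 2)) -
           (\sum_(i < n) a' i * z i s + b)).
    rewrite /trig opprD addrACA -sumrB; congr (cos (_ + _)).
    by apply: eq_bigr => i _; rewrite mulrBl.
  by rewrite cosD cosB /trig; field.
rewrite (funext E).
rewrite !ExpD; try (by apply: intgZ; exact: agree_intg);
  try (by apply: intgD; apply: intgZ; exact: agree_intg).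
by rewrite !ExpZ ?ht//; exact: agree_intg.
Qed.

Lemma multiplier_threshold q : multiplier q ->
  multiplier (fun s => (2^-1 <= q s)%R%:R).
Proof.
move=> mq.
apply: (@multiplier_cvg (fun k s => smooth_threshold k (q s))) => [k|s].
  by rewrite /smooth_threshold; apply/multiplierC/multiplierX/multiplierC/multiplierX.
by apply: smooth_threshold_cvg; case: mq.
Qed.

Lemma multiplier_ray i (c : R) : multiplier (fun s => (c <= z i s)%R%:R).
Proof.
under eq_fun do rewrite -subr_ge0.
apply: (@multiplier_cvg (fun k s =>
  (2^-1 <= (1 + sin (k.+1%:R^-1 * (z i s - c))) / 2)%R%:R)) => [k|s].
  apply: multiplier_threshold.
  have := multiplier_sin (fun j => (j == i)%:R * k.+1%:R^-1) (- (k.+1%:R^-1 * c)).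
  congr multiplier; apply/funext => s; congr ((1 + sin _) / 2).
  rewrite mulrBr; congr (_ - _); rewrite (bigD1 i)//= eqxx mul1r big1 ?addr0//.
  by move=> j /negbTE ->; rewrite !mul0r.
exact: sin_threshold.
Qed.

Lemma mset_borel i (A : set R) : measurable A -> kset multiplier (z i @^-1` A).
Proof.
move=> mA; apply: kset_borel => //; first exact: multiplier1.
- exact: multiplierM.
- exact: multiplierC.
- exact: multiplier_cvg.
- exact: multiplier_ray.
Qed.

Lemma mset_eq E : measurable E -> kset multiplier E -> P E = Q E.
Proof.
move=> mE [_ _ /(_ _ agree1) [_ _ /(_ (fun=> 0) 0)]].
have E1 (m : probability S R) :
    Exp m (fun s => 1 * (s \in E)%:R * trig (fun=> 0) 0 s) = fine (m E).
  rewrite /Exp /Rintegral; congr fine.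
  rewrite -[in RHS](setIT E) -integral_indic//; apply: eq_integral => s _.
  rewrite mul1r /trig big1 ?addr0 ?cos0 ?mulr1 ?indicE//.
  by move=> i _; rewrite mul0r.
rewrite !E1 => h.
by rewrite -[LHS]fineK ?fin_num_measure// h fineK// fin_num_measure.
Qed.

End TrigUniqueness.

(** * Characteristic function of a centered normal law *)

Section NormalCharacteristic.
Context (R : realType).
Local Notation leb := (@lebesgue_measure R).

Section Density.
Variables (m s : R).
Hypothesis s0 : s != 0.
Local Notation p := (normal_pdf m s).

Lemma normal_pdf_formula x :
  p x = normal_peak s * expR (- ((x - m) ^+ 2 * (2 * s ^+ 2)^-1)).
Proof.
by rewrite normal_pdfE// /normal_fun mulNr -[s ^+ 2 *+ 2]mulr_natl.
Qed.

Lemma der_normal_pdf : der p (fun x => - ((x - m) / s ^+ 2) * p x).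
Proof.
move=> x; have -> : p = fun x =>
    normal_peak s * expR (- ((x - m) ^+ 2 * (2 * s ^+ 2)^-1)).
  by apply/funext => y; exact: normal_pdf_formula.
have D := is_derive_scale (normal_peak s) (der_expR_comp (is_derive_opp
  (is_derive_mul (is_derive_exp 2 (is_derive_sub (is_derive_idfun x)
    (is_derive_const x m))) (is_derive_const x (2 * s ^+ 2)^-1)))).
by apply: is_derive_eq D _; rewrite /= expr1; field.
Qed.

Lemma continuous_npdf : continuous p.
Proof. exact: der_continuous der_normal_pdf. Qed.

End Density.

Definition normal (m s : R) : probability _ R := normal_prob m s.

(** Differentiation under the integral, dominated by |x|, followed by integration by parts shows
    that G(k) = E cos (k x + b) satisfies G' = - s^2 k G. Hence G(k) exp (s^2 k^2 / 2) is constant,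
    with value cos b at k = 0. *)
Lemma normal_cos s (a b : R) : s != 0 -> intg (normal 0 s) (fun x => x) ->
  Exp (normal 0 s) (fun x => cos (a * x + b)) =
  expR (- (s ^+ 2 * a ^+ 2 / 2)) * cos b.
Proof.
move=> s0 ix.
have mE (f : R -> R) : continuous f -> measurable_fun setT f by exact: continuous_meas.
pose nu := normal 0 s; pose p := normal_pdf 0 s.
have pc : continuous p := continuous_npdf s0.
have arg_c k l : continuous (fun x : R => k * x + l).
  apply: continuous_add; last exact: continuous_const.
  by apply: continuous_mul; [exact: continuous_const|exact: continuous_idfun].
have cos_c k : continuous (fun x : R => cos (k * x + b)).
  by apply: continuous_o; [exact: continuous_cos|exact: arg_c].
have sin_c k : continuous (fun x : R => sin (k * x + b)).
  by apply: continuous_o; [exact: continuous_sin|exact: arg_c].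
have dcos (x k : R) : is_derive k 1 (fun k => cos (k * x + b)) (- sin (k * x + b) * x).
  have D := @is_derive_o R k cos (fun k => k * x + b) _ _ (is_derive_cos _) (is_derive_add
    (is_derive_mul (is_derive_idfun k) (is_derive_const k x)) (is_derive_const k b)).
  by apply: is_derive_eq D _; rewrite mulr0 add0r mulr1 addr0.
have bnd (h : R -> R) : continuous h -> (forall x, `|h x| <= 1) -> intg nu h.
  by move=> hc h1; apply: (intg_le _ _ (intg_cst nu 1)) => //; exact: mE.
have icos k : intg nu (fun x => cos (k * x + b)).
  by apply: bnd => // x; exact: cos_max.
pose G k := Exp nu (fun x => cos (k * x + b)).
have Gd (k : R) : is_derive k 1 G (Exp nu (fun x => - sin (k * x + b) * x)).
  have kI : `](k - 1), (k + 1)[%classic k by rewrite /= in_itv/=; apply/andP; split; lra.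
  have d1 (k' x : R) : is_derive k' 1 (fun k => cos (k * x + b)) (- sin (k' * x + b) * x).
    exact: dcos.
  have D := @differentiation_under_integral R _ _ nu (fun k x => cos (k * x + b))
    setT measurableT k (k - 1) (k + 1) kI (fun k' _ => icos k')
    (fun k' x _ _ => @ex_derive _ _ _ _ _ _ _ (d1 k' x))
    (fun x => `|x|) (fun x => normr_ge0 x) (intg_norm ix).
  have D' := @derivable_under_integral R _ _ nu (fun k x => cos (k * x + b))
    setT measurableT k (k - 1) (k + 1) kI (fun k' _ => icos k')
    (fun k' x _ _ => @ex_derive _ _ _ _ _ _ _ (d1 k' x))
    (fun x => `|x|) (fun x => normr_ge0 x) (intg_norm ix).
  have E k' x : partial1of2 (fun k x => cos (k * x + b)) k' x = - sin (k' * x + b) * x.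
    by rewrite partial1of2E; exact: derive_val.
  have ub k' x : `](k - 1), (k + 1)[%classic k' -> [set: R] x ->
      `|partial1of2 (fun k x => cos (k * x + b)) k' x| <= `|x|.
    by move=> _ _; rewrite E normrM normrN ler_piMl// sin_max.
  split; first exact: (D' ub).
  rewrite -derive1E (D ub); congr fine; apply: eq_integral => x _.
  by rewrite E.
have GE k : Exp nu (fun x => - sin (k * x + b) * x) = - (s ^+ 2 * k) * G k.
  have ixs : intg nu (fun x => - sin (k * x + b) * x).
    apply: (intg_le _ _ (intg_norm ix)) => [|x].
      apply: mE; apply: continuous_mul; last exact: continuous_idfun.
      by apply: (continuous_o opp_continuous).
    by rewrite normrM normrN ler_piMl// sin_max.
  have isin : intg nu (fun x => sin (k * x + b)).
    by apply: bnd => // x; exact: sin_max.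
  have sE (x : R) : is_derive x 1 (fun x => sin (k * x + b)) (cos (k * x + b) * k).
    have D := @is_derive_o R x sin (fun x => k * x + b) _ _ (is_derive_sin _) (is_derive_add
      (is_derive_mul (is_derive_const x k) (is_derive_idfun x)) (is_derive_const x b)).
    by apply: is_derive_eq D _; rewrite mulr0 addr0 mulr1 addr0.
  have Ud : der (fun x => s ^+ 2 * (sin (k * x + b) * p x))
     (fun x => - sin (k * x + b) * x * p x + s ^+ 2 * k * (cos (k * x + b) * p x)).
    move=> x; have D := is_derive_scale (s ^+ 2) (is_derive_mul (sE x)
      (der_normal_pdf 0 s0 x)).
    by apply: is_derive_eq D _; rewrite subr0 -/p; field.
  have iL (f : R -> R) : continuous f -> intg nu f -> intg leb (fun x => f x * p x).
    by move=> fc /normal_prob_intg; apply; exact: mE.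
  have i1 := iL _ (sin_c k) isin; have i2 := iL _ (cos_c k) (icos k).
  have i3 : intg leb (fun x => - sin (k * x + b) * x * p x).
    apply: iL ixs; apply: continuous_mul; last exact: continuous_idfun.
    by apply: (continuous_o opp_continuous).
  have := line_ibp Ud _ (intgZ _ i1) (intgD i3 (intgZ _ i2)).
  rewrite ExpD//; last exact: intgZ.
  have mxs : measurable_fun setT (fun x => - sin (k * x + b) * x).
    apply: mE; apply: continuous_mul; last exact: continuous_idfun.
    by apply: (continuous_o opp_continuous).
  rewrite ExpZ// /G (normal_prob_Exp 0 s mxs) (normal_prob_Exp 0 s (mE _ (cos_c k))).
  move=> H; apply/eqP; rewrite -subr_eq0 mulNr opprK; apply/eqP; apply: H.
  apply: continuous_add; apply: continuous_mul => //.
  - apply: continuous_mul; last exact: continuous_idfun.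
    by apply: (continuous_o opp_continuous).
  - exact: continuous_const.
  - exact: continuous_mul.
pose H k := G k * expR (s ^+ 2 * k ^+ 2 / 2).
have Hd (k : R) : is_derive k 1 H 0.
  have D := is_derive_mul (Gd k) (der_expR_comp (is_derive_mul (is_derive_mul
    (is_derive_const k (s ^+ 2)) (is_derive_exp 2 (is_derive_idfun k)))
    (is_derive_const k 2^-1))).
  by apply: is_derive_eq D _; rewrite GE /= expr1; field.
have := is_derive_0_is_cst a 0 Hd.
rewrite /H expr0n/= mulr0 mul0r expR0 mulr1 /G.
have -> : (fun x : R => cos (0 * x + b)) = fun=> cos b.
  by apply/funext => x; rewrite mul0r add0r.
rewrite (Exp_cst nu (cos b)) => <-.
by rewrite mulrCA -expRD addNr expR0 mulr1.
Qed.

End NormalCharacteristic.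

(** * Variables with a Gaussian law, degenerate or not *)

Section GaussianLaw.
Context (R : realType) d (T : measurableType d) (P : probability T R).
Local Notation leb := (@lebesgue_measure R).
Variable Y : T -> R.
Hypothesis mY : measurable_fun setT Y.

Lemma Exp_dirac (m : R) (h : R -> R) : measurable_fun setT h ->
  Exp (\d_m : measure R R) h = h m.
Proof.
move=> mh; rewrite /Exp /Rintegral integral_dirac//.
  by rewrite diracT mul1e.
exact/measurable_EFinP.
Qed.

Lemma law_dirac m (h : R -> R) : has_gaussian_law P Y m 0 ->
  measurable_fun setT h -> Exp P (fun w => h (Y w)) = h m.
Proof.
move=> law mh; rewrite -(Exp_dirac m mh).
apply: (@transfer_Exp _ _ _ _ _ _ _ P (\d_m : measure R R) Y (fun x => x) mY) => //.
by move=> A mA; apply: etrans (law A mA) _; rewrite /gaussian_law eqxx.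
Qed.

Lemma law_normal m v : v != 0 -> has_gaussian_law P Y m v ->
  forall A : set R, measurable A ->
  P (Y @^-1` A) = normal m (Num.sqrt v) ((fun x => x) @^-1` A).
Proof.
move=> v0 law A mA; apply: etrans (law A mA) _.
by rewrite /gaussian_law (negbTE v0).
Qed.

(** Gaussian families only provide some mean and variance, which have to be matched with the
    moments. For v > 0 the function (x - m) p is the derivative of - v p, so its integral vanishes
    and m = 0; then (v - x^2) p is the derivative of v x p. For v = 0 the law is a Dirac mass. *)
Lemma gaussian_params m v : 0 <= v -> has_gaussian_law P Y m v ->
  intg P (fun w => Y w ^+ 2) -> Exp P Y = 0 -> m = 0 /\ v = Exp P (fun w => Y w ^+ 2).
Proof.
move=> v0 law i2 E1.
have c2 : continuous (fun x : R => x ^+ 2).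
  by apply: continuous_exp; exact: continuous_idfun.
have m2 : measurable_fun setT (fun x : R => x ^+ 2) by exact: continuous_meas.
have [v0'|vN0] := eqVneq v 0.
  rewrite v0' in law.
  have := law_dirac law (continuous_meas (@continuous_idfun R)).
  rewrite -/Y => E; have m0 : m = 0 by rewrite -E1.
  by split=> //; rewrite v0' (law_dirac law m2) m0 expr0n.
have vgt0 : 0 < v by rewrite lt_neqAle eq_sym vN0.
pose s := Num.sqrt v; have s2 : s ^+ 2 = v by rewrite sqr_sqrtr.
have s0 : s != 0 by rewrite sqrtr_eq0 -ltNge.
have L := law_normal vN0 law; rewrite -/s in L.
pose nu := normal m s; pose p := normal_pdf m s.
have mid : measurable_fun setT (fun x : measurableTypeR R => x : R) by [].
have mx : measurable_fun setT (fun x : R => x) by [].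
have j2 : intg nu (fun x => x ^+ 2).
  exact: (@transfer_intg _ _ _ _ _ _ _ P nu Y (fun x => x) mY mid L _ m2 i2).
have j1 : intg nu (fun x => x).
  apply: (intg_le _ _ (intgD (intg_cst nu 1) j2)) => // x.
  by rewrite -real_normK ?num_real//; have := normr_ge0 x; nra.
have F1 : Exp nu (fun x => x) = 0.
  by rewrite -E1; apply/esym/(@transfer_Exp _ _ _ _ _ _ _ P nu Y (fun x => x) mY mid L _ mx).
have F2 : Exp nu (fun x => x ^+ 2) = Exp P (fun w => Y w ^+ 2).
  by apply/esym/(@transfer_Exp _ _ _ _ _ _ _ P nu Y (fun x => x) mY mid L _ m2).
have pd := der_normal_pdf m s0; rewrite s2 -/p in pd.
have pc := der_continuous pd.
have ip : intg leb p by exact: integrable_normal_pdf.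
have Ep : Exp leb p = 1 by rewrite /Exp /Rintegral integral_normal_pdf.
have k1 : intg leb (fun x => x * p x) by apply/normal_prob_intg.
have k2 : intg leb (fun x => x ^+ 2 * p x) by apply/normal_prob_intg.
have H1 : Exp leb (fun x => x * p x) = 0 by rewrite -(normal_prob_Exp m s mx).
have H2 : Exp leb (fun x => x ^+ 2 * p x) = Exp P (fun w => Y w ^+ 2).
  by rewrite -(normal_prob_Exp m s m2).
have m0 : m = 0.
  have Ud : der (fun x => - v * p x) (fun x => x * p x - m * p x).
    by move=> x; apply: is_derive_eq (is_derive_scale (- v) (pd x)) _; field.
  have := line_ibp Ud _ (intgZ _ ip) (intgB k1 (intgZ _ ip)).
  rewrite ExpB//; last exact: intgZ.
  rewrite ExpZ// H1 Ep mulr1 sub0r => h; apply/eqP; rewrite -oppr_eq0.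
  apply/eqP/h; apply: continuous_sub; apply: continuous_mul => //.
    exact: continuous_idfun.
  exact: continuous_const.
split=> //.
have Ud : der (fun x => v * (x * p x)) (fun x => v * p x - x ^+ 2 * p x).
  move=> x; have D := is_derive_scale v (is_derive_mul (is_derive_idfun x) (pd x)).
  by apply: is_derive_eq D _; rewrite m0; field.
have := line_ibp Ud _ (intgZ _ k1) (intgB (intgZ _ ip) k2).
rewrite ExpB//; last exact: intgZ.
rewrite ExpZ// Ep mulr1 H2 => h; apply/eqP; rewrite -subr_eq0; apply/eqP/h.
by apply: continuous_sub; apply: continuous_mul => //; exact: continuous_const.
Qed.

Lemma gaussian_law_cos m v (a b : R) : 0 <= v -> has_gaussian_law P Y m v ->
  intg P (fun w => Y w ^+ 2) -> Exp P Y = 0 ->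
  Exp P (fun w => cos (a * Y w + b)) =
  expR (- (Exp P (fun w => Y w ^+ 2) * a ^+ 2 / 2)) * cos b.
Proof.
move=> v0 law i2 E1; have [m0 vE] := gaussian_params v0 law i2 E1.
rewrite -vE; rewrite m0 in law.
have cc : continuous (fun x : R => cos (a * x + b)).
  apply: continuous_o; first exact: continuous_cos.
  apply: continuous_add; last exact: continuous_const.
  by apply: continuous_mul; [exact: continuous_const|exact: continuous_idfun].
have mc := continuous_meas cc.
have [v0'|vN0] := eqVneq v 0.
  rewrite v0' in law *.
  by rewrite (law_dirac law mc) !mul0r mulr0 add0r oppr0 expR0 mul1r.
pose s := Num.sqrt v; have s2 : s ^+ 2 = v by rewrite sqr_sqrtr.
have s0 : s != 0 by rewrite sqrtr_eq0 -ltNge lt_neqAle eq_sym vN0.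
have L := law_normal vN0 law; rewrite -/s in L.
pose nu := normal 0 s.
have mid : measurable_fun setT (fun x : measurableTypeR R => x : R) by [].
have m2 : measurable_fun setT (fun x : R => x ^+ 2).
  by apply: continuous_meas; apply: continuous_exp; exact: continuous_idfun.
have j2 : intg nu (fun x => x ^+ 2).
  exact: (@transfer_intg _ _ _ _ _ _ _ P nu Y (fun x => x) mY mid L _ m2 i2).
have j1 : intg nu (fun x => x).
  apply: (intg_le _ _ (intgD (intg_cst nu 1) j2)) => // x.
  by rewrite -real_normK ?num_real//; have := normr_ge0 x; nra.
rewrite (@transfer_Exp _ _ _ _ _ _ _ P nu Y (fun x => x) mY mid L _ mc).
by rewrite normal_cos// s2.
Qed.

End GaussianLaw.

(** * Gaussian families and integration by parts *)

Section GaussianFamily.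
Context (R : realType).

(** A centered Gaussian vector with covariance [c], described by its characteristic function so that
    [c] may be singular. *)
Definition gauss_fam d (T : measurableType d) (P : probability T R) n
    (X : 'I_n -> T -> R) (c : 'I_n -> 'I_n -> R) : Prop :=
  (forall i, measurable_fun setT (X i)) /\
  forall a b, Exp P (trig X a b) =
    expR (- ((\sum_i \sum_j a i * a j * c i j) / 2)) * cos b.

Lemma gaussian_family_gauss_fam d (T : measurableType d) (P : probability T R)
    n (X : 'I_n -> T -> R) :
  (forall i, measurable_fun setT (X i)) ->
  (forall a : 'I_n -> R, exists m v : R, 0 <= v /\
     has_gaussian_law P (fun w => \sum_(i < n) a i * X i w) m v) ->
  (forall i, intg P (fun w => X i w ^+ 2)) -> (forall i, Exp P (X i) = 0) ->
  gauss_fam P X (fun i j => Exp P (fun w => X i w * X j w)).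
Proof.
move=> mX hG i2 E0; split=> // a b.
have iX i : intg P (X i).
  apply: (intg_le _ _ (intgD (intg_cst P 1) (i2 i))) => // w.
  by rewrite -real_normK ?num_real//; have := normr_ge0 (X i w); nra.
have iXX i j : intg P (fun w => X i w * X j w).
  apply: (intg_le _ _ (intgD (i2 i) (i2 j))) => [|w]; first exact: measurable_funM.
  rewrite normrM -[X i w ^+ 2]real_normK ?num_real// -[X j w ^+ 2]real_normK ?num_real//.
  by have := sqr_ge0 (`|X i w| - `|X j w|); have := normr_ge0 (X i w);
    have := normr_ge0 (X j w); nra.
pose Y w := \sum_(i < n) a i * X i w.
have mY : measurable_fun setT Y by exact: measurable_lin.
have Y2E w : Y w ^+ 2 = \sum_i \sum_j a i * a j * (X i w * X j w).
  rewrite expr2 /Y mulr_suml; apply: eq_bigr => i _; rewrite mulr_sumr.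
  by apply: eq_bigr => j _; ring.
have iY2 : intg P (fun w => Y w ^+ 2).
  rewrite (funext Y2E); apply: intg_sum => i; apply: intg_sum => j.
  exact: intgZ.
have EY2 : Exp P (fun w => Y w ^+ 2) =
    \sum_i \sum_j a i * a j * Exp P (fun w => X i w * X j w).
  rewrite (funext Y2E) Exp_sum; last by move=> i; apply: intg_sum => j; exact: intgZ.
  apply: eq_bigr => i _; rewrite Exp_sum; last by move=> j; exact: intgZ.
  by apply: eq_bigr => j _; rewrite ExpZ.
have EY : Exp P Y = 0.
  rewrite /Y Exp_sum; last by move=> i; exact: intgZ.
  by rewrite big1// => i _; rewrite ExpZ// E0 mulr0.
have [m [v [v0 law]]] := hG a.
have := gaussian_law_cos mY 1 b v0 law iY2 EY.
rewrite EY2 expr1n mulr1 => <-; congr Exp.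
by apply/funext => w; rewrite /trig mul1r.
Qed.

Definition joint d (T : measurableType d) n (X : 'I_n -> T -> R) (w : T) :
  n.-tuple R := [tuple X i w | i < n].

Lemma measurable_joint d (T : measurableType d) n (X : 'I_n -> T -> R) :
  (forall i, measurable_fun setT (X i)) -> measurable_fun setT (joint X).
Proof.
move=> mX; apply/measurable_fun_tnthP => i.
by rewrite (_ : _ \o _ = X i)//; apply/funext => w; rewrite /= tnth_mktuple.
Qed.

(** The two image laws on tuples have the same cosines. The sets whose indicators are multipliers
    form a sigma-algebra containing the preimages of Borel sets under the coordinates, which
    generate the measurable sets of tuples. *)
Lemma gauss_fam_law d (T : measurableType d) (P : probability T R)
    d' (T' : measurableType d') (P' : probability T' R) n
    (X : 'I_n -> T -> R) (X' : 'I_n -> T' -> R) c :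
  gauss_fam P X c -> gauss_fam P' X' c ->
  forall A, measurable A -> P (joint X @^-1` A) = P' (joint X' @^-1` A).
Proof.
move=> [mX tX] [mX' tX'].
have mJ := measurable_joint mX; have mJ' := measurable_joint mX'.
pose JX : {mfun T >-> n.-tuple R} := HB.pack (joint X)
  (isMeasurableFun.Build _ _ _ _ _ mJ).
pose JX' : {mfun T' >-> n.-tuple R} := HB.pack (joint X')
  (isMeasurableFun.Build _ _ _ _ _ mJ').
pose z (i : 'I_n) (t : n.-tuple R) : R := tnth t i.
have mz i : measurable_fun setT (z i) by exact: measurable_tnth.
have push e (U : measurableType e) (p : probability U R) (Z : 'I_n -> U -> R)
    (J : {mfun U >-> n.-tuple R}) a b : (J : U -> _) = joint Z ->
    Exp (distribution p J) (trig z a b) = Exp p (trig Z a b).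
  move=> JE.
  have mt := measurable_trig mz a b.
  have E w : trig Z a b w = trig z a b (J w).
    rewrite JE /trig; congr (cos (_ + _)); apply: eq_bigr => i _.
    by rewrite /z tnth_mktuple.
  rewrite (funext E).
  apply: (@transfer_Exp _ _ _ _ _ _ _ (distribution p J) p (fun t => t) J) => //.
have tE a b : Exp (distribution P JX) (trig z a b) =
              Exp (distribution P' JX') (trig z a b).
  by rewrite (push _ _ _ X)// (push _ _ _ X')// tX tX'.
move=> A mA; rewrite -[LHS]/(distribution P JX A) -[RHS]/(distribution P' JX' A).
apply: (mset_eq tE) => //.
move: A mA; apply: smallest_sub.
  split=> [|A mA|F mF].
  - rewrite -setCT; apply: ksetC; last by apply: kset_setT; exact: multiplier1.
    exact: multiplierC.
  - by rewrite setTD; apply: ksetC => //; exact: multiplierC.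
  - apply: kset_bigcup => //; first exact: multiplier1.
    + exact: multiplierM.
    + exact: multiplierC.
    + exact: multiplier_cvg.
move=> A; rewrite -bigcup_seq/= => -[i _ [B mB <-]].
by rewrite setTI; apply: mset_borel.
Qed.

End GaussianFamily.

(** * Fubini's theorem for real-valued integrals *)

Section FubiniExp.
Context (R : realType) d (T : measurableType d) (P : probability T R)
  d' (T' : measurableType d') (Q : probability T' R).

(** The inner integrals in Fubini's theorem are extended reals; [fine] changes them at most on a
    null set. *)
Lemma intg_fine (F : T -> \bar R) : P.-integrable setT F ->
  intg P (fine \o F) /\ Exp P (fine \o F) = fine (\int[P]_x F x)%E.
Proof.
move=> iF; have mF := measurable_int _ iF.
have mfF : measurable_fun setT (fine \o F) by apply: measurableT_comp => //.
have i1 : intg P (fine \o F).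
  apply: (le_integrable measurableT _ _ iF) => [|x _].
    exact/measurable_EFinP.
  by rewrite /=; case: (F x) => [r| |] //=; rewrite ?normr0 leey.
split=> //; rewrite /Exp /Rintegral; congr fine.
apply: ae_eq_integral => //; first exact/measurable_EFinP.
have := integrable_ae measurableT iF; apply: filterS => x /= /(_ I) fx _.
by rewrite /= fineK.
Qed.

Definition prodP : probability _ R := (P \x Q)%E.

Lemma prodP_Exp (h : T * T' -> R) : intg prodP h ->
  [/\ intg P (fun x => Exp Q (fun y => h (x, y))),
      Exp prodP h = Exp P (fun x => Exp Q (fun y => h (x, y))) &
      {ae P, forall x, intg Q (fun y => h (x, y))}].
Proof.
move=> ih; have [i1 E1] := intg_fine (integrable_fubini_F ih).
split; [exact: i1| |exact: ae_integrable1 ih].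
apply/esym; apply: etrans E1 _; congr fine.
exact: (integral12_prod_meas1 ih).
Qed.

End FubiniExp.

(** * Resampling one coordinate of a Gaussian vector *)

Section Resampling.
Context (R : realType) d (T : measurableType d) (P : probability T R) (n : nat).
Variables (X : 'I_n -> T -> R) (c : 'I_n -> 'I_n -> R) (l : 'I_n).
Hypotheses (cl : c l l = 1) (csym : forall i j, c i j = c j i)
  (fam : gauss_fam P X c).

(* [X l] is replaced by an independent normal variable while the residuals
   [X k - c l k * X l], which are independent of [X l], are kept. *)
Definition resample (k : 'I_n) (z : T * measurableTypeR R) : R :=
  X k z.1 + c l k * (z.2 - X l z.1).

(** The variance of a linear form splits into s^2, carried by [X l], and the variance of the form in
    the residuals, whose coefficients in terms of [X] are those of [a] with [s] subtracted at
    [l]. *)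
Lemma quad_shift (a : 'I_n -> R) :
  let s := \sum_i a i * c l i in
  \sum_i \sum_j (a i - s * (i == l)%:R) * (a j - s * (j == l)%:R) * c i j + s ^+ 2 =
  \sum_i \sum_j a i * a j * c i j.
Proof.
move=> s.
have E i j : (a i - s * (i == l)%:R) * (a j - s * (j == l)%:R) * c i j =
    a i * a j * c i j + (- s * (a i * (c i j * (j == l)%:R)) +
      (- s * (a j * (c i j * (i == l)%:R)) +
       s ^+ 2 * ((j == l)%:R * (c i j * (i == l)%:R)))).
  by ring.
have dj (f : 'I_n -> R) : \sum_j f j * (j == l)%:R = f l.
  rewrite (bigD1 l)//= eqxx mulr1 big1 ?addr0// => j /negbTE ->.
  by rewrite mulr0.
under eq_bigr do under eq_bigr do rewrite E.
under eq_bigr do rewrite big_split big_split big_split/= -!mulr_sumr dj.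
rewrite big_split big_split big_split/= -!mulr_sumr.
have -> : \sum_i a i * c i l = s by apply: eq_bigr => i _; rewrite csym.
have -> : \sum_i \sum_j a j * (c i j * (i == l)%:R) = s.
  by rewrite exchange_big/=; apply: eq_bigr => j _; rewrite -mulr_sumr dj.
have -> : \sum_i \sum_j (j == l)%:R * (c i j * (i == l)%:R) = 1.
  rewrite exchange_big/=; under eq_bigr do rewrite -mulr_sumr dj mulrC.
  by rewrite dj.
ring.
Qed.

Lemma measurable_resample k : measurable_fun setT (resample k).
Proof.
have [mX _] := fam.
apply: measurable_funD; first exact: measurableT_comp.
apply: measurable_funM; first exact: measurable_cst.
by apply: measurable_funB; [exact: measurable_snd|exact: measurableT_comp].
Qed.

Lemma gauss_cos (s a : R) :
  Exp (gauss R) (fun x => cos (s * x + a)) = expR (- (s ^+ 2 / 2)) * cos a.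
Proof.
have := @normal_cos R 1 s a (oner_neq0 _).
rewrite expr1n mul1r; apply; apply/(intg_gauss (continuous_meas (@continuous_idfun R))).
exact: intg_id_gpdf.
Qed.

(** For fixed [w] the linear form is s x plus the form with coefficients [a'] in [X]. Integrating
    over x gives the factor exp (- s^2 / 2), which restores the variance removed in passing from [a]
    to [a']. *)
Lemma resample_fam : gauss_fam (prodP P (gauss R)) resample c.
Proof.
have [mX tX] := fam.
split=> [|a b]; first exact: measurable_resample.
pose s := \sum_i a i * c l i.
pose a' i := a i - s * (i == l)%:R.
have it : intg (prodP P (gauss R)) (trig resample a b).
  apply: intg_bounded1; last exact: trig_le1.
  by apply: measurable_trig; exact: measurable_resample.
have [_ -> _] := prodP_Exp it.
have E w : Exp (gauss R) (fun x => trig resample a b (w, x)) =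
    expR (- (s ^+ 2 / 2)) * trig X a' b w.
  rewrite -gauss_cos; congr Exp; apply/funext => x; rewrite /trig addrA.
  congr (cos (_ + _)); rewrite /resample/= /a' {1}/s mulr_suml.
  have -> : \sum_i (a i - s * (i == l)%:R) * X i w =
      \sum_i a i * X i w - s * X l w.
    under eq_bigr do rewrite mulrBl; rewrite sumrB; congr (_ - _).
    rewrite (bigD1 l)//= eqxx mulr1 big1 ?addr0// => j /negbTE ->.
    by rewrite mulr0 mul0r.
  rewrite {1}/s mulr_suml addrCA -sumrB -big_split/=.
  by apply: eq_bigr => i _; ring.
rewrite (funext E) ExpZ; last first.
  by apply: intg_bounded1; [exact: measurable_trig|exact: trig_le1].
rewrite tX mulrA -expRD -(quad_shift a); congr (expR _ * _).
rewrite -/s; lra.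
Qed.

End Resampling.

Lemma continuous_bigsum (R : realType) (I : Type) (s : seq I) (F : I -> R -> R) :
  (forall i, continuous (F i)) -> continuous (fun x => \sum_(i <- s) F i x).
Proof.
move=> Fc; elim: s => [|i s IH].
  by under eq_fun do rewrite big_nil; exact: continuous_const.
by under eq_fun do rewrite big_cons; exact: continuous_add.
Qed.

(** * Integration by parts in one coordinate of a Gaussian vector *)

Section FamilyIBP.
Context (R : realType).

Lemma Exp_ae d (T : measurableType d) (m : {measure set T -> \bar R})
    (f g : T -> R) : intg m f -> intg m g -> {ae m, forall x, f x = g x} ->
  Exp m f = Exp m g.
Proof.
move=> mf mg fg; rewrite /Exp /Rintegral; congr fine.
apply: ae_eq_integral => //; [exact: measurable_int mf|exact: measurable_int mg|].
by apply: filterS fg => x /= -> _.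
Qed.

Section Transfer.
Context d (T : measurableType d) (P : probability T R)
  d' (T' : measurableType d') (P' : probability T' R) (n : nat)
  (X : 'I_n -> T -> R) (X' : 'I_n -> T' -> R) (c : 'I_n -> 'I_n -> R).
Hypotheses (fX : gauss_fam P X c) (fX' : gauss_fam P' X' c).
Variable h : n.-tuple R -> R.
Hypothesis mh : measurable_fun setT h.

Lemma fam_Exp :
  Exp P (fun w => h (joint X w)) = Exp P' (fun w => h (joint X' w)).
Proof.
apply: transfer_Exp => //.
- by apply: measurable_joint; case: fX.
- by apply: measurable_joint; case: fX'.
- exact: gauss_fam_law fX fX'.
Qed.

Lemma fam_intg : intg P (fun w => h (joint X w)) ->
  intg P' (fun w => h (joint X' w)).
Proof.
apply: transfer_intg => //.
- by apply: measurable_joint; case: fX.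
- by apply: measurable_joint; case: fX'.
- exact: gauss_fam_law fX fX'.
Qed.

End Transfer.

Context d (T : measurableType d) (P : probability T R) (n : nat).
Variables (X : 'I_n -> T -> R) (c : 'I_n -> 'I_n -> R) (l : 'I_n).
Hypotheses (cl : c l l = 1) (csym : forall i j, c i j = c j i)
  (fam : gauss_fam P X c).
Variables (phi dphi u g dg : R -> R) (kap C D : R).
Hypotheses (phid : der phi dphi) (dphic : continuous dphi)
  (ud : der u (fun x => x * u x - phi x)) (iphi : intg (gauss R) phi)
  (iu : intg (gauss R) u)
  (gd : der g dg) (dgc : continuous dg) (gC : forall x, `|g x| <= C)
  (dgD : forall x, `|dg x| <= D)
  (iphiX : intg P (fun w => phi (X l w)))
  (iuX : forall k, intg P (fun w => u (X l w) * dphi (X k w))).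

Let phic := der_continuous phid.
Let uc := der_continuous ud.
Let gc := der_continuous gd.

Let tn (i : 'I_n) (t : n.-tuple R) : R := tnth t i.
Let mtn i : measurable_fun setT (tn i).
Proof. exact: measurable_tnth. Qed.

Let comp_meas (f : R -> R) (h : n.-tuple R -> R) : continuous f ->
  measurable_fun setT h -> measurable_fun setT (fun t => f (h t)).
Proof. by move=> fc mh; apply: measurableT_comp => //; exact: continuous_meas. Qed.

Let S (t : n.-tuple R) := kap * \sum_(k < n) phi (tn k t).
Let mS : measurable_fun setT S.
Proof.
apply: measurable_funM; first exact: measurable_cst.
by apply: measurable_sum => k; exact: comp_meas.
Qed.

Let h1 (t : n.-tuple R) := phi (tn l t) * g (S t).
Let h2 (t : n.-tuple R) :=
  u (tn l t) * (dg (S t) * (kap * \sum_(k < n) dphi (tn k t) * c l k)).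

Let mh1 : measurable_fun setT h1.
Proof. by apply: measurable_funM; exact: comp_meas. Qed.

Let mh2 : measurable_fun setT h2.
Proof.
apply: measurable_funM; first exact: comp_meas.
apply: measurable_funM; first exact: comp_meas.
apply: measurable_funM; first exact: measurable_cst.
apply: measurable_sum => k; apply: measurable_funM; last exact: measurable_cst.
exact: comp_meas.
Qed.

Let jointE (e : measure_display) (U : measurableType e) (Z : 'I_n -> U -> R) i w :
  tn i (joint Z w) = Z i w.
Proof. by rewrite /tn tnth_mktuple. Qed.

Let ih1 : intg P (fun w => h1 (joint X w)).
Proof.
have mJ := measurable_joint fam.1.
apply: (intg_le _ _ (intgZ C (intg_norm iphiX))) => [|w].
  exact: measurableT_comp mh1 mJ.
by rewrite /h1 jointE normrM mulrC ler_wpM2r.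
Qed.

Let D0 : 0 <= D. Proof. exact: le_trans (dgD 0). Qed.

Let ih2 : intg P (fun w => h2 (joint X w)).
Proof.
have mJ := measurable_joint fam.1.
have iS : intg P (fun w => \sum_(k < n) u (X l w) * dphi (X k w) * c l k).
  by apply: intg_sum => k; exact: intgZr.
apply: (intg_le _ _ (intgZ (D * `|kap|) (intg_norm iS))) => [|w].
  exact: measurableT_comp mh2 mJ.
rewrite /h2 jointE.
have -> : u (X l w) * (dg (S (joint X w)) *
   (kap * \sum_(k < n) dphi (tn k (joint X w)) * c l k)) =
   dg (S (joint X w)) * kap * (\sum_(k < n) u (X l w) * dphi (X k w) * c l k).
  rewrite mulrCA -mulrA; congr (_ * _); rewrite mulrCA mulr_sumr; congr (_ * _).
  by apply: eq_bigr => k _; rewrite jointE mulrA.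
rewrite !normrM; apply: ler_wpM2r => //; exact: ler_wpM2r.
Qed.

(** In the resampled vector the coordinate [l] is x itself, and every coordinate [k] is affine in x
    with slope [c l k]. By Fubini's theorem the identity reduces to [gauss_ibp] in x, applied to the
    value of [g] at the scaled sum; its derivative produces the factors [c l k] and [kap]. *)
Lemma family_ibp :
  Exp P (fun w => phi (X l w) * g (kap * \sum_(k < n) phi (X k w))) =
  kap * \sum_(k < n) c l k * Exp P (fun w => u (X l w) * dphi (X k w) *
    dg (kap * \sum_(k < n) phi (X k w))).
Proof.
pose Z := resample X c l.
have fZ : gauss_fam (prodP P (gauss R)) Z c by exact: resample_fam.
have Zl w x : Z l (w, x) = x by rewrite /Z /resample/= cl mul1r addrC subrK.
have j1 := fam_intg fam fZ mh1 ih1; have j2 := fam_intg fam fZ mh2 ih2.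
have [k1 E1 a1] := prodP_Exp j1; have [k2 E2 a2] := prodP_Exp j2.
have SE (e : measure_display) (U : measurableType e) (Y : 'I_n -> U -> R) w :
    S (joint Y w) = kap * \sum_(k < n) phi (Y k w).
  by rewrite /S; congr (_ * _); apply: eq_bigr => k _; rewrite jointE.
have L1 : Exp P (fun w => phi (X l w) * g (kap * \sum_(k < n) phi (X k w))) =
    Exp P (fun w => h1 (joint X w)).
  by congr Exp; apply/funext => w; rewrite /h1 SE jointE.
have L2 : kap * \sum_(k < n) c l k * Exp P (fun w => u (X l w) * dphi (X k w) *
    dg (kap * \sum_(k < n) phi (X k w))) = Exp P (fun w => h2 (joint X w)).
  have mJ := measurable_joint fam.1.
  have ik k : intg P (fun w => u (X l w) * dphi (X k w) *
      dg (kap * \sum_(k < n) phi (X k w))).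
    apply: (intg_le _ _ (intgZr D (intg_norm (iuX k)))) => [|w].
      apply: measurable_funM; first exact: intg_measurable (iuX k).
      apply: (measurableT_comp (continuous_meas dgc)).
      have := measurableT_comp mS mJ; congr measurable_fun.
      by apply/funext => w; rewrite /= SE.
    by rewrite normrM ler_wpM2l.
  have E w : h2 (joint X w) = kap * \sum_(k < n) c l k * (u (X l w) * dphi (X k w) *
      dg (kap * \sum_(k < n) phi (X k w))).
    rewrite /h2 SE jointE; set G := dg _.
    have -> : \sum_(k < n) c l k * (u (X l w) * dphi (X k w) * G) =
        u (X l w) * G * \sum_(k < n) dphi (tn k (joint X w)) * c l k.
      by rewrite mulr_sumr; apply: eq_bigr => k _; rewrite jointE; ring.
    ring.
  rewrite (funext E) ExpZ ?Exp_sum.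
  - by congr (_ * _); apply: eq_bigr => k _; rewrite ExpZ.
  - by move=> k; exact: intgZ.
  - by apply: intg_sum => k; exact: intgZ.
rewrite L1 L2 (fam_Exp fam fZ mh1) (fam_Exp fam fZ mh2) E1 E2.
(* The one-dimensional identity needs the section of [h2] at [w] to be integrable, which holds for
   almost every [w] only. *)
apply: Exp_ae => //; apply: filterS a2 => w i2.
pose psi x := g (S (joint Z (w, x))).
pose dpsi x := dg (S (joint Z (w, x))) *
  (kap * \sum_(k < n) dphi (tn k (joint Z (w, x))) * c l k).
have Zd (k : 'I_n) (x : R) : is_derive x 1 (fun x : R => Z k (w, x)) (c l k).
  have Dv := is_derive_add (is_derive_const x (X k w)) (is_derive_scale (c l k)
    (is_derive_sub (is_derive_idfun x) (is_derive_const x (X l w)))).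
  by apply: is_derive_eq Dv _; rewrite add0r subr0 mulr1.
have psid : der psi dpsi.
  move=> x; rewrite /psi /dpsi.
  have -> : (fun x0 : R => g (S (joint Z (w, x0)))) =
      fun x0 => g (kap * \sum_(k < n) phi (Z k (w, x0))).
    by apply/funext => y; rewrite SE.
  have Dv := @is_derive_o R x g _ _ _ (gd _) (is_derive_scale kap
    (@is_derive_bigsum R x _ (index_enum 'I_n) (fun k y => phi (Z k (w, y))) _
      (fun k => @is_derive_o R x phi _ _ _ (phid _) (Zd k x)))).
  apply: is_derive_eq Dv _; rewrite SE; congr (_ * (_ * _)).
  by apply: eq_bigr => k _; rewrite jointE.
have Zc k : continuous (fun x : R => Z k (w, x)) := der_continuous (Zd k).
have dpsic : continuous dpsi.
  have -> : dpsi = fun x => dg (kap * \sum_(k < n) phi (Z k (w, x))) *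
      (kap * \sum_(k < n) dphi (Z k (w, x)) * c l k).
    apply/funext => x; rewrite /dpsi SE; congr (_ * (_ * _)).
    by apply: eq_bigr => k _; rewrite jointE.
  apply: continuous_mul.
    apply: continuous_o => //; apply: continuous_mul; first exact: continuous_const.
    by apply: continuous_bigsum => k; exact: continuous_o.
  apply: continuous_mul; first exact: continuous_const.
  apply: continuous_bigsum => k; apply: continuous_mul; last exact: continuous_const.
  exact: continuous_o.
have E3 : (fun x => h1 (joint Z (w, x))) = fun x => phi x * psi x.
  by apply/funext => x; rewrite /h1 jointE Zl.
have E4 : (fun x => h2 (joint Z (w, x))) = fun x => u x * dpsi x.
  by apply/funext => x; rewrite /h2 jointE Zl.
rewrite E3 E4; rewrite E4 in i2.
exact: (gauss_ibp phic ud iphi iu psid dpsic (fun x => gC _) i2).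
Qed.

End FamilyIBP.

(** * The Poincare inequality for Gaussian families *)

Section EfronStein.
Context (R : realType).

Lemma le_Exp_ae d (T : measurableType d) (m : {measure set T -> \bar R})
    (f g : T -> R) : intg m f -> intg m g -> {ae m, forall x, f x <= g x} ->
  Exp m f <= Exp m g.
Proof.
move=> mf mg fg; rewrite -subr_ge0 -ExpB//.
have mgf := intgB mg mf.
rewrite (@Exp_ae _ _ _ m (fun x => g x - f x) (fun x => `|g x - f x|))//.
- exact: Exp_ge0.
- exact: intg_norm.
- by apply: filterS fg => x fgx; rewrite ger0_norm// subr_ge0.
Qed.

Lemma intg_sqr d (T : measurableType d) (P : probability T R) (h : T -> R) :
  measurable_fun setT h -> intg P (fun x => h x ^+ 2) -> intg P h.
Proof.
move=> mh i2; apply: (intg_le _ _ (intgD (intg_cst P 1) i2)) => // x.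
by rewrite -[h x ^+ 2]real_normK ?num_real//; have := normr_ge0 (h x); nra.
Qed.

Lemma variance_centered d (T : measurableType d) (P : probability T R) (h : T -> R) :
  measurable_fun setT h -> intg P (fun x => h x ^+ 2) ->
  Exp P (fun x => (h x - Exp P h) ^+ 2) = Exp P (fun x => h x ^+ 2) - Exp P h ^+ 2.
Proof.
move=> mh i2; have i1 := intg_sqr mh i2; set e := Exp P h.
have E x : (h x - e) ^+ 2 = h x ^+ 2 + (- 2 * e * h x + e ^+ 2) by ring.
have ic := intg_cst P (e ^+ 2).
rewrite (funext E) ExpD//; last by apply: intgD => //; exact: intgZ.
rewrite ExpD//; last exact: intgZ.
by rewrite (ExpZ (- 2 * e))// (Exp_cst P (e ^+ 2)) -/e; ring.
Qed.

Lemma sqr_Exp_le d (T : measurableType d) (P : probability T R) (h : T -> R) :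
  measurable_fun setT h -> intg P (fun x => h x ^+ 2) ->
  Exp P h ^+ 2 <= Exp P (fun x => h x ^+ 2).
Proof.
move=> mh i2; rewrite -subr_ge0 -variance_centered//.
by apply: Exp_ge0 => x; exact: sqr_ge0.
Qed.

Section TwoFactors.
Context d (T : measurableType d) (P : probability T R)
  d' (T' : measurableType d') (Q : probability T' R).

Lemma prodP_Exp_swap (h : T * T' -> R) : intg (prodP P Q) h ->
  [/\ intg Q (fun y => Exp P (fun x => h (x, y))),
      Exp (prodP P Q) h = Exp Q (fun y => Exp P (fun x => h (x, y))) &
      {ae Q, forall y, intg P (fun x => h (x, y))}].
Proof.
move=> ih; have mh := measurable_int _ ih.
have iG : Q.-integrable setT (fun y => \int[P]_x (h (x, y))%:E)%E.
  apply/integrableP; split; first exact: (measurable_fubini_G ih).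
  have := (integrable21ltyP P Q mh).1 ih; apply: le_lt_trans.
  apply: ge0_le_integral => //.
  - by apply: measurableT_comp => //; exact: (measurable_fubini_G ih).
  - apply: (measurable_fun_fubini_tonelli_G (fun z => `|(h z)%:E|%E)) => //.
    exact: measurableT_comp.
  - move=> y _; apply: le_abse_integral => //.
    by apply: (measurableT_comp mh); exact: pair2_measurable.
have [i1 E1] := intg_fine iG.
split; [exact: i1| |exact: ae_integrable2 ih].
apply/esym; apply: etrans E1 _; congr fine.
exact: (integral21_prod_meas1 ih).
Qed.

Lemma intg_snd (k : T' -> R) : intg Q k -> intg (prodP P Q) (fun z => k z.2).
Proof.
move=> ik.
apply: (@transfer_intg _ _ _ _ _ _ _ Q (prodP P Q) (fun y => y) snd) => //.
- move=> A mA; rewrite -[RHS]/((P \x Q)%E (snd @^-1` A)).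
  rewrite -setTX product_measure1E//.
  by rewrite -[X in (X * _)%E]/(P setT) probability_setT mul1e.
- exact: intg_measurable ik.
Qed.

(** The Efron-Stein inequality for two independent variables. The variance is the mean of the
    variance in y plus the variance of g(x) = E_Q f(x, y). With m(y) = E_P f(x, y), one has g(x) - e
    = E_Q (f(x, y) - m(y)), so by Jensen's inequality the second term is at most E (f - m)^2, the
    mean of the variance in x. *)
Lemma efron_stein2 (f : T * T' -> R) : measurable_fun setT f ->
  intg (prodP P Q) (fun z => f z ^+ 2) ->
  [/\ intg P (fun x => Exp Q (fun y => f (x, y) ^+ 2) - Exp Q (fun y => f (x, y)) ^+ 2),
      intg Q (fun y => Exp P (fun x => f (x, y) ^+ 2) - Exp P (fun x => f (x, y)) ^+ 2) &
  Exp (prodP P Q) (fun z => f z ^+ 2) - Exp (prodP P Q) f ^+ 2 <=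
  Exp P (fun x => Exp Q (fun y => f (x, y) ^+ 2) - Exp Q (fun y => f (x, y)) ^+ 2) +
  Exp Q (fun y => Exp P (fun x => f (x, y) ^+ 2) - Exp P (fun x => f (x, y)) ^+ 2)].
Proof.
move=> mf i2; have i1 := intg_sqr mf i2.
have ms1 x : measurable_fun setT (fun y => f (x, y)).
  by apply: (measurableT_comp mf); exact: pair1_measurable.
have ms2 y : measurable_fun setT (fun x => f (x, y)).
  by apply: (measurableT_comp mf); exact: pair2_measurable.
have [a1 A1 s1] := prodP_Exp i1; have [a2 A2 s2] := prodP_Exp i2.
have [b1 B1 t1] := prodP_Exp_swap i1; have [b2 B2 t2] := prodP_Exp_swap i2.
pose g x := Exp Q (fun y => f (x, y)); pose m y := Exp P (fun x => f (x, y)).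
have mg : measurable_fun setT g := intg_measurable a1.
have mm : measurable_fun setT m := intg_measurable b1.
(* Sections of [f] are square integrable only almost everywhere, so the partial means are dominated
   only almost everywhere. *)
have ae_int e (U : measurableType e) (p : probability U R) (k q : U -> R) :
    measurable_fun setT k -> intg p q -> {ae p, forall x, k x ^+ 2 <= q x} ->
    intg p (fun x => k x ^+ 2).
  move=> mk iq kq; apply/integrableP; split.
    by apply/measurable_EFinP; exact: measurable_funX.
  move/integrableP: (iq) => [mq]; apply: le_lt_trans.
  apply: ae_ge0_le_integral => //.
  - by apply: measurableT_comp => //; apply/measurable_EFinP; exact: measurable_funX.
  - exact: measurableT_comp.
  - apply: filterS kq => x kqx _ /=; rewrite lee_fin ger0_norm ?sqr_ge0//.
    by rewrite (le_trans kqx)// ler_norm.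
have ig2 : intg P (fun x => g x ^+ 2).
  by apply: (ae_int _ _ _ _ _ mg a2); apply: filterS s2 => x h; exact: sqr_Exp_le.
have im2 : intg Q (fun y => m y ^+ 2).
  by apply: (ae_int _ _ _ _ _ mm b2); apply: filterS t2 => x h; exact: sqr_Exp_le.
have j1 : intg P (fun x => Exp Q (fun y => f (x, y) ^+ 2) - g x ^+ 2) by exact: intgB.
have j2 : intg Q (fun y => Exp P (fun x => f (x, y) ^+ 2) - m y ^+ 2) by exact: intgB.
split=> //.
pose e := Exp (prodP P Q) f.
have Eg : Exp P g = e by exact: esym A1.
have Em : Exp Q m = e by exact: esym B1.
rewrite -/e -/(g _) A2 ExpB//.
have H : Exp P (fun x => g x ^+ 2) - e ^+ 2 <=
    Exp Q (fun y => Exp P (fun x => f (x, y) ^+ 2) - m y ^+ 2); last first.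
  by have := H; rewrite /g; lra.
rewrite -Eg -variance_centered//.
pose k (z : T * T') := (f z - m z.2) ^+ 2.
have mk : measurable_fun setT (fun z : T * T' => f z - m z.2).
  by apply: measurable_funB => //; exact: measurableT_comp.
have ik : intg (prodP P Q) k.
  apply: (intg_le _ _ (intgD (intgZ 2 i2) (intgZ 2 (intg_snd im2)))) => [|z].
    exact: measurable_funX.
  rewrite /k ger0_norm ?sqr_ge0//; have := sqr_ge0 (f z + m z.2); nra.
have [p1 P1 q1] := prodP_Exp ik; have [p2 P2 q2] := prodP_Exp_swap ik.
have i_m : intg Q m := b1.
apply: (@le_trans _ _ (Exp (prodP P Q) k)).
  rewrite P1 Eg; apply: le_Exp_ae => //.
    have E x : (g x - e) ^+ 2 = g x ^+ 2 + (- 2 * e * g x + e ^+ 2) by ring.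
    rewrite (funext E); apply: intgD => //; apply: intgD; first exact: intgZ.
    exact: intg_cst.
  apply: filterS2 q1 s1 => x kx fx.
  have -> : g x - e = Exp Q (fun y => f (x, y) - m y) by rewrite ExpB// Em.
  by apply: sqr_Exp_le => //; apply: measurable_funB.
rewrite P2 le_eqVlt; apply/orP; left; apply/eqP; apply: Exp_ae => //.
by apply: filterS t2 => y fy; rewrite -variance_centered.
Qed.

End TwoFactors.

End EfronStein.

(** * Factorization of positive semidefinite matrices *)

Section PsdFactorization.
Context (R : realType).

Definition psd n (c : 'I_n -> 'I_n -> R) : Prop :=
  (forall i j, c i j = c j i) /\
  forall a : 'I_n -> R, 0 <= \sum_i \sum_j a i * a j * c i j.

Lemma psd_split n (c : 'I_n.+1 -> 'I_n.+1 -> R) (a : 'I_n.+1 -> R) :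
  (forall i j, c i j = c j i) ->
  \sum_i \sum_j a i * a j * c i j =
  a ord0 ^+ 2 * c ord0 ord0 +
  2 * a ord0 * \sum_i a (lift ord0 i) * c (lift ord0 i) ord0 +
  \sum_i \sum_j a (lift ord0 i) * a (lift ord0 j) * c (lift ord0 i) (lift ord0 j).
Proof.
move=> cs; rewrite big_ord_recl big_ord_recl/=.
under [X in _ + X = _]eq_bigr do rewrite big_ord_recl.
rewrite big_split/= addrA; congr (_ + _).
rewrite -addrA; congr (_ + _).
rewrite mulr_sumr -big_split/=; apply: eq_bigr => i _.
by rewrite (cs ord0); ring.
Qed.

(** Cholesky factorization by induction on the size, for matrices that may be singular. If the
    corner entry is 0, positivity forces its row and column to vanish; otherwise the induction
    hypothesis is applied to the Schur complement [c'] of the corner. *)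
Lemma psd_factor n (c : 'I_n -> 'I_n -> R) : psd c ->
  exists A : 'I_n -> 'I_n -> R, forall i j, c i j = \sum_k A i k * A j k.
Proof.
elim: n c => [|n IH] c [cs cp]; first by exists (fun _ _ => 0) => -[].
have c00 : 0 <= c ord0 ord0.
  have := cp (fun i => (i == ord0)%:R); rewrite psd_split//= expr1n mul1r.
  rewrite big1 ?mulr0 ?addr0; last by move=> i _; rewrite mul0r.
  by rewrite big1 ?addr0// => i _; rewrite big1// => j _; rewrite !mul0r.
pose l (i : 'I_n) := lift ord0 i.
have [c0|c0] := eqVneq (c ord0 ord0) 0.
  have ci0 i : c (l i) ord0 = 0.
    apply/eqP; rewrite eq_le; apply/andP.
    have H t : 0 <= 2 * t * c (l i) ord0 + c (l i) (l i).
      have := cp (fun j => if unlift ord0 j is Some k then (k == i)%:R else t).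
      rewrite psd_split//= ?unlift_none c0 mulr0 add0r.
      rewrite (bigD1 i)//= liftK eqxx mul1r big1 ?addr0; last first.
        by move=> j /negbTE ji; rewrite liftK ji mul0r.
      rewrite (bigD1 i)//= (bigD1 i)//= liftK eqxx !mul1r big1 ?addr0; last first.
        by move=> j /negbTE ji; rewrite liftK ji mulr0 mul0r.
      rewrite [X in _ + (_ + X)]big1 ?addr0// => j /negbTE ji.
      by rewrite big1// => k _; rewrite liftK ji !mul0r.
    have cii : 0 <= c (l i) (l i) by have := H 0; rewrite mulr0 mul0r add0r.
    set x := c (l i) ord0 in H *; set y := c (l i) (l i) in H cii.
    split; rewrite leNgt; apply/negP => x0.
      (* [H] says that an affine function of [t] with slope [2 * x] is nonnegative on the whole
         line. At this point its value would be - 1, so [x] is 0. *)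
      have := H (- (y + 1) / (2 * x)).
      have -> : 2 * (- (y + 1) / (2 * x)) * x = - (y + 1) by field; lra.
      lra.
    have := H (- (y + 1) / (2 * x)).
    have -> : 2 * (- (y + 1) / (2 * x)) * x = - (y + 1) by field; lra.
    lra.
  have [|A HA] := IH (fun i j => c (l i) (l j)).
    split=> [i j|a]; first exact: cs.
    have := cp (fun j => if unlift ord0 j is Some k then a k else 0).
    rewrite psd_split//= ?unlift_none c0 !mulr0 mul0r !add0r.
    by under eq_bigr do under eq_bigr do rewrite !liftK.
  exists (fun i k => if unlift ord0 i is Some i' then
    if unlift ord0 k is Some k' then A i' k' else 0 else 0) => i j.
  rewrite big_ord_recl/= ?unlift_none.
  case: (unliftP ord0 i) => [i'|] ->; last first.
    rewrite ?unlift_none mul0r add0r big1; last by move=> k _; rewrite mul0r.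
    by case: (unliftP ord0 j) => [j'|] -> //; rewrite cs ci0.
  rewrite ?liftK mul0r add0r; case: (unliftP ord0 j) => [j'|] ->.
    by rewrite HA; apply: eq_bigr => k _; rewrite ?liftK.
  by rewrite ci0 big1// => k _; rewrite ?unlift_none mulr0.
have {}c00 : 0 < c ord0 ord0 by rewrite lt_neqAle eq_sym c0.
pose s := Num.sqrt (c ord0 ord0); have s0 : 0 < s by rewrite sqrtr_gt0.
have s2 : s ^+ 2 = c ord0 ord0 by rewrite sqr_sqrtr// ltW.
pose c' i j := c (l i) (l j) - c (l i) ord0 * c (l j) ord0 / s ^+ 2.
have [|A HA] := IH c'.
  split=> [i j|a]; first by rewrite /c' cs mulrC [c (l j) _ * _]mulrC mulrC.
  pose t := \sum_i a i * c (l i) ord0.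
  (* This corner coordinate minimizes the quadratic form for given other coordinates; the minimum is
     the form of the Schur complement. *)
  have := cp (fun j => if unlift ord0 j is Some k then a k else - t / s ^+ 2).
  rewrite psd_split//= ?unlift_none -s2.
  under eq_bigr do rewrite ?liftK.
  under [X in _ <= _ + X -> _]eq_bigr do under eq_bigr do rewrite ?liftK.
  rewrite -/(l _) -/t => h.
  have E : \sum_i \sum_j a i * a j * c' i j =
      \sum_i \sum_j a i * a j * c (l i) (l j) - t * t / s ^+ 2.
    rewrite {1}/t mulr_suml mulr_suml -sumrB; apply: eq_bigr => i _.
    rewrite /t mulr_sumr mulr_suml -sumrB; apply: eq_bigr => j _.
    by rewrite /c'; ring.
  rewrite E; apply: le_trans h _; rewrite le_eqVlt; apply/orP; left; apply/eqP.
  rewrite addrC; congr (_ + _); field.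
  by rewrite gt_eqF.
exists (fun i k => if unlift ord0 i is Some i' then
    if unlift ord0 k is Some k' then A i' k' else c (l i') ord0 / s
    else if unlift ord0 k is Some k' then 0 else s) => i j.
rewrite big_ord_recl/= ?unlift_none.
case: (unliftP ord0 i) => [i'|] ->; last first.
  rewrite ?unlift_none big1; last by move=> k _; rewrite ?liftK mul0r.
  rewrite addr0; case: (unliftP ord0 j) => [j'|] ->; last by rewrite ?unlift_none -?expr2 s2.
  by rewrite ?liftK cs mulrCA divff ?mulr1// gt_eqF.
rewrite ?liftK; case: (unliftP ord0 j) => [j'|] ->; last first.
  rewrite ?unlift_none divfK ?gt_eqF// big1 ?addr0// => k _.
  by rewrite ?liftK mulr0.
rewrite ?liftK; have := HA i' j'; rewrite /c' => /eqP; rewrite subr_eq => /eqP ->.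
rewrite addrC; congr (_ + _); last by apply: eq_bigr => k _; rewrite ?liftK.
by field; rewrite gt_eqF.
Qed.

End PsdFactorization.

(** * Independent normal variables and tensorization of the Poincare inequality *)

Section GaussSpace.
Context (R : realType).

Definition upd n (y : 'I_n -> R) (i : 'I_n) (t : R) : 'I_n -> R :=
  fun j => if j == i then t else y j.

Definition fcons n (x : R) (y : 'I_n -> R) : 'I_n.+1 -> R :=
  fun i => if unlift ord0 i is Some j then y j else x.

Lemma upd_fcons0 n x (y : 'I_n -> R) t : upd (fcons x y) ord0 t = fcons t y.
Proof.
apply/funext => i; rewrite /upd /fcons.
by case: (unliftP ord0 i) => [j ->|->]; rewrite ?eqxx// ?liftK ?unlift_none.
Qed.

Lemma upd_fconsS n x (y : 'I_n -> R) i t :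
  upd (fcons x y) (lift ord0 i) t = fcons x (upd y i t).
Proof.
apply/funext => j; rewrite /upd /fcons.
case: (unliftP ord0 j) => [k ->|->]; rewrite ?liftK ?unlift_none//.
Qed.

Definition coordinate_C1 n (psi : ('I_n -> R) -> R)
    (dpsi : 'I_n -> ('I_n -> R) -> R) : Prop :=
  forall i y, der (fun t => psi (upd y i t)) (fun t => dpsi i (upd y i t)) /\
    continuous (fun t => dpsi i (upd y i t)).

(** Independence and standard normality are expressed together by the characteristic function, the
    form in which linear images are compared with a Gaussian family. *)
Definition iid_normal d (S : measurableType d) (nu : probability S R) n
    (z : 'I_n -> S -> R) : Prop :=
  (forall i, measurable_fun setT (z i)) /\
  forall a b, Exp nu (trig z a b) = expR (- ((\sum_i a i ^+ 2) / 2)) * cos b.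

(** The inequality is a property of a space with coordinates, so that it can be carried from [n] to
    [n.+1] coordinates by induction. The constant is that of one variable, for every [n]. *)
Definition poincare_space d (S : measurableType d) (nu : probability S R) n
    (z : 'I_n -> S -> R) : Prop :=
  forall (psi : ('I_n -> R) -> R) (dpsi : 'I_n -> ('I_n -> R) -> R),
    coordinate_C1 psi dpsi ->
    measurable_fun setT (fun s => psi (z ^~ s)) ->
    (forall i, measurable_fun setT (fun s => dpsi i (z ^~ s))) ->
    intg nu (fun s => psi (z ^~ s) ^+ 2) ->
    (forall i, intg nu (fun s => dpsi i (z ^~ s) ^+ 2)) ->
    Exp nu (fun s => psi (z ^~ s) ^+ 2) - Exp nu (fun s => psi (z ^~ s)) ^+ 2 <=
    32 * \sum_i Exp nu (fun s => dpsi i (z ^~ s) ^+ 2).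

Section Extend.
Context d (S : measurableType d) (nu : probability S R) n (z : 'I_n -> S -> R).
Hypotheses (iid : iid_normal nu z) (poin : poincare_space nu z).

Let z' (i : 'I_n.+1) (s : S * measurableTypeR R) : R := fcons s.2 (z ^~ s.1) i.
Let nu' := prodP nu (gauss R).

Let mz' i : measurable_fun setT (z' i).
Proof.
rewrite /z' /fcons; case: (unliftP ord0 i) => [j _|_]; last exact: measurable_snd.
by apply: (measurableT_comp (iid.1 j)); exact: measurable_fst.
Qed.

Lemma iid_extend : iid_normal nu' z'.
Proof.
have [mz tz] := iid.
split=> [|a b]; first exact: mz'.
have it : intg nu' (trig z' a b).
  by apply: intg_bounded1; [exact: measurable_trig|exact: trig_le1].
have [_ -> _] := prodP_Exp it.
have E s : Exp (gauss R) (fun x => trig z' a b (s, x)) =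
    expR (- (a ord0 ^+ 2 / 2)) * trig z (fun i => a (lift ord0 i)) b s.
  rewrite -gauss_cos; congr Exp; apply/funext => x; rewrite /trig big_ord_recl.
  rewrite -addrA /z' /fcons/= ?unlift_none; congr (cos (_ + (_ + _))).
  by apply: eq_bigr => i _; rewrite ?liftK.
rewrite (funext E) ExpZ; last first.
  by apply: intg_bounded1; [exact: measurable_trig|exact: trig_le1].
rewrite tz mulrA -expRD big_ord_recl; congr (expR _ * _); lra.
Qed.

(** [efron_stein2] splits the variance into two parts. In the new coordinate the one-dimensional
    inequality applies, in the old ones, with x frozen, the induction hypothesis. The parts are
    added, so the constant does not grow. *)
Lemma poincare_extend : poincare_space nu' z'.
Proof.
have [mz _] := iid.
move=> psi dpsi c1 mpsi mdpsi ipsi idpsi.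
have [j1 j2 ES] := efron_stein2 mpsi ipsi.
apply: le_trans ES _.
rewrite big_ord_recl mulrDr; apply: lerD.
  have [k0 E0 a0] := prodP_Exp (idpsi ord0).
  rewrite E0 -ExpZ//; apply: le_Exp_ae => //; first exact: intgZ.
  apply: filterS a0 => s i0.
  pose h t := psi (fcons t (z ^~ s)); pose dh t := dpsi ord0 (fcons t (z ^~ s)).
  have [hd hc] := c1 ord0 (fcons 0 (z ^~ s)).
  have hE : (fun t => psi (upd (fcons 0 (z ^~ s)) ord0 t)) = h.
    by apply/funext => t; rewrite upd_fcons0.
  have dhE : (fun t => dpsi ord0 (upd (fcons 0 (z ^~ s)) ord0 t)) = dh.
    by apply/funext => t; rewrite upd_fcons0.
  rewrite hE dhE in hd; rewrite dhE in hc.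
  by have [_ _] := gauss_poincare hd hc i0.
have sw i := prodP_Exp_swap (idpsi (lift ord0 i)).
have sE i : Exp nu' (fun s => dpsi (lift ord0 i) (z' ^~ s) ^+ 2) =
    Exp (gauss R) (fun x => Exp nu (fun s => dpsi (lift ord0 i) (z' ^~ (s, x)) ^+ 2)).
  by case: (sw i).
under eq_bigr do rewrite sE.
have iw i : intg (gauss R) (fun x => Exp nu (fun s => dpsi (lift ord0 i) (z' ^~ (s, x)) ^+ 2)).
  by case: (sw i).
rewrite -Exp_sum// -ExpZ; last exact: intg_sum.
apply: le_Exp_ae => //; first by apply: intgZ; exact: intg_sum.
have aw : {ae gauss R, forall x, forall i : 'I_n,
    intg nu (fun s => dpsi (lift ord0 i) (z' ^~ (s, x)) ^+ 2)}.
  by apply: filter_forall => i; case: (sw i).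
have [_ _ a2] := prodP_Exp_swap ipsi.
apply: filterS2 aw a2 => x ix ipx.
have mp : measurable_fun setT (fun s : S => (s, x : measurableTypeR R)).
  exact: pair2_measurable.
apply: (poin (psi := fun y => psi (fcons x y))
  (dpsi := fun i y => dpsi (lift ord0 i) (fcons x y))) => //.
- move=> i y; have := c1 (lift ord0 i) (fcons x y).
  have E1 : (fun t => psi (upd (fcons x y) (lift ord0 i) t)) =
      (fun t => psi (fcons x (upd y i t))).
    by apply/funext => t; rewrite upd_fconsS.
  have E2 : (fun t => dpsi (lift ord0 i) (upd (fcons x y) (lift ord0 i) t)) =
      (fun t => dpsi (lift ord0 i) (fcons x (upd y i t))).
    by apply/funext => t; rewrite upd_fconsS.
  by rewrite E1 E2.
- exact: (measurableT_comp mpsi mp).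
- by move=> i; exact: (measurableT_comp (mdpsi (lift ord0 i)) mp).
Qed.

End Extend.

Lemma gauss_space n : exists d (S : measurableType d) (nu : probability S R)
  (z : 'I_n -> S -> R), iid_normal nu z /\ poincare_space nu z.
Proof.
elim: n => [|n [d [S [nu [z [iid poin]]]]]]; last first.
  by do 4 eexists; split; [exact: (iid_extend iid)|exact: (poincare_extend iid poin)].
(* Without coordinates every function of the vector is constant, so any probability space serves as
   the base case. *)
exists _, _, (gauss R), (fun _ _ => 0); split.
  split=> [|a b]; first by case.
  rewrite big_ord0 mul0r oppr0 expR0 mul1r -(Exp_cst (gauss R) (cos b)).
  by congr Exp; apply/funext => s; rewrite /trig big_ord0 add0r.
move=> psi dpsi _ _ _ _ _; rewrite big_ord0 mulr0.
rewrite (Exp_cst (gauss R) (psi (fun=> 0) ^+ 2)) (Exp_cst (gauss R) (psi (fun=> 0))).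
by rewrite subrr.
Qed.

Section FamilyPoincare.
Context d (T : measurableType d) (P : probability T R) (n : nat).
Variables (X : 'I_n -> T -> R) (c : 'I_n -> 'I_n -> R).
Hypotheses (cpsd : psd c) (fam : gauss_fam P X c).
Variables (W : ('I_n -> R) -> R) (dW : 'I_n -> ('I_n -> R) -> R).
Hypotheses
  (Wd : forall y v, der (fun t => W (fun j => y j + t * v j))
     (fun t => \sum_j v j * dW j (fun j => y j + t * v j)))
  (dWc : forall y v : 'I_n -> R, continuous (fun t : R => \sum_j v j * dW j (fun j => y j + t * v j)))
  (mW : measurable_fun setT (fun t : n.-tuple R => W (tnth t)))
  (mdW : forall i, measurable_fun setT (fun t : n.-tuple R => dW i (tnth t)))
  (iW : intg P (fun w => W (X ^~ w) ^+ 2))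
  (idW : forall i, intg P (fun w => dW i (X ^~ w) ^+ 2)).

Let tnth_joint e (U : measurableType e) (Z : 'I_n -> U -> R) w :
  tnth (joint Z w) = Z ^~ w.
Proof. by apply/funext => i; rewrite tnth_mktuple. Qed.

(** The law is realized as A z with independent normal z, where c is A times its transpose. The
    squared gradient of y |-> W(A y) is the sum over k of (sum_i A i k dW i)^2, that is, the
    quadratic form of [c] at the gradient of [W]. *)
Lemma family_poincare :
  Exp P (fun w => W (X ^~ w) ^+ 2) - Exp P (fun w => W (X ^~ w)) ^+ 2 <=
  32 * Exp P (fun w => \sum_i \sum_j c i j * (dW i (X ^~ w) * dW j (X ^~ w))).
Proof.
have [A cA] := psd_factor cpsd.
have [e [S [nu [z [[mz tz] poin]]]]] := gauss_space n.
pose Z i s := \sum_k A i k * z k s.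
have mZ i : measurable_fun setT (Z i) by exact: measurable_lin.
have fZ : gauss_fam nu Z c.
  split=> // a b.
  have -> : trig Z a b = trig z (fun k => \sum_i a i * A i k) b.
    apply/funext => s; rewrite /trig; congr (cos (_ + _)).
    under [RHS]eq_bigr do rewrite mulr_suml.
    rewrite exchange_big/=; apply: eq_bigr => i _.
    by rewrite /Z mulr_sumr; apply: eq_bigr => k _; rewrite mulrA.
  rewrite tz; congr (expR (- (_ / 2)) * _).
  under eq_bigr do rewrite expr2 mulr_suml.
  rewrite exchange_big/=; apply: eq_bigr => i _.
  under eq_bigr do rewrite mulr_sumr.
  rewrite exchange_big/=; apply: eq_bigr => j _.
  by rewrite cA mulr_sumr; apply: eq_bigr => k _; ring.
have tr (h : ('I_n -> R) -> R) : measurable_fun setT (fun t : n.-tuple R => h (tnth t)) ->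
    (intg P (fun w => h (X ^~ w)) -> intg nu (fun s => h (Z ^~ s))) /\
    Exp P (fun w => h (X ^~ w)) = Exp nu (fun s => h (Z ^~ s)).
  move=> mh; have := fam_intg fam fZ mh; have := fam_Exp fam fZ mh.
  have E1 : (fun w => h (tnth (joint X w))) = fun w => h (X ^~ w).
    by apply/funext => w; rewrite tnth_joint.
  have E2 : (fun w => h (tnth (joint Z w))) = fun w => h (Z ^~ w).
    by apply/funext => w; rewrite tnth_joint.
  by rewrite E1 E2.
have [jW EW2] := tr (fun y => W y ^+ 2) (measurable_funX 2 mW).
have [_ EW] := tr W mW.
have mq : measurable_fun setT (fun t : n.-tuple R =>
    \sum_i \sum_j c i j * (dW i (tnth t) * dW j (tnth t))).
  apply: measurable_sum => i; apply: measurable_sum => j.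
  apply: measurable_funM; first exact: measurable_cst.
  exact: measurable_funM.
have [_ EQ] := tr (fun y => \sum_i \sum_j c i j * (dW i y * dW j y)) mq.
rewrite EW2 EW EQ.
pose B (y : 'I_n -> R) : 'I_n -> R := fun i => \sum_k A i k * y k.
pose psi y := W (B y); pose dpsi k y := \sum_i A i k * dW i (B y).
(* A change of the k-th coordinate moves the image along the k-th column of [A]; hence the
   hypotheses on [W] concern arbitrary lines, and not only those parallel to the axes. *)
have BE y k t : B (upd y k t) = fun i => B (upd y k 0) i + t * A i k.
  apply/funext => i; rewrite /B (bigD1 k)//= [X in _ = X + _](bigD1 k)//=.
  rewrite /upd eqxx mulr0 add0r addrC [t * _]mulrC; congr (_ + _).
  by apply: eq_bigr => j /negbTE ->.
have C1 : coordinate_C1 psi dpsi.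
  move=> k y; rewrite /psi /dpsi.
  have E1 : (fun t => W (B (upd y k t))) =
      fun t => W (fun i => B (upd y k 0) i + t * A i k).
    by apply/funext => t; rewrite BE.
  have E2 : (fun t => \sum_i A i k * dW i (B (upd y k t))) =
      fun t => \sum_i A i k * dW i (fun i => B (upd y k 0) i + t * A i k).
    by apply/funext => t; rewrite BE.
  by rewrite E1 E2; split; [exact: Wd|exact: dWc].
have mJ := measurable_joint mZ.
have mcomp (h : ('I_n -> R) -> R) : measurable_fun setT (fun t : n.-tuple R => h (tnth t)) ->
    measurable_fun setT (fun s => h (Z ^~ s)).
  move=> mh; have := measurableT_comp mh mJ; congr measurable_fun.
  by apply/funext => s; rewrite /= tnth_joint.
have mpsi : measurable_fun setT (fun s => psi (z ^~ s)) by exact: (mcomp W).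
have md k : measurable_fun setT (fun s => dpsi k (z ^~ s)).
  apply: measurable_sum => i; apply: measurable_funM; first exact: measurable_cst.
  exact: (mcomp (dW i)).
have jdW i : intg nu (fun s => dW i (Z ^~ s) ^+ 2).
  exact: (tr (fun y => dW i y ^+ 2) (measurable_funX 2 (mdW i))).1.
have jdWW i j : intg nu (fun s => dW i (Z ^~ s) * dW j (Z ^~ s)).
  apply: (intg_le _ _ (intgD (jdW i) (jdW j))) => [|s].
    by apply: measurable_funM; exact: (mcomp (dW _)).
  rewrite normrM -[dW i _ ^+ 2]real_normK ?num_real// -[dW j _ ^+ 2]real_normK ?num_real//.
  have := normr_ge0 (dW i (Z ^~ s)); have := normr_ge0 (dW j (Z ^~ s)).
  by have := sqr_ge0 (`|dW i (Z ^~ s)| - `|dW j (Z ^~ s)|); nra.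
have dpsi2 k s : dpsi k (z ^~ s) ^+ 2 =
    \sum_i \sum_j A i k * A j k * (dW i (Z ^~ s) * dW j (Z ^~ s)).
  rewrite expr2 /dpsi mulr_suml; apply: eq_bigr => i _.
  by rewrite mulr_sumr; apply: eq_bigr => j _; rewrite /B /Z; ring.
have idp k : intg nu (fun s => dpsi k (z ^~ s) ^+ 2).
  rewrite (funext (dpsi2 k)); apply: intg_sum => i; apply: intg_sum => j.
  exact: intgZ.
have := poin psi dpsi C1 mpsi md (jW iW) idp.
move=> /le_trans; apply; rewrite ler_pM2l// -Exp_sum//.
rewrite le_eqVlt; apply/orP; left; apply/eqP; congr Exp; apply/funext => s.
under eq_bigr do rewrite dpsi2.
rewrite exchange_big/=; apply: eq_bigr => i _.
rewrite exchange_big/=; apply: eq_bigr => j _.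
by rewrite cA mulr_suml.
Qed.

End FamilyPoincare.

End GaussSpace.

(** * Total variation *)

Section TotalVariation.
Context (R : realType) d (T : measurableType d) (P : probability T R)
  d' (T' : measurableType d') (Q : probability T' R) (U : T -> R) (V : T' -> R).
Hypotheses (mU : measurable_fun setT U) (mV : measurable_fun setT V).

Let unit_fun (q : R -> R) := measurable_fun setT q /\ forall x, 0 <= q x <= 1.

Let unit_intg d0 (T0 : measurableType d0) (P0 : probability T0 R) (U0 : T0 -> R) q :
  measurable_fun setT U0 -> unit_fun q -> intg P0 (fun w => q (U0 w)).
Proof.
move=> mU0 [mq q01]; apply: (intg_le _ _ (intg_cst P0 1)) => [|w].
  exact: measurableT_comp.
by have /andP[q0 q1] := q01 (U0 w); rewrite ger0_norm.
Qed.

Let unit_dist d0 (T0 : measurableType d0) (P0 : probability T0 R) (U0 : T0 -> R) q r :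
  measurable_fun setT U0 -> unit_fun q -> unit_fun r ->
  intg P0 (fun w => `|q (U0 w) - r (U0 w)|).
Proof. by move=> mU0 uq ur; apply/intg_norm/intgB; exact: unit_intg. Qed.

Let L1 (q r : R -> R) : R := Exp P (fun w => `|q (U w) - r (U w)|) +
              Exp Q (fun w => `|q (V w) - r (V w)|).

(** [L1] adds the distances under both laws, so one continuous function serves for both. The class
    has the closure properties required by [kset_borel] and therefore contains all Borel indicators;
    this takes the place of the regularity of measures. *)
Let approx (q : R -> R) : Prop := unit_fun q /\ forall e, 0 < e ->
  exists h, [/\ continuous h, unit_fun h & L1 q h <= e].

Let L1_triangle q r q1 r1 q2 r2 : unit_fun q -> unit_fun r -> unit_fun q1 ->
  unit_fun r1 -> unit_fun q2 -> unit_fun r2 ->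
  (forall x, `|q x - r x| <= `|q1 x - r1 x| + `|q2 x - r2 x|) ->
  L1 q r <= L1 q1 r1 + L1 q2 r2.
Proof.
move=> uq ur uq1 ur1 uq2 ur2 H.
have i1 := unit_dist P mU uq1 ur1; have i2 := unit_dist P mU uq2 ur2.
have j1 := unit_dist Q mV uq1 ur1; have j2 := unit_dist Q mV uq2 ur2.
rewrite /L1 addrACA -(ExpD i1 i2) -(ExpD j1 j2).
by rewrite lerD// le_Exp//; first [exact: unit_dist|exact: intgD].
Qed.

Let unitM q r : unit_fun q -> unit_fun r -> unit_fun (fun x => q x * r x).
Proof.
move=> [mq q01] [mr r01]; split=> [|x]; first exact: measurable_funM.
by have /andP[q0 q1] := q01 x; have /andP[r0 r1] := r01 x;
  rewrite mulr_ge0//= mulr_ile1.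
Qed.

Let unitC q : unit_fun q -> unit_fun (fun x => 1 - q x).
Proof.
move=> [mq q01]; split=> [|x]; last by have := q01 x; lra.
by apply: measurable_funB => //; exact: measurable_cst.
Qed.

Let approx_cont h : continuous h -> unit_fun h -> approx h.
Proof.
move=> hc uh; split=> // e e0; exists h; split=> //.
rewrite /L1 (_ : (fun w => `|h (U w) - h (U w)|) = fun=> 0); last first.
  by apply/funext => w; rewrite subrr normr0.
rewrite (_ : (fun w => `|h (V w) - h (V w)|) = fun=> 0); last first.
  by apply/funext => w; rewrite subrr normr0.
by rewrite !Exp0 addr0 ltW.
Qed.

Let approx1 : approx (fun=> 1).
Proof.
apply: approx_cont; first by move=> x; exact: cvg_cst.
by split=> [|x]; [exact: measurable_cst|rewrite ler01 lexx].
Qed.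

Let approxM q r : approx q -> approx r -> approx (fun x => q x * r x).
Proof.
move=> [uq aq] [ur ar]; split; first exact: unitM.
move=> e e0; have e2 : 0 < e / 2 by rewrite divr_gt0.
have [h [hc uh he]] := aq _ e2; have [k [kc uk ke]] := ar _ e2.
exists (fun x => h x * k x); split; [exact: continuous_mul|exact: unitM|].
apply: le_trans (_ : L1 q h + L1 r k <= _); last by lra.
apply: L1_triangle => //; try exact: unitM.
move=> x; have -> : q x * r x - h x * k x = (q x - h x) * r x + h x * (r x - k x).
  by ring.
apply: (le_trans (ler_normD _ _)); rewrite lerD// normrM.
  by rewrite ler_piMr//; case: ur => _ /(_ x) /andP[? ?]; rewrite ger0_norm.
by rewrite ler_piMl//; case: uh => _ /(_ x) /andP[? ?]; rewrite ger0_norm.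
Qed.

Let approxC q : approx q -> approx (fun x => 1 - q x).
Proof.
move=> [uq aq]; split; first exact: unitC.
move=> e /aq[h [hc uh he]]; exists (fun x => 1 - h x); split; last 1 first.
- have E x : `|1 - q x - (1 - h x)| = `|q x - h x|.
    by rewrite -normrN; congr `|_|; ring.
  suff -> : L1 (fun x => 1 - q x) (fun x => 1 - h x) = L1 q h by [].
  rewrite /L1 (_ : (fun w => _) = (fun w => `|q (U w) - h (U w)|)); last exact/funext.
  by congr (_ + _); congr Exp; apply/funext.
- by apply: continuous_sub => //; exact: continuous_const.
- exact: unitC.
Qed.

Let approx_cvg (q : nat -> R -> R) r : (forall k, approx (q k)) ->
  (forall x, q k x @[k --> \oo] --> r x) -> approx r.
Proof.
move=> aq qr.
have ur : unit_fun r.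
  split=> [|x].
    by apply: (@measurable_fun_cvg _ _ _ _ q) => // k; case: (aq k) => -[].
  have cvq : cvgn (q ^~ x) by apply/cvg_ex; exists (r x); exact: qr.
  have -> : r x = limn (q ^~ x) by apply/esym/cvg_lim => //; exact: qr.
  by apply/andP; split; [apply: limr_ge|apply: limr_le] => //; apply: nearW => k;
    case: (aq k) => -[_ /(_ x) /andP[]].
split=> // e e0; have e3 : 0 < e / 3 by rewrite divr_gt0.
have H d0 (T0 : measurableType d0) (P0 : probability T0 R) (U0 : T0 -> R) :
    measurable_fun setT U0 ->
    \forall k \near \oo, Exp P0 (fun w => `|r (U0 w) - q k (U0 w)|) <= e / 3.
  move=> mU0.
  have [||||_ H] := @Exp_dct _ _ _ P0 (fun k w => `|r (U0 w) - q k (U0 w)|)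
      (fun=> 0) (fun=> 1).
  - move=> k; apply: intg_measurable; apply: unit_dist => //.
    by case: (aq k).
  - move=> w; rewrite -(@normr0 _ R) -(subrr (r (U0 w))).
    by apply: cvg_norm; apply: cvgB; [exact: cvg_cst|exact: qr].
  - move=> k w; rewrite normr_id ler_norml.
    by case: (aq k) => -[_ /(_ (U0 w)) + _]; case: ur => _ /(_ (U0 w)); lra.
  - exact: intg_cst.
  by apply: cvgr_le H _ _; rewrite Exp0.
have [k [kP kQ]] : exists k, Exp P (fun w => `|r (U w) - q k (U w)|) <= e / 3 /\
    Exp Q (fun w => `|r (V w) - q k (V w)|) <= e / 3.
  by have [k []] := filter_ex (filterI (H _ _ P U mU) (H _ _ Q V mV)); exists k.
have [uq /(_ _ e3)[h [hc uh he]]] := aq k.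
exists h; split=> //.
apply: le_trans (_ : L1 r (q k) + L1 (q k) h <= _); last first.
  by apply: le_trans (lerD (lerD kP kQ) he) _; lra.
by apply: L1_triangle => // x; exact: ler_distD.
Qed.

(** Truncation to the unit interval, in a form that is visibly continuous. Composed with steep
    affine maps it gives ramps converging to the indicator of a ray. *)
Let clamp (y : R) : R := (`|y| - `|y - 1| + 1) / 2.

Let clampE y : clamp y = if y <= 0 then 0 else if 1 <= y then 1 else y.
Proof.
rewrite /clamp; case: ifPn => [y0|/negP y0]; first by rewrite !ler0_norm; lra.
case: ifPn => [y1|/negP y1]; first by rewrite !ger0_norm; lra.
by rewrite ger0_norm ?ler0_norm; lra.
Qed.

Let approx_ray c : approx (fun x => (c <= x)%R%:R).
Proof.
apply: (@approx_cvg (fun k x => clamp (1 + k%:R * (x - c)))) => [k|x].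
  have rc : continuous (fun x : R => clamp (1 + k%:R * (x - c))).
    have lc : continuous (fun x : R => 1 + k%:R * (x - c)).
      apply: continuous_add; first exact: continuous_const.
      apply: continuous_mul; first exact: continuous_const.
      by apply: continuous_sub; [exact: continuous_idfun|exact: continuous_const].
    apply: continuous_mul; last exact: continuous_const.
    apply: continuous_add; last exact: continuous_const.
    apply: continuous_sub; apply: continuous_normr => //.
    by apply: continuous_sub => //; exact: continuous_const.
  apply: approx_cont => //; split=> [|x]; first exact: continuous_meas.
  by rewrite clampE; case: ifPn => [|/negP h0]; [lra|case: ifPn => [|/negP]; lra].
apply: cvg_near_cst; case: (leP c x) => cx.
  apply: nearW => k; apply/eqP; rewrite clampE.
  have h : 0 <= k%:R * (x - c) by rewrite mulr_ge0// subr_ge0.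
  by case: ifPn => [|_]; [lra|rewrite ifT//; lra].
near=> k; apply/eqP; rewrite clampE ifT//.
have : 1 / (c - x) <= k%:R by near: k; exact: nbhs_infty_ger.
rewrite ler_pdivrMr ?subr_gt0// => h.
have -> : k%:R * (x - c) = - (k%:R * (c - x)) by ring.
by rewrite subr_le0.
Unshelve. all: by end_near. Qed.

Lemma tv_le_continuous (e : R) :
  (forall h : R -> R, continuous h -> (forall x, 0 <= h x <= 1) ->
    `|Exp P (fun w => h (U w)) - Exp Q (fun w => h (V w))| <= e) ->
  forall A : set R, measurable A ->
  (`|P (U @^-1` A) - Q (V @^-1` A)| <= e%:E)%E.
Proof.
move=> he A mA.
have EA d0 (T0 : measurableType d0) (P0 : probability T0 R) (U0 : T0 -> R) :
    measurable_fun setT U0 ->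
    P0 (U0 @^-1` A) = (Exp P0 (fun w => (U0 w \in A)%:R))%:E.
  move=> mU0; have mE : measurable (U0 @^-1` A) by rewrite -[_ @^-1` _]setTI; exact: mU0.
  have E : (fun w => (U0 w \in A)%:R) = \1_(U0 @^-1` A) :> (T0 -> R).
    by apply/funext => w; rewrite indicE.
  rewrite E -ExpE; last first.
    apply: (@intg_le _ _ _ _ _ (fun=> 1)); last exact: intg_cst.
      exact: measurable_indic.
    by move=> w; rewrite indicE normr_nat lern1 leq_b1.
  by rewrite integral_indic// setIT.
rewrite (EA _ _ P U mU) (EA _ _ Q V mV) -EFinB abse_EFin lee_fin.
have [uA aA] : approx (fun x => (x \in A)%:R).
  exact: (@kset_borel R R approx approx1 approxM approxC approx_cvg id A approx_ray mA).
apply/ler_addgt0Pr => t /aA[h [hc uh ht]].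
have iq := unit_intg P mU uA; have ih := unit_intg P mU uh.
have jq := unit_intg Q mV uA; have jh := unit_intg Q mV uh.
have -> : Exp P (fun w => (U w \in A)%:R) - Exp Q (fun w => (V w \in A)%:R) =
    (Exp P (fun w => h (U w)) - Exp Q (fun w => h (V w))) +
    (Exp P (fun w => (U w \in A)%:R - h (U w)) -
     Exp Q (fun w => (V w \in A)%:R - h (V w))).
  by rewrite !ExpB//; ring.
apply: (le_trans (ler_normD _ _)); apply: lerD; first by apply: he => //; case: uh.
apply: (le_trans (ler_normB _ _)); apply: le_trans ht.
by apply: lerD; apply: le_norm_Exp; exact: intgB.
Qed.

End TotalVariation.

(** * The Stein bound *)

Section ScaledSine.
Context (R : realType).

(** Both facts needed about M sin (x / M) follow: it is at most |x| in absolute value, and it tends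
    to x. *)
Lemma sin_mvt (y : R) : exists2 z, `|z| <= `|y| & sin y = cos z * y.
Proof.
wlog y0 : y / 0 <= y.
  move=> H; have [|y0] := leP 0 y; first exact: H.
  have [|z zy e] := H (- y); first by rewrite oppr_ge0 ltW.
  by exists z; rewrite ?normrN// in zy *; apply: oppr_inj; rewrite -sinN e mulrN.
have [|z] := @MVT_segment R sin cos 0 y y0 (fun x _ => is_derive_sin x).
  by apply: continuous_subspaceT => x; exact: continuous_sin.
rewrite in_itv/= sin0 !subr0 => /andP[z0 zy] e.
by exists z => //; rewrite !ger0_norm.
Qed.

Lemma scaled_sin_le (k : nat) (x : R) : `|k.+1%:R * sin (k.+1%:R^-1 * x)| <= `|x|.
Proof.
have [z _ ->] := sin_mvt (k.+1%:R^-1 * x).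
by rewrite mulrCA mulVKf ?pnatr_eq0// normrM ler_piMl// cos_max.
Qed.

Lemma scaled_cvg0 (x : R) : k.+1%:R^-1 * x @[k --> \oo] --> (0 : R).
Proof.
rewrite -[X in _ --> X](mul0r x); apply: cvgM; last exact: cvg_cst.
exact: cvg_harmonic.
Qed.

Lemma scaled_sin_cvg (x : R) : k.+1%:R * sin (k.+1%:R^-1 * x) @[k --> \oo] --> x.
Proof.
have /choice[z zP] : forall k : nat, exists z : R,
    `|z| <= k.+1%:R^-1 * `|x| /\ k.+1%:R * sin (k.+1%:R^-1 * x) = cos z * x.
  move=> k; have [z zx e] := sin_mvt (k.+1%:R^-1 * x); exists z.
  by rewrite e mulrCA mulVKf ?pnatr_eq0//; move: zx; rewrite normrM gtr0_norm.
have z0 : z k @[k --> \oo] --> (0 : R).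
  apply/norm_cvg0P/(squeeze_cvgr _ (cvg_cst 0) (scaled_cvg0 `|x|)).
  by apply: nearW => k; rewrite normr_ge0; case: (zP k).
rewrite (_ : (fun k => _) = fun k => cos (z k) * x); last first.
  by apply/funext => k; case: (zP k).
rewrite -[X in _ --> X](mul1r x) -(@cos0 R); apply: cvgM; last exact: cvg_cst.
exact: (cvg_comp _ _ z0 (@continuous_cos R 0)).
Qed.

End ScaledSine.

Section StandardNormal.
Context (R : realType) d (T : measurableType d) (P : probability T R) (Y : T -> R).
Hypotheses (mY : measurable_fun setT Y)
  (law : forall A, measurable A -> P (Y @^-1` A) = gauss R A).
Variable q : R -> R.
Hypothesis qc : continuous q.

Let mid : measurable_fun setT (fun x : R => x).
Proof. exact: measurable_id. Qed.

Lemma gauss_law_Exp : Exp P (fun w => q (Y w)) = Exp (gauss R) q.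
Proof.
exact: (@transfer_Exp _ _ _ _ _ _ _ P (gauss R) Y (fun x => x) mY mid law _
  (continuous_meas qc)).
Qed.

Lemma gauss_law_intg : intg P (fun w => q (Y w)) <-> intg (gauss R) q.
Proof.
split.
  exact: (@transfer_intg _ _ _ _ _ _ _ P (gauss R) Y (fun x => x) mY mid law _
    (continuous_meas qc)).
have law' A : measurable A -> gauss R ((fun x => x) @^-1` A) = P (Y @^-1` A).
  by move=> mA; rewrite law.
exact: (@transfer_intg _ _ _ _ _ _ _ (gauss R) P (fun x => x) Y mid mY law' _
  (continuous_meas qc)).
Qed.

End StandardNormal.

Lemma young4 (R : realType) (a b : R) : `|a * b| <= 1 + (a ^+ 4 + b ^+ 4).
Proof.
have q (x : R) : x ^+ 2 <= (1 + x ^+ 4) / 2.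
  have := sqr_ge0 (x ^+ 2 - 1).
  have -> : (x ^+ 2 - 1) ^+ 2 = x ^+ 4 - 2 * x ^+ 2 + 1 by ring.
  lra.
have := sqr_ge0 (a - b); have := sqr_ge0 (a + b); rewrite sqrrB sqrrD.
have := q a; have := q b; have := expr4_ge0 a; have := expr4_ge0 b.
by rewrite ler_norml; lra.
Qed.

(** * The weight of the integration by parts, its variance and the normal approximation *)

Section SteinBound.
Context (R : realType) d (T : measurableType d) (P : probability T R) (n : nat).
Local Notation gauss := (gauss R).
Variables (X : 'I_n -> T -> R) (c : 'I_n -> 'I_n -> R) (S : R).
Hypotheses (cpsd : psd c) (c1 : forall i, c i i = 1)
  (cS : forall i, \sum_j `|c i j| <= S)
  (fam : gauss_fam P X c)
  (law : forall i A, measurable A -> P (X i @^-1` A) = gauss A).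
Variables (phi dphi ddphi u : R -> R).
Let du x := x * u x - phi x.
Hypotheses (phid : der phi dphi) (dphid : der dphi ddphi)
  (ddphic : continuous ddphi) (ud : der u du)
  (iphi : intg gauss (fun x => phi x ^+ 4))
  (idphi : intg gauss (fun x => dphi x ^+ 4))
  (iddphi : intg gauss (fun x => ddphi x ^+ 4))
  (iu : intg gauss (fun x => u x ^+ 4))
  (idu : intg gauss (fun x => du x ^+ 4)).

Let mX i : measurable_fun setT (X i). Proof. by case: fam. Qed.
Let csym i j : c i j = c j i. Proof. by case: cpsd. Qed.
Let phic := der_continuous phid.
Let dphic := der_continuous dphid.
Let uc := der_continuous ud.
Let duc : continuous du.
Proof.
by apply: continuous_sub => //; apply: continuous_mul => //; exact: continuous_idfun.
Qed.

(* The majorant dominates all the factors at once, so that the square of every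
   partial derivative is controlled by products of four of its values. *)
Definition majorant x := `|u x| + `|du x| + (`|dphi x| + `|ddphi x|).
Local Notation m := majorant.
Definition moment4 := Exp gauss (fun x => m x ^+ 4).

Lemma continuous_majorant : continuous m.
Proof. by apply: continuous_add; apply: continuous_add; exact: continuous_normr. Qed.

Let m_ge0 x : 0 <= m x.
Proof. by rewrite /majorant !addr_ge0. Qed.

Let im : intg gauss (fun x => m x ^+ 4).
Proof.
have D4 (a b : R -> R) : continuous a -> continuous b ->
    intg gauss (fun x => a x ^+ 4) -> intg gauss (fun x => b x ^+ 4) ->
    intg gauss (fun x => (a x + b x) ^+ 4).
  move=> ac bc ia ib; apply: (intg_le _ _ (intgD (intgZ 8 ia) (intgZ 8 ib))) => [|x].
    by apply: continuous_meas; apply: continuous_exp; exact: continuous_add.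
  rewrite ger0_norm ?expr4_ge0//; have := expr4_sub (a x) (- b x).
  by rewrite opprK expr4N.
have N4 (a : R -> R) : intg gauss (fun x => a x ^+ 4) ->
    intg gauss (fun x => `|a x| ^+ 4).
  by congr intg; apply/funext => x; rewrite -normrX ger0_norm ?expr4_ge0.
by apply: (D4); [apply: continuous_add; exact: continuous_normr..|
  apply: (D4); by [exact: continuous_normr|exact: N4]|
  apply: (D4); by [exact: continuous_normr|exact: N4]].
Qed.

Let mm i (w : T) := m (X i w).

Let im4 i : intg P (fun w => mm i w ^+ 4).
Proof.
exact: (gauss_law_intg (mX i) (law i) (continuous_exp continuous_majorant)).2 im.
Qed.

Let Em4 i : Exp P (fun w => mm i w ^+ 4) = moment4.
Proof. exact: (gauss_law_Exp (mX i) (law i) (continuous_exp continuous_majorant)). Qed.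

Let mmm i : measurable_fun setT (mm i).
Proof. exact: measurableT_comp (continuous_meas continuous_majorant) (mX i). Qed.

Let prod4 i j k l w : mm i w * mm k w * (mm j w * mm l w) <=
  4^-1 * (mm i w ^+ 4 + mm j w ^+ 4 + (mm k w ^+ 4 + mm l w ^+ 4)).
Proof.
set a := mm i w; set b := mm k w; set e := mm j w; set f := mm l w.
have h1 : a * b * (e * f) <= ((a * b) ^+ 2 + (e * f) ^+ 2) / 2.
  by have := sqr_ge0 (a * b - e * f); rewrite sqrrB; lra.
have h2 : (a * b) ^+ 2 <= (a ^+ 4 + b ^+ 4) / 2.
  have -> : (a * b) ^+ 2 = a ^+ 2 * b ^+ 2 by ring.
  have := sqr_ge0 (a ^+ 2 - b ^+ 2).
  have -> : (a ^+ 2 - b ^+ 2) ^+ 2 = a ^+ 4 + b ^+ 4 - 2 * (a ^+ 2 * b ^+ 2) by ring.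
  lra.
have h3 : (e * f) ^+ 2 <= (e ^+ 4 + f ^+ 4) / 2.
  have -> : (e * f) ^+ 2 = e ^+ 2 * f ^+ 2 by ring.
  have := sqr_ge0 (e ^+ 2 - f ^+ 2).
  have -> : (e ^+ 2 - f ^+ 2) ^+ 2 = e ^+ 4 + f ^+ 4 - 2 * (e ^+ 2 * f ^+ 2) by ring.
  lra.
lra.
Qed.

Let i4 i j k l : intg P (fun w => mm i w * mm k w * (mm j w * mm l w)).
Proof.
apply: (intg_le _ _ (intgZ 4^-1 (intgD (intgD (im4 i) (im4 j)) (intgD (im4 k) (im4 l)))))
  => [|w].
  by apply: measurable_funM; exact: measurable_funM.
by rewrite ger0_norm ?prod4// !mulr_ge0 ?m_ge0.
Qed.

Let E4 i j k l : Exp P (fun w => mm i w * mm k w * (mm j w * mm l w)) <= moment4.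
Proof.
have iij := intgD (im4 i) (im4 j); have ikl := intgD (im4 k) (im4 l).
apply: le_trans (le_Exp (i4 i j k l) (intgZ 4^-1 (intgD iij ikl)) (prod4 i j k l)) _.
rewrite (ExpZ _ (intgD iij ikl)) (ExpD iij ikl) (ExpD (im4 i) (im4 j)).
by rewrite (ExpD (im4 k) (im4 l)) !Em4; lra.
Qed.

(** A common bound for the i-th row of [weight] and for its i-th partial derivative. Products of two
    such rows contain exactly four values of the majorant. *)
Let rowm i w := \sum_k `|c i k| * (mm i w * mm k w).

Let rowmM i j w : rowm i w * rowm j w =
  \sum_k \sum_l `|c i k| * `|c j l| * (mm i w * mm k w * (mm j w * mm l w)).
Proof.
rewrite /rowm mulr_suml; apply: eq_bigr => k _.
by rewrite mulr_sumr; apply: eq_bigr => l _; ring.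
Qed.

Let irow i j : intg P (fun w => rowm i w * rowm j w).
Proof.
rewrite (funext (rowmM i j)).
by apply: intg_sum => k; apply: intg_sum => l; apply: intgZ.
Qed.

Let moment4_ge0 : 0 <= moment4.
Proof. by apply: Exp_ge0 => x; exact: expr4_ge0. Qed.

Let Erow i j : Exp P (fun w => rowm i w * rowm j w) <= S ^+ 2 * moment4.
Proof.
rewrite (funext (rowmM i j)) Exp_sum; last first.
  by move=> k; apply: intg_sum => l; apply: intgZ.
under eq_bigr => k _.
  rewrite Exp_sum; last by move=> l; apply: intgZ.
  under eq_bigr => l _ do rewrite ExpZ//.
  over.
apply: le_trans (_ : \sum_k \sum_l `|c i k| * `|c j l| * moment4 <= _).
  apply: ler_sum => k _; apply: ler_sum => l _.
  by rewrite ler_wpM2l// mulr_ge0.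
under eq_bigr => k _ do rewrite -mulr_suml -mulr_sumr.
rewrite -mulr_suml -mulr_suml expr2 ler_wpM2r// ler_pM//; exact: sumr_ge0.
Qed.

Let rowm_ge0 i w : 0 <= rowm i w.
Proof. by apply: sumr_ge0 => k _; rewrite !mulr_ge0 ?m_ge0. Qed.

(* The scalar product of the gradient of [fsum] with the field [u (X l) e_l],
   whose divergence is [fsum]. *)
Definition weight (y : 'I_n -> R) : R :=
  \sum_l \sum_k c l k * (u (y l) * dphi (y k)).

(** In [weight] the coordinate [i] occurs once as [l], through [u], and once as [k], through [dphi];
    the symmetry of [c] merges the two resulting sums. *)
Definition dweight (i : 'I_n) (y : 'I_n -> R) : R :=
  \sum_k c i k * (du (y i) * dphi (y k) + u (y k) * ddphi (y i)).

Let weight_le w : `|weight (X ^~ w)| <= \sum_i rowm i w.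
Proof.
apply: (le_trans (ler_norm_sum _ _ _)); apply: ler_sum => l _.
apply: (le_trans (ler_norm_sum _ _ _)); apply: ler_sum => k _.
rewrite normrM ler_wpM2l// normrM ler_pM// /mm /majorant.
  by rewrite -addrA lerDl !addr_ge0.
by rewrite addrCA lerDl !addr_ge0.
Qed.

Let dweight_le i w : `|dweight i (X ^~ w)| <= rowm i w.
Proof.
apply: (le_trans (ler_norm_sum _ _ _)); apply: ler_sum => k _.
rewrite normrM ler_wpM2l// (le_trans (ler_normD _ _))// !normrM /mm /majorant.
set a := `|u (X i w)|; set b := `|du (X i w)|; set e := `|dphi (X i w)|.
set f := `|ddphi (X i w)|; set a' := `|u (X k w)|; set b' := `|du (X k w)|.
set e' := `|dphi (X k w)|; set f' := `|ddphi (X k w)|.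
have [? ? ? ?] : [/\ 0 <= a, 0 <= b, 0 <= e & 0 <= f] by rewrite !normr_ge0.
have [? ? ? ?] : [/\ 0 <= a', 0 <= b', 0 <= e' & 0 <= f'] by rewrite !normr_ge0.
have h : b * e' + a' * f <= (b + f) * (a' + e').
  by rewrite mulrDl !mulrDr [a' * f]mulrC; nra.
by apply: (le_trans h); rewrite ler_pM ?addr_ge0//; lra.
Qed.

Let measurable_at (q : R -> R) i : continuous q ->
  measurable_fun setT (fun t : n.-tuple R => q (tnth t i)).
Proof.
by move=> qc; apply: measurableT_comp (continuous_meas qc) _; exact: measurable_tnth.
Qed.

Let measurable_weight : measurable_fun setT (fun t : n.-tuple R => weight (tnth t)).
Proof.
apply: measurable_sum => l; apply: measurable_sum => k.
apply: measurable_funM; first exact: measurable_cst.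
by apply: measurable_funM; exact: measurable_at.
Qed.

Let measurable_dweight i :
  measurable_fun setT (fun t : n.-tuple R => dweight i (tnth t)).
Proof.
apply: measurable_sum => k; apply: measurable_funM; first exact: measurable_cst.
by apply: measurable_funD; apply: measurable_funM; exact: measurable_at.
Qed.

Let mtuple (W : ('I_n -> R) -> R) :
  measurable_fun setT (fun t : n.-tuple R => W (tnth t)) ->
  measurable_fun setT (fun w => W (X ^~ w)).
Proof.
move=> mW; have := measurableT_comp mW (measurable_joint mX).
congr measurable_fun; apply/funext => w /=; congr W.
by apply/funext => i; rewrite tnth_mktuple.
Qed.

Let measurable_weightX := mtuple measurable_weight.
Let measurable_dweightX i := mtuple (measurable_dweight i).

Lemma intg_weight2 : intg P (fun w => weight (X ^~ w) ^+ 2).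
Proof.
have i2 : intg P (fun w => \sum_i \sum_j rowm i w * rowm j w).
  by apply: intg_sum => i; apply: intg_sum => j.
apply: (intg_le _ _ i2) => [|w]; first exact: measurable_funX.
rewrite normrX (le_trans (lerXn2r 2 _ _ (weight_le w)))// ?nnegrE ?sumr_ge0//.
rewrite expr2 mulr_suml; under eq_bigr => i _ do rewrite mulr_sumr.
by [].
Qed.

Let prod_dweight_le i j w : `|dweight i (X ^~ w) * dweight j (X ^~ w)| <= rowm i w * rowm j w.
Proof. by rewrite normrM ler_pM. Qed.

Let intg_dweight i j : intg P (fun w => dweight i (X ^~ w) * dweight j (X ^~ w)).
Proof.
by apply: (intg_le _ _ (irow i j)) => [|w//]; exact: measurable_funM.
Qed.

Lemma weight_line (y v : 'I_n -> R) :
  der (fun t => weight (fun j => y j + t * v j))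
     (fun t => \sum_j v j * dweight j (fun j => y j + t * v j)).
Proof.
move=> t.
have lin j : is_derive t 1 (fun t : R => y j + t * v j) (v j).
  apply: is_derive_eq (is_derive_add (is_derive_const _ _) (is_derive_mul
    (is_derive_idfun t) (is_derive_const _ _))) _.
  by rewrite add0r mulr0 add0r mulr1.
have E : \sum_j v j * dweight j (fun j => y j + t * v j) =
    \sum_l \sum_k c l k * (v l * du (y l + t * v l) * dphi (y k + t * v k) +
      u (y l + t * v l) * (v k * ddphi (y k + t * v k))).
  transitivity (\sum_l \sum_k (c l k * (v l * du (y l + t * v l) * dphi (y k + t * v k))) +
    \sum_l \sum_k (c l k * (u (y l + t * v l) * (v k * ddphi (y k + t * v k))))); last first.
    rewrite -big_split; apply: eq_bigr => l _ /=; rewrite -big_split.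
    by apply: eq_bigr => k _ /=; ring.
  rewrite [X in _ = _ + X]exchange_big -big_split; apply: eq_bigr => l _ /=.
  rewrite -big_split mulr_sumr; apply: eq_bigr => k _ /=; rewrite (csym k l); ring.
rewrite E; apply: is_derive_bigsum => l; apply: is_derive_bigsum => k.
apply: is_derive_scale; apply: is_derive_eq (is_derive_mul
  (@is_derive_o _ _ _ (fun t => y l + t * v l) _ _ (ud _) (lin l))
  (@is_derive_o _ _ _ (fun t => y k + t * v k) _ _ (dphid _) (lin k))) _.
by ring.
Qed.

Lemma continuous_weight_line (y v : 'I_n -> R) :
  continuous (fun t : R => \sum_j v j * dweight j (fun j => y j + t * v j)).
Proof.
have lin j : continuous (fun t : R => y j + t * v j).
  apply: continuous_add; first exact: continuous_const.
  by apply: continuous_mul; [exact: continuous_idfun|exact: continuous_const].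
apply: continuous_bigsum => j; apply: continuous_mul; first exact: continuous_const.
apply: continuous_bigsum => k; apply: continuous_mul; first exact: continuous_const.
by apply: continuous_add; apply: continuous_mul; exact: continuous_o.
Qed.

(** The Poincare inequality leaves the sum of c i j times the expected product of two partial
    derivatives. Each such expectation costs S^2, one factor per row, and the sum over j costs a
    third S; only the sum over i contributes n, so the bound is linear in n. *)
Lemma variance_weight :
  Exp P (fun w => weight (X ^~ w) ^+ 2) - Exp P (fun w => weight (X ^~ w)) ^+ 2 <=
  32 * (n%:R * (S ^+ 3 * moment4)).
Proof.
have H := family_poincare cpsd fam weight_line continuous_weight_line
  measurable_weight measurable_dweight intg_weight2.
apply: (le_trans (H _)) => [i|].
  by have := intg_dweight i i; congr intg; apply/funext => w; rewrite expr2.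
rewrite ler_pM2l//.
rewrite Exp_sum; last by move=> i; apply: intg_sum => j; exact/intgZ/intg_dweight.
apply: le_trans (_ : \sum_(i < n) S * (S ^+ 2 * moment4) <= _); last first.
  by rewrite sumr_const card_ord -[_ *+ n]mulr_natl [S * _]mulrA -exprS.
apply: ler_sum => i _; rewrite Exp_sum; last by move=> j; exact/intgZ/intg_dweight.
apply: le_trans (_ : \sum_j `|c i j| * (S ^+ 2 * moment4) <= _); last first.
  by rewrite -mulr_suml ler_wpM2r// mulr_ge0// sqr_ge0.
apply: ler_sum => j _; rewrite ExpZ// (le_trans (ler_norm _))// normrM ler_wpM2l//.
apply: le_trans (Erow i j); apply: Exp_norm_le => //; exact: measurable_funM.
Qed.

Definition fsum w := \sum_k phi (X k w).

Let iuX l k : intg P (fun w => u (X l w) * dphi (X k w)).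
Proof.
apply: (intg_le _ _ (intgD (intg_cst P 1) (intgD (im4 l) (im4 k)))) => [|w].
  by apply: measurable_funM; apply: measurableT_comp => //; exact: continuous_meas.
apply: le_trans (young4 (mm l w) (mm k w)); rewrite !normrM ler_pM//.
  by rewrite [leRHS]ger0_norm ?m_ge0// /mm /majorant -addrA lerDl !addr_ge0.
by rewrite [leRHS]ger0_norm ?m_ge0// /mm /majorant addrCA lerDl !addr_ge0.
Qed.

Let iphi1 : intg gauss phi.
Proof. exact: (@intg_expr4 _ _ _ gauss phi (continuous_meas phic)). Qed.

Let iu1 : intg gauss u.
Proof. exact: (@intg_expr4 _ _ _ gauss u (continuous_meas uc)). Qed.

Let iphiX i : intg P (fun w => phi (X i w)).
Proof. exact: (gauss_law_intg (mX i) (law i) phic).2 iphi1. Qed.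

Let iphi4 i : intg P (fun w => phi (X i w) ^+ 4).
Proof. exact: (gauss_law_intg (mX i) (law i) (continuous_exp phic)).2 iphi. Qed.

Let mphiX i : measurable_fun setT (fun w => phi (X i w)).
Proof. exact: intg_measurable (iphiX i). Qed.

Let mfsum : measurable_fun setT fsum.
Proof. exact: measurable_sum. Qed.

Lemma intg_fsum2 : intg P (fun w => fsum w ^+ 2).
Proof.
have E w : fsum w ^+ 2 = \sum_i \sum_j phi (X i w) * phi (X j w).
  by rewrite expr2 mulr_suml; under eq_bigr => i _ do rewrite mulr_sumr.
rewrite (funext E); apply: intg_sum => i; apply: intg_sum => j.
apply: (intg_le _ _ (intgD (intg_cst P 1) (intgD (iphi4 i) (iphi4 j)))) => [|w].
  exact: measurable_funM.
exact: young4.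
Qed.

Let intg_bounded_mul (a b : T -> R) D : intg P a -> measurable_fun setT b ->
  (forall w, `|b w| <= D) -> intg P (fun w => a w * b w).
Proof.
move=> ia mb bD; apply: (intg_le _ _ (intgZr D (intg_norm ia))) => [|w].
  by apply: measurable_funM => //; exact: intg_measurable ia.
by rewrite normrM ler_wpM2l.
Qed.

Let mcomp_fsum (g : R -> R) kap : continuous g ->
  measurable_fun setT (fun w => g (kap * fsum w)).
Proof.
move=> gc; apply: measurableT_comp (continuous_meas gc) _.
by apply: measurable_funM => //; exact: measurable_cst.
Qed.

Lemma stein_ibp (g dg : R -> R) (kap C D : R) : der g dg -> continuous dg ->
  (forall x, `|g x| <= C) -> (forall x, `|dg x| <= D) ->
  Exp P (fun w => fsum w * g (kap * fsum w)) =
  kap * Exp P (fun w => weight (X ^~ w) * dg (kap * fsum w)).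
Proof.
move=> gd dgc gC dgD; have gc := der_continuous gd.
have E1 w : fsum w * g (kap * fsum w) = \sum_l phi (X l w) * g (kap * fsum w).
  by rewrite mulr_suml.
have E2 w : weight (X ^~ w) * dg (kap * fsum w) =
    \sum_l \sum_k c l k * (u (X l w) * dphi (X k w) * dg (kap * fsum w)).
  rewrite mulr_suml; apply: eq_bigr => l _; rewrite mulr_suml.
  by apply: eq_bigr => k _; rewrite -mulrA.
have i2 l k : intg P (fun w => u (X l w) * dphi (X k w) * dg (kap * fsum w)).
  exact: (@intg_bounded_mul _ _ D (iuX l k) (mcomp_fsum kap dgc)).
rewrite (funext E1) (funext E2) Exp_sum; last first.
  by move=> l; exact: (@intg_bounded_mul _ _ C (iphiX l) (mcomp_fsum kap gc)).
rewrite Exp_sum; last by move=> l; apply: intg_sum => k; exact/intgZ/i2.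
rewrite mulr_sumr; apply: eq_bigr => l _.
rewrite (family_ibp (c1 l) csym fam kap phid dphic ud iphi1 iu1 gd dgc gC dgD) => //.
congr (_ * _); rewrite Exp_sum; last by move=> k; exact/intgZ/i2.
by apply: eq_bigr => k _; rewrite ExpZ.
Qed.

Let iweight : intg P (fun w => weight (X ^~ w)).
Proof. by apply: intg_sqr => //; exact: intg_weight2. Qed.

Lemma Exp_weight : Exp P (fun w => weight (X ^~ w)) = Exp P (fun w => fsum w ^+ 2).
Proof.
(* [stein_ibp] needs a bounded test function, so the identity is approximated by
   [x |-> M sin (x / M)]. *)
pose g k (x : R) : R := k.+1%:R * sin (k.+1%:R^-1 * x).
pose dg k (x : R) : R := cos (k.+1%:R^-1 * x).
have lin k : continuous (fun x : R => k.+1%:R^-1 * x).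
  by apply: continuous_mul; [exact: continuous_const|exact: continuous_idfun].
have gd k : der (g k) (dg k).
  move=> x; apply: is_derive_eq (is_derive_scale k.+1%:R (@is_derive_o _ _ sin
    (fun y => k.+1%:R^-1 * y) _ _ (is_derive_sin _)
    (is_derive_scale k.+1%:R^-1 (is_derive_idfun x)))) _.
  by rewrite mulr1 mulrCA mulfV ?mulr1 ?pnatr_eq0.
have dgc k : continuous (dg k) by apply: continuous_o => //; exact: continuous_cos.
have ibp k : Exp P (fun w => fsum w * g k (fsum w)) =
    Exp P (fun w => weight (X ^~ w) * dg k (fsum w)).
  have := @stein_ibp (g k) (dg k) 1 k.+1%:R 1 (gd k) (dgc k) _ _.
  rewrite mul1r; under [X in Exp P X = _]eq_fun do rewrite mul1r.
  under [X in _ = Exp P X]eq_fun do rewrite mul1r.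
  apply=> x; last exact: cos_max.
  by rewrite normrM ger0_norm// ler_piMr// sin_max.
have [||||_ H1] := @Exp_dct _ _ _ P (fun k w => fsum w * g k (fsum w))
    (fun w => fsum w ^+ 2) (fun w => fsum w ^+ 2).
- move=> k; apply: measurable_funM => //; apply: measurableT_comp => //.
  exact: continuous_meas (der_continuous (gd k)).
- by move=> w; rewrite expr2; apply: cvgM; [exact: cvg_cst|exact: scaled_sin_cvg].
- move=> k w; rewrite normrM -[leRHS]real_normK ?num_real// expr2.
  by rewrite ler_wpM2l// scaled_sin_le.
- exact: intg_fsum2.
have [||||_ H2] := @Exp_dct _ _ _ P (fun k w => weight (X ^~ w) * dg k (fsum w))
    (fun w => weight (X ^~ w)) (fun w => `|weight (X ^~ w)|).
- move=> k; apply: measurable_funM => //; apply: measurableT_comp => //.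
  exact: continuous_meas.
- move=> w; rewrite -[X in _ --> X]mulr1 -(@cos0 R); apply: cvgM; first exact: cvg_cst.
  exact: (cvg_comp _ _ (scaled_cvg0 (fsum w)) (@continuous_cos R 0)).
- by move=> k w; rewrite normrM ler_piMr// cos_max.
- exact: intg_norm.
apply: cvg_unique H2 _; first exact: Rhausdorff.
by rewrite (_ : (fun k => _) = fun k => Exp P (fun w => fsum w * g k (fsum w)))//;
  apply/funext => k; rewrite ibp.
Qed.

Lemma stein_bound (h : R -> R) (v t : R) : v = Exp P (fun w => fsum w ^+ 2) ->
  0 < v -> 0 < t -> continuous h -> (forall x, 0 <= h x <= 1) ->
  `|Exp P (fun w => h ((Num.sqrt v)^-1 * fsum w)) - Exp gauss h| <=
  t + 32 * (n%:R * (S ^+ 3 * moment4)) / v ^+ 2 / t.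
Proof.
move=> vE v0 t0 hc h01; set kap := (Num.sqrt v)^-1.
have ih : intg gauss h.
  apply: (intg_le _ _ (intg_cst gauss 1)) => [|x]; first exact: continuous_meas.
  by have := h01 x; rewrite ler_norml; lra.
have eh : 0 <= Exp gauss h <= 1.
  rewrite -[X in _ <= _ <= X](Exp_cst gauss 1) Exp_ge0/= => [|x]; last by case/andP: (h01 x).
  by apply: le_Exp => // [|x]; [exact: intg_cst|case/andP: (h01 x)].
pose psi x := h x - Exp gauss h.
have psic : continuous psi by apply: continuous_sub => //; exact: continuous_const.
have psi1 x : `|psi x| <= 1 by rewrite /psi ler_norml; have := h01 x; lra.
have psi0 : Exp gauss psi = 0.
  by rewrite /psi ExpB//; [rewrite Exp_cst subrr|exact: intg_cst].
have [g [gd g2 [C gC]]] := stein_bounded psic psi1 psi0.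
set dg := (fun x => x * g x - psi x) in gd g2.
have gc := der_continuous gd.
have dgc : continuous dg.
  by apply: continuous_sub => //; apply: continuous_mul => //; exact: continuous_idfun.
have kap2 : kap * kap = v^-1 by rewrite -expr2 exprVn sqr_sqrtr// ltW.
pose Y w := kap * fsum w.
have iY : intg P Y.
  by apply: intgZ; apply: intg_sqr => //; exact: intg_fsum2.
have iYg : intg P (fun w => Y w * g (Y w)).
  exact: (@intg_bounded_mul _ _ C iY (mcomp_fsum kap gc)).
have idg : intg P (fun w => dg (Y w)).
  by apply: (intg_le _ _ (intg_cst P 2)) => [|w]; [exact: (mcomp_fsum kap dgc)|exact: g2].
have ihY : intg P (fun w => h (Y w)).
  apply: (intg_le _ _ (intg_cst P 1)) => [|w]; first exact: (mcomp_fsum kap hc).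
  by have := h01 (Y w); rewrite ler_norml; lra.
have iWdg : intg P (fun w => weight (X ^~ w) * dg (Y w)).
  exact: (@intg_bounded_mul _ _ 2 iweight (mcomp_fsum kap dgc) (fun w => g2 _)).
have ibp : Exp P (fun w => Y w * g (Y w)) =
    v^-1 * Exp P (fun w => weight (X ^~ w) * dg (Y w)).
  have := stein_ibp kap gd dgc gC g2; rewrite -/Y => e.
  rewrite -kap2 -mulrA -e -ExpZ//; last first.
    apply: (@intg_bounded_mul _ _ C) => //; last exact: (mcomp_fsum kap gc).
    by apply: intg_sqr => //; exact: intg_fsum2.
  by congr Exp; apply/funext => w; rewrite mulrA.
pose V w := v^-1 * weight (X ^~ w) - 1.
have iV : intg P V by apply: intgB; [exact: intgZ|exact: intg_cst].
have mV : measurable_fun setT V by exact: intg_measurable iV.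
(* Stein's equation turns the difference into the expectation of Y g(Y) - g'(Y); the integration by
   parts replaces the first term by W g'(Y) / v. *)
have diff : Exp P (fun w => h (Y w)) - Exp gauss h = Exp P (fun w => V w * dg (Y w)).
  have E w : V w * dg (Y w) = v^-1 * (weight (X ^~ w) * dg (Y w)) - dg (Y w).
    by rewrite /V mulrBl mul1r mulrA.
  rewrite (funext E) ExpB//; last exact: intgZ.
  rewrite ExpZ// -ibp -ExpB//.
  have F w : Y w * g (Y w) - dg (Y w) = h (Y w) - Exp gauss h by rewrite /dg /psi; ring.
  by rewrite (funext F) ExpB// ?Exp_cst//; exact: intg_cst.
have iV2 : intg P (fun w => V w ^+ 2).
  have E w : V w ^+ 2 = v^-1 ^+ 2 * weight (X ^~ w) ^+ 2 -
      2 * v^-1 * weight (X ^~ w) + 1 by rewrite /V; ring.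
  rewrite (funext E); apply: intgD; last exact: intg_cst.
  by apply: intgB; apply: intgZ => //; exact: intg_weight2.
have EV2 : Exp P (fun w => V w ^+ 2) <= 32 * (n%:R * (S ^+ 3 * moment4)) / v ^+ 2.
  have E w : V w ^+ 2 = v^-1 ^+ 2 * (weight (X ^~ w) - Exp P (fun w => weight (X ^~ w))) ^+ 2.
    rewrite Exp_weight -vE /V -exprMn mulrBr mulVf// gt_eqF//.
  have ic : intg P (fun w => (weight (X ^~ w) - Exp P (fun w => weight (X ^~ w))) ^+ 2).
    have := intgZ (v ^+ 2) iV2; congr intg; apply/funext => w.
    by rewrite E exprVn mulVKf// expf_neq0// gt_eqF.
  rewrite (funext E) ExpZ// variance_centered//; last exact: intg_weight2.
  by rewrite mulrC exprVn ler_wpM2r ?invr_ge0 ?sqr_ge0// variance_weight.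
rewrite diff.
(* Since |g'| <= 2, the integrand is at most 2 |V| <= t + V^2 / t. The free parameter [t] replaces
   the square root of the Cauchy-Schwarz inequality. *)
apply: le_trans (_ : Exp P (fun w => t + V w ^+ 2 * t^-1) <= _).
  apply: Exp_norm_le.
  - by apply: measurable_funM => //; exact: (mcomp_fsum kap dgc).
  - move=> w; rewrite normrM.
    apply: le_trans (_ : `|V w| * 2 <= _); first by rewrite ler_wpM2l//; exact: g2.
    rewrite -[V w ^+ 2]real_normK ?num_real// -subr_ge0.
    have -> : t + `|V w| ^+ 2 / t - `|V w| * 2 = (t - `|V w|) ^+ 2 / t.
      by field; rewrite gt_eqF.
    by rewrite mulr_ge0 ?sqr_ge0// invr_ge0 ltW.
  - by apply: intgD; [exact: intg_cst|exact: intgZr].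
rewrite ExpD ?Exp_cst; [|exact: intg_cst|exact: intgZr].
by rewrite lerD2l ExpZr// ler_wpM2r// invr_ge0 ltW.
Qed.

End SteinBound.

(** * The stationary sequence *)

Section Stationarity.
Context (R : realType) d (T : measurableType d) (P : probability T R).

(** Stationarity only compares probabilities of rectangles; these form a generating family stable
    under intersection, hence determine the joint law. *)
Lemma pair_law (U V U' V' : T -> R) :
  measurable_fun setT U -> measurable_fun setT V ->
  measurable_fun setT U' -> measurable_fun setT V' ->
  (forall A B : set R, measurable A -> measurable B ->
    P (U @^-1` A `&` V @^-1` B) = P (U' @^-1` A `&` V' @^-1` B)) ->
  forall C : set (R * R), measurable C ->
  P ((fun w => (U w, V w)) @^-1` C) = P ((fun w => (U' w, V' w)) @^-1` C).
Proof.
move=> mU mV mU' mV' H.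
have mp := measurable_fun_pair mU mV; have mp' := measurable_fun_pair mU' mV'.
pose J : {mfun T >-> (R * R)%type} := HB.pack (fun w => (U w, V w))
  (isMeasurableFun.Build _ _ _ _ _ mp).
pose J' : {mfun T >-> (R * R)%type} := HB.pack (fun w => (U' w, V' w))
  (isMeasurableFun.Build _ _ _ _ _ mp').
move=> C mC; rewrite -[LHS]/(distribution P J C) -[RHS]/(distribution P J' C).
pose G : set (set (R * R)) := [set A `*` B | A in measurable & B in measurable].
apply: (measure_unique G (fun=> setT)) => //.
- exact: measurable_prod_measurableType.
- move=> _ _ [A mA [B mB <-]] [A' mA' [B' mB' <-]].
  exists (A `&` A'); first exact: measurableI.
  by exists (B `&` B'); [exact: measurableI|rewrite setXI].
- by move=> _; exists setT => //; exists setT => //; rewrite setXTT.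
- by rewrite bigcup_const//; exists 0%N.
- by move=> _ [A mA [B mB <-]]; exact: H.
- by move=> _; apply: le_lt_trans (probability_le1 (distribution P J) measurableT) (ltry 1).
Qed.

Lemma stationary_covariance (X : int -> T -> R) :
  (forall k, measurable_fun setT (X k)) -> stationary P X ->
  forall k l h, Exp P (fun w => X (k + h) w * X (l + h) w) =
    Exp P (fun w => X k w * X l w).
Proof.
move=> mX st k l h.
apply: (@transfer_Exp _ _ _ _ _ _ _ P P (fun w => (X (k + h) w, X (l + h) w))
  (fun w => (X k w, X l w)) _ _ _ (fun z => z.1 * z.2)).
- exact: measurable_fun_pair.
- exact: measurable_fun_pair.
- apply: pair_law => // A B mA mB.
  pose K (i : 'I_2) := if i == ord0 then k else l.
  pose C (i : 'I_2) := if i == ord0 then A else B.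
  have E (Y : int -> T -> R) (K' : 'I_2 -> int) :
      \bigcap_(i in setT) Y (K' i) @^-1` C i =
      Y (K' ord0) @^-1` A `&` Y (K' ord_max) @^-1` B.
    apply/seteqP; split=> [w H|w [a b] i _]; first by split; [exact: (H ord0)|exact: (H ord_max)].
    have [->|->//] : i = ord0 \/ i = ord_max by
      case: i => -[|[|//]] ?; [left|right]; exact/val_inj.
    exact: a.
  have := st 2%N K h C; rewrite (E X (fun i => K i + h)) (E X K); apply.
  by move=> i; rewrite /C; case: ifP.
- by apply: measurable_funM; [exact: measurable_fst|exact: measurable_snd].
Qed.

End Stationarity.

Lemma injective_sum_le_esum (R : realType) (I : choiceType) (n : nat)
    (a : I -> \bar R) (e : 'I_n -> I) : injective e -> (forall i, 0 <= a i)%E ->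
  (\sum_(j < n) a (e j) <= \esum_(i in [set: I]) a i)%E.
Proof.
move=> ie a0; apply: esum_ge.
pose r := [seq e j | j <- enum 'I_n].
exists [set` r]; first by split.
rewrite -fsbig_seq; last by rewrite map_inj_uniq ?enum_uniq.
by rewrite big_map big_enum.
Qed.

Section Expectation.
Context (R : realType) d (T : measurableType d) (P : probability T R).

Lemma fine_expectation (X : T -> R) : fine ('E_P[X])%E = Exp P X.
Proof. by rewrite unlock. Qed.

Lemma intg_expectation (X : T -> R) : measurable_fun setT X ->
  (forall w, 0 <= X w) -> ('E_P[X] < +oo)%E -> intg P X.
Proof.
move=> mX X0; rewrite unlock => h; apply/integrableP; split; first exact/measurable_EFinP.
rewrite (_ : (fun x => _) = EFin \o X)//.
by apply/funext => w; rewrite /= ger0_norm.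
Qed.

Lemma variance_expectation (X : T -> R) : Exp P X = 0 ->
  'V_P[X]%E = ('E_P[(fun w => (X w ^+ 2)%R)])%E.
Proof.
move=> X0; rewrite /variance unlock fine_expectation X0.
congr expectation; apply/funext => w.
by rewrite /= -[LHS]/((X w - 0) * (X w - 0)) subr0 expr2.
Qed.

Lemma variance_EFin (X : T -> R) : Exp P X = 0 -> intg P (fun w => X w ^+ 2) ->
  'V_P[X]%E = (Exp P (fun w => X w ^+ 2))%:E.
Proof. by move=> /variance_expectation -> /ExpE <-; rewrite unlock. Qed.

Lemma intg_variance (X : T -> R) : measurable_fun setT X -> Exp P X = 0 ->
  ('V_P[X] < +oo)%E -> intg P (fun w => X w ^+ 2).
Proof.
move=> mX /variance_expectation -> h.
by apply: intg_expectation h => [|w]; [exact: measurable_funX|exact: sqr_ge0].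
Qed.

Lemma standard_normal_law (X : T -> R) : has_gaussian_law P X 0 1 ->
  forall A : set R, measurable A -> P (X @^-1` A) = gauss R A.
Proof.
by move=> law A mA; apply: etrans (law A mA) _; rewrite /gaussian_law oner_eq0 sqrtr1.
Qed.

End Expectation.

Lemma abs_probability_sub_le1 (R : realType) d (T : measurableType d)
    (P : probability T R) d' (T' : measurableType d') (Q : probability T' R)
    (A : set T) (B : set T') : measurable A -> measurable B ->
  (`|P A - Q B| <= 1)%E.
Proof.
move=> mA mB.
have := probability_le1 P mA; have := probability_le1 Q mB.
rewrite -(fineK (fin_num_measure P _ mA)) -(fineK (fin_num_measure Q _ mB)).
rewrite -EFinB abse_EFin !lee_fin ler_norml.
have := fine_ge0 (measure_ge0 P A); have := fine_ge0 (measure_ge0 Q B); lra.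
Qed.

Lemma der_derive1 (R : realType) (f : R -> R) :
  (forall x : R, derivable f x 1) -> der f f^`()%classic.
Proof. by move=> fd x; rewrite derive1E; exact/derivableP. Qed.

Section StationarySequence.
Context (R : realType) d (T : measurableType d) (P : probability T R).
Variable X : int -> {RV P >-> R}.
Hypotheses (hgauss : gaussian_family P (fun k => X k : T -> R))
  (hstat : stationary P (fun k => X k : T -> R))
  (hcent : forall k : int, ('E_P[X k] = 0)%E)
  (hvar : forall k : int, ('V_P[X k] = 1)%E)
  (hrho : (\esum_(nu in [set: int])
     `|correlation P (fun k => X k : T -> R) nu| < +oo)%E).

Let mX k : measurable_fun setT (X k : T -> R).
Proof. exact: measurable_funPT. Qed.

Let EX k : Exp P (X k) = 0.
Proof. by rewrite -fine_expectation hcent. Qed.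

Let iX2 k : intg P (fun w => X k w ^+ 2).
Proof. by apply: intg_variance => //; rewrite hvar ltry. Qed.

Let VX k : Exp P (fun w => X k w ^+ 2) = 1.
Proof. by rewrite -fine_expectation -variance_expectation// hvar. Qed.

Lemma marginal_law k (A : set R) : measurable A -> P (X k @^-1` A) = gauss R A.
Proof.
have [m [v [v0 law]]] := hgauss (fun _ : 'I_1 => k) (fun=> 1).
have E : (fun w => \sum_(i < 1) 1 * X k w) = X k :> (T -> R).
  by apply/funext => w; rewrite big_ord1 mul1r.
have {}law : has_gaussian_law P (X k) m v by move=> B mB; rewrite -E; exact: law.
have [m0 v1] := gaussian_params (mX k) v0 law (iX2 k) (EX k).
by apply: standard_normal_law; rewrite -m0 -(VX k) -v1.
Qed.

(** Ordinals start at 0 and the sums at k = 1, hence the shift. *)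
Definition sample n (i : 'I_n) : T -> R := X i.+1%:Z.
Definition sample_cov n (i j : 'I_n) : R := Exp P (fun w => sample i w * sample j w).

Lemma sample_fam n : gauss_fam P (@sample n) (@sample_cov n).
Proof.
apply: gaussian_family_gauss_fam => [i|a|i|i]; [exact: mX| |exact: iX2|exact: EX].
exact: (hgauss (fun i : 'I_n => i.+1%:Z) a).
Qed.

Lemma sample_cov1 n (i : 'I_n) : sample_cov i i = 1.
Proof.
by rewrite -(VX i.+1%:Z); congr Exp; apply/funext => w; rewrite expr2.
Qed.

Let iXX k l : intg P (fun w => X k w * X l w).
Proof.
apply: (intg_le _ _ (intgD (iX2 k) (iX2 l))) => [|w]; first exact: measurable_funM.
have := sqr_ge0 (X k w - X l w); have := sqr_ge0 (X k w + X l w).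
rewrite sqrrB sqrrD ler_norml.
have := sqr_ge0 (X k w); have := sqr_ge0 (X l w); lra.
Qed.

Lemma sample_cov_psd n : psd (@sample_cov n).
Proof.
split=> [i j|a].
  by congr Exp; apply/funext => w; rewrite mulrC.
rewrite (_ : \sum_i _ = Exp P (fun w => (\sum_i a i * sample i w) ^+ 2)).
  by apply: Exp_ge0 => w; exact: sqr_ge0.
have E w : (\sum_i a i * sample i w) ^+ 2 =
    \sum_i \sum_j a i * a j * (sample i w * sample j w).
  rewrite expr2 mulr_suml; apply: eq_bigr => i _.
  by rewrite mulr_sumr; apply: eq_bigr => j _; ring.
rewrite (funext E) Exp_sum; last first.
  by move=> i; apply: intg_sum => j; exact/intgZ/iXX.
apply: eq_bigr => i _; rewrite Exp_sum; last by move=> j; exact/intgZ/iXX.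
by apply: eq_bigr => j _; rewrite ExpZ//; exact: iXX.
Qed.

Definition abs_cov_sum : R :=
  fine (\esum_(nu in [set: int]) `|correlation P (fun k => X k : T -> R) nu|)%E.

(** By stationarity the covariance depends only on j - i, and j |-> j - i is injective, so a row is
    part of the series of all absolute correlations. The bound is thus uniform in [i] and [n]. *)
Lemma sample_cov_sum n (i : 'I_n) : \sum_j `|sample_cov i j| <= abs_cov_sum.
Proof.
have c0 nu : (0 <= `|correlation P (fun k => X k : T -> R) nu|)%E by exact: abse_ge0.
have E j : (`|sample_cov i j|)%:E =
    `|correlation P (fun k => X k : T -> R) (j%:Z - i%:Z)|%E.
  rewrite /correlation unlock ExpE//= -(stationary_covariance mX hstat _ _ i.+1%:Z).
  rewrite add0r; have -> : j%:Z - i%:Z + i.+1%:Z = j.+1%:Z by rewrite !intS; ring.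
  by [].
rewrite -lee_fin -sumEFin fineK; last first.
  by rewrite ge0_fin_numE//; apply: esum_ge0 => nu _.
under eq_bigr => j _ do rewrite E.
apply: (@injective_sum_le_esum R int n _ (fun j => j%:Z - i%:Z)) => // j k /addIr[].
exact: val_inj.
Qed.

End StationarySequence.

Lemma normalized_sumE (R : realType) d (T : measurableType d) (P : probability T R)
    (f : R -> R) (X : int -> {RV P >-> R}) (m : R) n w :
  (forall k, Exp P (fun w => f (X k w)) = m) ->
  normalized_sum P f (fun k => X k : T -> R) n w =
  (Num.sqrt n%:R)^-1 * fsum (sample X (n := n)) (fun x => f x - m) w.
Proof.
move=> fX; rewrite /normalized_sum; congr (_ * _).
rewrite big_add1 big_mkord; apply: eq_bigr => i _.
by rewrite fine_expectation fX.
Qed.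

Theorem corollary4p3 (R : realType)
  (d : measure_display) (T : measurableType d) (P : probability T R)
  (d' : measure_display) (T' : measurableType d') (Q : probability T' R)
  (N : {RV Q >-> R}) (hN : has_gaussian_law Q N 0 1)
  (B : R -> {RV P >-> R}) (hB : two_sided_brownian_motion B)
  (X : int -> {RV P >-> R}) (K : int -> R -> R)
  (hgauss : gaussian_family P (fun k => X k : T -> R))
  (hstat : stationary P (fun k => X k : T -> R))
  (hcent : forall k : int, ('E_P[X k] = 0)%E)
  (hvar : forall k : int, ('V_P[X k] = 1)%E)
  (hK : forall k : int, K k \in Lfun lebesgue_measure 2%:E)
  (hX : forall k : int,
     is_wiener_integral P (fun t => B t : T -> R) (K k) (X k))
  (hrho : (\esum_(nu in [set: int])
             `|correlation P (fun k => X k : T -> R) nu| < +oo)%E)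
  (f : R -> R) (hf : class_C2 f)
  (hf0 : ('E_Q[(fun w => `|f (N w)|)%R] < +oo)%E)
  (hf2 : ('E_Q[(fun w => `|(f^`()^`())%classic (N w)| ^+ 4)%R] < +oo)%E)
  (g : R -> R) (mg : measurable_fun setT g)
  (hKg : forall k : int,
     {ae lebesgue_measure, forall x : R, `|K k x| <= g (k%:~R - x)})
  (hg : (\int[lebesgue_measure]_y (g y)%:E < +oo)%E)
  (F : nat -> T -> R)
  (hF : F = normalized_sum P f (fun k => X k : T -> R))
  (hlim : exists2 s : R, 0 < s & 'V_P[F n]%E @[n --> \oo] --> s%:E) :
  exists C : R, forall n : nat, (1 <= n)%N -> (0 < 'V_P[F n])%E ->
    (dTV P (fun w => F n w / Num.sqrt (fine 'V_P[F n]))%R Q N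
      <= (C / Num.sqrt n%:R)%:E)%E.
Proof.
have [fd fdd ddc] := hf; have fder := der_derive1 fd; have fder2 := der_derive1 fdd.
have fc := der_continuous fder; have dfc := der_continuous fder2.
set df := f^`()%classic in fder fder2 dfc; set ddf := (df^`())%classic in fder2 ddc.
have mN : measurable_fun setT (N : T' -> R) by exact: measurable_funPT.
have NL := standard_normal_law hN.
have ifg : intg (gauss R) f.
  have mfN : measurable_fun setT (fun w => f (N w)).
    exact: measurableT_comp (continuous_meas fc) mN.
  apply/(gauss_law_intg mN NL fc); apply: (intg_le _ (fun w => lexx `|f (N w)|)) => //.
  by apply: intg_expectation hf0 => //; exact: measurableT_comp.
have iddf : intg (gauss R) (fun x => ddf x ^+ 4).
  apply/(gauss_law_intg mN NL (continuous_exp ddc)).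
  have E w : ddf (N w) ^+ 4 = `|ddf (N w)| ^+ 4.
    by rewrite -normrX ger0_norm// expr4_ge0.
  rewrite (funext E); apply: intg_expectation hf2 => [|w]; last exact: expr4_ge0.
  apply: measurable_funX; apply: measurableT_comp => //.
  by apply: measurableT_comp mN; exact: continuous_meas.
pose m0 := Exp (gauss R) f; pose phi x := f x - m0.
have phid : der phi df.
  by move=> x; apply: is_derive_eq (is_derive_sub (fder x) (is_derive_const x m0)) _;
    rewrite subr0.
have idf := L4_primitive fder2 ddc iddf.
have iphi := L4_primitive phid dfc idf.
have phi0 : Exp (gauss R) phi = 0.
  by rewrite /phi ExpB//; [rewrite Exp_cst subrr|exact: intg_cst].
have [u [ud iu idu]] := stein_L4 phid dfc idf phi0.
have law := marginal_law hgauss hcent hvar.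
have mX k : measurable_fun setT (X k : T -> R) by exact: measurable_funPT.
have fX k : Exp P (fun w => f (X k w)) = m0.
  exact: (gauss_law_Exp (mX k) (@law k) fc).
pose S := abs_cov_sum X; pose M := moment4 phi df ddf u.
pose D := 32 * (S ^+ 3 * M).
pose fs n := fsum (sample X (n := n)) phi.
have FE n w : F n w = (Num.sqrt n%:R)^-1 * fs n w.
  by rewrite hF; exact: normalized_sumE.
have fam := sample_fam hgauss hcent hvar.
have lawn n i (A : set R) (mA : measurable A) : P (sample X (n := n) i @^-1` A) = gauss R A.
  exact: law.
pose v n := Exp P (fun w => fs n w ^+ 2).
have ifs2 n : intg P (fun w => fs n w ^+ 2).
  exact: (@intg_fsum2 _ _ _ P n _ _ (fam n) (lawn n) _ _ phid iphi).
have phic := der_continuous phid.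
have iphiX k : intg P (fun w => phi (X k w)).
  by apply/(gauss_law_intg (mX k) (@law k) phic)/intgB => //; exact: intg_cst.
have Efs n : Exp P (fs n) = 0.
  rewrite /fs /fsum Exp_sum => [|i]; last exact: iphiX.
  apply: big1 => i _; rewrite -phi0.
  exact: (gauss_law_Exp (mX i.+1%:Z) (@law i.+1%:Z) phic).
have mfs n : measurable_fun setT (fs n).
  by apply: measurable_sum => i; exact: intg_measurable (iphiX _).
have VF n : 'V_P[F n]%E = (n%:R^-1 * v n)%:E.
  have FE2 w : F n w ^+ 2 = n%:R^-1 * fs n w ^+ 2.
    by rewrite FE exprMn exprVn sqr_sqrtr.
  rewrite variance_EFin.
  - by rewrite (funext FE2) ExpZ.
  - by rewrite (funext (FE n)) ExpZ ?Efs ?mulr0//; exact: intg_sqr.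
  - by rewrite (funext FE2); exact: intgZ.
have D0 : 0 <= D.
  rewrite mulr_ge0// mulr_ge0//; last by apply: Exp_ge0 => x; exact: expr4_ge0.
  by rewrite exprn_ge0// fine_ge0// esum_ge0.
have bound n : (0 < n)%N -> 0 < v n -> forall A : set R, measurable A ->
    (`|P ((fun w => (F n w / Num.sqrt (fine 'V_P[F n]))%R) @^-1` A) - Q (N @^-1` A)| <=
      ((1 + D / (n%:R^-1 * v n) ^+ 2) / Num.sqrt n%:R)%R%:E)%E.
  move=> n0 vn0.
  have nR : 0 < n%:R :> R by rewrite ltr0n.
  have sn0 : 0 < Num.sqrt n%:R :> R by rewrite sqrtr_gt0.
  have UE w : F n w / Num.sqrt (fine 'V_P[F n]) = (Num.sqrt (v n))^-1 * fs n w.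
    rewrite FE VF /= sqrtrM ?invr_ge0// sqrtrV// invfM invrK.
    by rewrite mulrAC !mulrA mulVf ?gt_eqF// mul1r.
  rewrite (funext UE).
  (* The right-hand side is the bound of [stein_bound] at t = 1 / sqrt n. Written with the variance
     v / n of [F n], its second term is also of order 1 / sqrt n. *)
  have -> : (1 + D / (n%:R^-1 * v n) ^+ 2) / Num.sqrt n%:R =
      (Num.sqrt n%:R)^-1 + 32 * (n%:R * (S ^+ 3 * M)) / v n ^+ 2 / (Num.sqrt n%:R)^-1.
    have nE : n%:R = Num.sqrt n%:R ^+ 2 :> R by rewrite sqr_sqrtr.
    move: sn0 nE; set a := Num.sqrt _ => a0 ->; rewrite /D; field.
    by rewrite !gt_eqF.
  apply: tv_le_continuous => //.
    by apply: measurable_funM => //; exact: measurable_cst.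
  move=> h hc h01; rewrite (gauss_law_Exp mN NL hc).
  have H := stein_bound (sample_cov_psd hcent hvar n) (@sample_cov1 _ _ _ _ X hcent hvar n)
    (@sample_cov_sum _ _ _ _ X hstat hcent hvar hrho n) (fam n) (lawn n) phid fder2 ddc ud
    iphi idf iddf iu idu.
  by apply: H => //; rewrite invr_gt0.
have [s s0 Vs] := hlim.
have [n0 _ n0P] : \forall n \near \oo, s / 2 <= n%:R^-1 * v n.
  have := fine_cvg Vs; rewrite (_ : fine \o _ = fun n => n%:R^-1 * v n); last first.
    by apply/funext => n; rewrite /= VF.
  by move=> cv; apply: (@cvgr_ge R _ \oo _ _ s (cv _)); lra.
(* From [n0] on the variance of [F n] is at least s / 2, which yields the first two terms. For the
   finitely many smaller [n] the distance is at most 1, and the last term makes the bound at least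
   1. *)
exists (1 + D / (s / 2) ^+ 2 + Num.sqrt n0%:R) => n n1 V0.
have sn0 : 0 < Num.sqrt n%:R :> R by rewrite sqrtr_gt0 ltr0n.
have vn0 : 0 < v n by move: V0; rewrite VF lte_fin pmulr_rgt0// invr_gt0 ltr0n.
have sD : 0 <= D / (s / 2) ^+ 2 by rewrite divr_ge0// sqr_ge0.
apply: ge_ereal_sup => _ [A mA <-]; have [n0n|nn0] := leqP n0 n.
  apply: le_trans (bound n n1 vn0 A mA) _.
  rewrite lee_fin ler_wpM2r ?invr_ge0 ?sqrtr_ge0//.
  rewrite -addrA lerD2l; apply: le_trans (_ : D / (s / 2) ^+ 2 <= _); last first.
    by rewrite lerDl sqrtr_ge0.
  have s2 : 0 < s / 2 by lra.
  have sv := n0P n n0n.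
  rewrite ler_wpM2l// lef_pV2 ?posrE ?exprn_gt0//; last exact: lt_le_trans sv.
  by rewrite lerXn2r ?nnegrE//; lra.
apply: le_trans (_ : 1 <= _)%E.
  apply: abs_probability_sub_le1; rewrite -[_ @^-1` _]setTI.
    suff mU : measurable_fun setT (fun w => F n w / Num.sqrt (fine 'V_P[F n])) by exact: mU.
    apply: measurable_funM; last exact: measurable_cst.
    by rewrite (funext (FE n)); apply: measurable_funM => //; exact: measurable_cst.
  exact: mN.
rewrite lee_fin ler_pdivlMr// mul1r.
apply: le_trans (_ : Num.sqrt n0%:R <= _); first by apply: ler_wsqrtr; rewrite ler_nat ltnW.
by rewrite lerDr addr_ge0// ler01.
Qed.
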